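(* The inverse orbit map $\mathcal{M}(\mathbb{B})\to\mathbb{B}$ given by $\mathcal{F}\mapsto\mathcal{F}^{-1}(0)$ yields a globally trivial principal fiber bundle with structure group $\mathcal{M}(\mathbb{B})_0\simeq\mathrm{Sp}(1)$ for its left action on $\mathcal{M}(\mathbb{B})$ given by $(\mathcal{F}_0,\mathcal{F})\mapsto\mathcal{F}_0\circ\mathcal{F}$.
   Context: $\mathbb{H}$ denotes the quaternions and $\mathbb{B}=\{q\in\mathbb{H}: |q|<1\}$. $\mathrm{Sp}(1,1)=\{A\in M_2(\mathbb{H}): A^*I_{1,1}A=I_{1,1}\}$ with $I_{1,1}=\operatorname{diag}(1,-1)$, a Lie group. $\mathrm{Sp}(1)=\{q\in\mathbb{H}:|q|=1\}$, and $\mathrm{Sp}(1)I_2=\{uI_2:u\in\mathrm{Sp}(1)\}$, a closed subgroup of $\mathrm{Sp}(1,1)$. A function $f:\mathbb{B}\to\mathbb{H}$ is (left) slice regular if for every $I\in\mathbb{H}$ with $I^2=-1$ one has $\frac12\left(\frac{\partial}{\partial x}+I\frac{\partial}{\partial y}\right)f(x+Iy)=0$ whenever $x,y\in\mathbb{R}$, $x+yI\in\mathbb{B}$. Such functions have power series expansions $f(q)=\sum_n q^na_n$ on $\mathbb{B}$. For $f(q)=\sum q^na_n$ and $g(q)=\sum q^nb_n$, the $*$-product is $(f*g)(q)=\sum_n q^n\sum_{k=0}^n a_kb_{n-k}$; the regular conjugate is $f^c(q)=\sum q^n\overline{a_n}$; the symmetrization is $f^s=f*f^c$; the $*$-reciprocal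 is $f^{-*}(q)=f^s(q)^{-1}f^c(q)$ off the zero set of $f^s$. For $a,b\in\mathbb{H}$ let $l_{(a,b)}(q)=qa+b$. For $A=\begin{pmatrix}a&c\\ b&d\end{pmatrix}\in\mathrm{Sp}(1,1)$, the slice regular M\''obius transformation $\mathcal{F}_A:\mathbb{B}\to\mathbb{B}$ is $\mathcal{F}_A=l_{(c,d)}^{-*}*l_{(a,b)}$, written $\mathcal{F}_A(q)=(qc+d)^{-*}*(qa+b)$. Set $\mathcal{M}(\mathbb{B})=\{\mathcal{F}_A:A\in\mathrm{Sp}(1,1)\}$. Each $\mathcal{F}_A$ is a well defined slice regular bijection of $\mathbb{B}$ onto itself; $\mathcal{F}^{-1}$ denotes the inverse map of the bijection $\mathcal{F}:\mathbb{B}\to\mathbb{B}$. Manifold structure: $\mathrm{Sp}(1,1)/\mathrm{Sp}(1)I_2$ carries the unique manifold structure for which the quotient map from $\mathrm{Sp}(1,1)$ is a submersion, and $\mathcal{M}(\mathbb{B})$ carries the manifold structure for which the bijection $\mathrm{Sp}(1,1)/\mathrm{Sp}(1)I_2\to\mathcal{M}(\mathbb{B})$, $A\,\mathrm{Sp}(1)I_2\mapsto\mathcal{F}_{A^{-1}}$, is a diffeomorphism. $\mathcal{M}(\mathbb{B})_0=\{\mathcal{F}\in\mathcal{M}(\mathbb{B}):\mathcal{F}(0)=0\}=\{R_u:u\in\mathrm{Sp}(1)\}$, with $R_u(q)=qu$. It is a compact submanifold of $\mathcal{M}(\mathbb{B})$ and a Lie group under composition, and $u\mapsto R_{u^{-1}}$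 is a Lie group isomorphism $\mathrm{Sp}(1)\to\mathcal{M}(\mathbb{B})_0$. A principal fiber bundle with structure Lie group $G$ acting on the left consists of smooth manifolds $P$, $M$ and a map $\pi:P\to M$ such that: (1) $\pi$ is a submersion, i.e. a surjective smooth map with surjective differential at every point; (2) there is a free and proper smooth left $G$-action on $P$ whose orbits are precisely the fibers of $\pi$; (3) for every $p\in M$ there are an open $U\ni p$ in $M$ and a $G$-equivariant diffeomorphism $\varphi_U:U\times G\to\pi^{-1}(U)$ (with $G$ acting on the factor $G$ of $U\times G$ by left translations) such that $\pi\circ\varphi_U$ is the projection onto $U$. It is globally trivial if one can take $U=M$ in (3); equivalently, if $\pi$ has a smooth global section. *)

(* Defs.v *)
From HB Require Import structures.
From mathcomp Require Import all_boot all_order all_algebra.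
From mathcomp Require Import all_classical all_reals all_analysis.
From mathcomp Require Import ring lra.

Set Implicit Arguments.
Unset Strict Implicit.
Unset Printing Implicit Defensive.

Import Order.TTheory GRing.Theory Num.Theory.
Import numFieldNormedType.Exports.

Local Open Scope classical_set_scope.
Local Open Scope ring_scope.

(* [Ck k U f]: on the open set [U], [f] has Frechet differentiable iterated
   directional derivatives up to order [k - 1], and those of order [k] are
   continuous. *)
Fixpoint Ck (R : realType) (V W : normedModType R) (k : nat) (U : set V)
    (f : V -> W) : Prop :=
  if k is k'.+1 then
    (forall x, U x -> differentiable f x) /\
    (forall v : V, Ck k' U (fun x => 'D_v f x))
  else forall x, U x -> {for x, continuous f}.

Definition Cinfty (R : realType) (V W : normedModType R) (U : set V)
    (f : V -> W) : Prop := forall k, Ck k U f.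

(* Only the restriction of [cmap] to [cdom] and that of [cinv] to the image of
   [cdom] are meaningful. *)
Record chart (R : realType) (T : Type) (n : nat) := Chart {
  cdom : set T;
  cmap : T -> 'rV[R]_n;
  cinv : 'rV[R]_n -> T }.

Record atlas (R : realType) (T : Type) := Atlas {
  adim : nat;
  acharts : set (chart R T adim) }.

Arguments acharts {R T} a _.

(* The carrier [T] with the topology generated by the sets
   [dom(phi) `&` phi^-1(V)], for [phi] a chart and [V] open. *)
Definition mspace (R : realType) (T : choiceType) (S : atlas R T) : Type := T.

Section mspace_topology.
Context (R : realType) (T : choiceType) (S : atlas R T).

Definition mspace_subbase : set (set T) :=
  [set cdom c `&` cmap c @^-1` V | c in acharts S & V in open].

HB.instance Definition _ := Choice.copy (mspace S) T.
HB.instance Definition _ :=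
  isSubBaseTopological.Build (mspace S) mspace_subbase id.

End mspace_topology.

Section manifolds.
Context (R : realType).
Implicit Types T : choiceType.

Definition is_manifold T (S : atlas R T) : Prop :=
  [/\ (forall c, acharts S c ->
        {in cdom c, cancel (cmap c) (cinv c)} /\ open (cmap c @` cdom c)),
      (forall c c', acharts S c -> acharts S c' ->
        let W := cmap c @` (cdom c `&` cdom c') in
        open W /\ Cinfty W (cmap c' \o cinv c)),
      (forall x, exists2 c, acharts S c & cdom c x),
      hausdorff_space (mspace S) &
      @second_countable (mspace S)].

(* [D] is meant to be open; the openness of [W] expresses continuity. *)
Definition smooth_on T T' (S : atlas R T) (S' : atlas R T') (D : set T)
    (f : T -> T') : Prop :=
  forall c c', acharts S c -> acharts S' c' ->
    let W := cmap c @` (cdom c `&` D `&` f @^-1` cdom c') in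
    open W /\ Cinfty W (cmap c' \o f \o cinv c).

Definition smooth T T' (S : atlas R T) (S' : atlas R T') (f : T -> T') : Prop :=
  smooth_on S S' setT f.

Definition diffeomorphism T T' (S : atlas R T) (S' : atlas R T')
    (f : T -> T') : Prop :=
  smooth S S' f /\
  exists g : T' -> T, [/\ cancel f g, cancel g f & smooth S' S g].

Definition chart_diff T T' n n' (c : chart R T n) (c' : chart R T' n')
    (f : T -> T') (x : T) : 'rV[R]_n -> 'rV[R]_n' :=
  'd (cmap c' \o f \o cinv c) (cmap c x).

Definition submersion T T' (S : atlas R T) (S' : atlas R T')
    (f : T -> T') : Prop :=
  [/\ smooth S S' f, set_surj setT setT f &
      forall x c c', acharts S c -> acharts S' c' -> cdom c x ->
        cdom c' (f x) -> set_surj setT setT (chart_diff c c' f x)].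

(* Injective immersion that is a homeomorphism onto its image; for [f] the
   inclusion of a subset, this says that [S] is the structure of an embedded
   submanifold. *)
Definition embedding T T' (S : atlas R T) (S' : atlas R T')
    (f : T -> T') : Prop :=
  [/\ smooth S S' f, injective f,
      (forall x c c', acharts S c -> acharts S' c' -> cdom c x ->
        cdom c' (f x) -> injective (chart_diff c c' f x)) &
      forall U : set T, open (U : set (mspace S)) ->
        exists2 V : set T', open (V : set (mspace S')) & U = f @^-1` V].

Definition prod_chart T T' n n' (c : chart R T n) (c' : chart R T' n') :
    chart R (T * T')%type (n + n') :=
  Chart (cdom c `*` cdom c')
        (fun p => row_mx (cmap c p.1) (cmap c' p.2))
        (fun v => (cinv c (lsubmx v), cinv c' (rsubmx v))).

Definition prod_atlas T T' (S : atlas R T) (S' : atlas R T') :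
    atlas R (T * T')%type :=
  Atlas [set prod_chart c c' | c in acharts S & c' in acharts S'].

Definition single_chart T n (D : set T) (phi : T -> 'rV[R]_n)
    (psi : 'rV[R]_n -> T) : atlas R T :=
  Atlas [set Chart D phi psi].

Definition is_group (G : Type) (mul : G -> G -> G) (one : G) (inv : G -> G) :=
  [/\ associative mul, left_id one mul, right_id one mul,
      left_inverse one inv mul & right_inverse one inv mul].

Definition is_lie_group (G : choiceType) (SG : atlas R G)
    (mul : G -> G -> G) (one : G) (inv : G -> G) : Prop :=
  [/\ is_manifold SG, is_group mul one inv,
      smooth (prod_atlas SG SG) SG (fun p => mul p.1 p.2) &
      smooth SG SG inv].

Definition is_lie_isomorphism (G G' : choiceType)
    (SG : atlas R G) (mul : G -> G -> G)
    (SG' : atlas R G') (mul' : G' -> G' -> G') (f : G -> G') : Prop :=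
  (forall g h, f (mul g h) = mul' (f g) (f h)) /\ diffeomorphism SG SG' f.

(* A continuous map is proper when preimages of compact sets are compact. *)
Record is_free_proper_smooth_action (G P : choiceType)
    (SG : atlas R G) (mul : G -> G -> G) (one : G)
    (SP : atlas R P) (act : G -> P -> P) : Prop := {
  action_one : forall p, act one p = p;
  action_mul : forall g h p, act (mul g h) p = act g (act h p);
  action_smooth : smooth (prod_atlas SG SP) SP (fun gp => act gp.1 gp.2);
  action_free : forall g p, act g p = p -> g = one;
  action_proper : forall K : set (P * P),
    compact (K : set (mspace (prod_atlas SP SP))) ->
    compact ([set gp | K (act gp.1 gp.2, gp.2)]
             : set (mspace (prod_atlas SG SP))) }.

(* An equivariant diffeomorphism [phi : U * G -> pi^-1(U)] over [U]; only the
   restrictions of [phi] to [U * G] and of its inverse [psi] to [pi^-1(U)]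
   matter. *)
Definition is_trivialization (P M G : choiceType)
    (SP : atlas R P) (SM : atlas R M) (SG : atlas R G) (mul : G -> G -> G)
    (act : G -> P -> P) (pi : P -> M) (U : set M) (phi : M * G -> P) : Prop :=
  [/\ (forall x g, U x -> pi (phi (x, g)) = x),
      (forall x g h, U x -> phi (x, mul g h) = act g (phi (x, h))),
      smooth_on (prod_atlas SM SG) SP (U `*` setT) phi &
      exists psi : P -> M * G,
        [/\ (forall x g, U x -> psi (phi (x, g)) = (x, g)),
            (forall p, U (pi p) -> U (psi p).1 /\ phi (psi p) = p) &
            smooth_on SP (prod_atlas SM SG) (pi @^-1` U) psi]].

Record is_principal_bundle (P M G : choiceType)
    (SP : atlas R P) (SM : atlas R M)
    (SG : atlas R G) (mul : G -> G -> G) (one : G) (inv : G -> G)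
    (act : G -> P -> P) (pi : P -> M) : Prop := {
  bundle_total : is_manifold SP;
  bundle_base : is_manifold SM;
  bundle_group : is_lie_group SG mul one inv;
  bundle_proj : submersion SP SM pi;
  bundle_action : is_free_proper_smooth_action SG mul one SP act;
  bundle_orbits : forall p p', pi p = pi p' <-> exists g, p' = act g p;
  bundle_local : forall x : M, exists U : set M,
    [/\ open (U : set (mspace SM)), U x &
        exists phi, is_trivialization SP SM SG mul act pi U phi] }.

Definition is_globally_trivial (P M G : choiceType)
    (SP : atlas R P) (SM : atlas R M) (SG : atlas R G) (mul : G -> G -> G)
    (act : G -> P -> P) (pi : P -> M) : Prop :=
  exists phi, is_trivialization SP SM SG mul act pi setT phi.

End manifolds.

(* The row [q] stands for [q_0 + q_1 i + q_2 j + q_3 k]. The normed space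
   structure of ['rV[R]_4] is deliberately not inherited, as it is given by the
   sup norm. *)
Definition quat (R : realType) : Type := 'rV[R]_4.

Section quaternions.
Context (R : realType).
Local Notation H := (quat R).

HB.instance Definition _ := GRing.Lmodule.copy H 'rV[R]_4.
HB.instance Definition _ := PointedTopological.copy H 'rV[R]_4.

Definition qcoord (q : H) (k : nat) : R := (q : 'rV[R]_4) 0 (inord k).

Definition mkquat (a b c d : R) : H := (\row_i [:: a; b; c; d]`_i : 'rV[R]_4).

Definition qmul (p q : H) : H :=
  let a0 := qcoord p 0 in let a1 := qcoord p 1 in
  let a2 := qcoord p 2 in let a3 := qcoord p 3 in
  let b0 := qcoord q 0 in let b1 := qcoord q 1 in
  let b2 := qcoord q 2 in let b3 := qcoord q 3 in
  mkquat (a0 * b0 - a1 * b1 - a2 * b2 - a3 * b3)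
         (a0 * b1 + a1 * b0 + a2 * b3 - a3 * b2)
         (a0 * b2 - a1 * b3 + a2 * b0 + a3 * b1)
         (a0 * b3 + a1 * b2 - a2 * b1 + a3 * b0).

Definition qconj (q : H) : H :=
  mkquat (qcoord q 0) (- qcoord q 1) (- qcoord q 2) (- qcoord q 3).

Definition qnormsq (q : H) : R :=
  qcoord q 0 ^+ 2 + qcoord q 1 ^+ 2 + qcoord q 2 ^+ 2 + qcoord q 3 ^+ 2.

Definition qnorm (q : H) : R := Num.sqrt (qnormsq q).

Definition qinv (q : H) : H := (qnormsq q)^-1 *: qconj q.

Lemma qcoord_mk a b c d :
  (qcoord (mkquat a b c d) 0 = a) * (qcoord (mkquat a b c d) 1 = b) *
  (qcoord (mkquat a b c d) 2 = c) * (qcoord (mkquat a b c d) 3 = d).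
Proof. by rewrite /qcoord /mkquat !mxE !inordK. Qed.

Lemma qcoordD p q k : qcoord (p + q) k = qcoord p k + qcoord q k.
Proof. by rewrite /qcoord mxE. Qed.

Lemma qcoordZ a p k : qcoord (a *: p) k = a * qcoord p k.
Proof. by rewrite /qcoord mxE. Qed.

Lemma qcoord0 k : qcoord 0 k = 0.
Proof. by rewrite /qcoord mxE. Qed.

Lemma quatP (p q : H) :
  qcoord p 0 = qcoord q 0 -> qcoord p 1 = qcoord q 1 ->
  qcoord p 2 = qcoord q 2 -> qcoord p 3 = qcoord q 3 -> p = q.
Proof.
move=> e0 e1 e2 e3; apply/rowP => i; rewrite -(inord_val i).
by case: i => [[|[|[|[|]]]]].
Qed.

Let qE := (qcoord_mk, qcoordD, qcoordZ, qcoord0).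

Lemma qmulA : associative qmul.
Proof. by move=> p q r; apply: quatP; rewrite /qmul !qE; ring. Qed.

Lemma qmul1l : left_id (mkquat 1 0 0 0) qmul.
Proof. by move=> p; apply: quatP; rewrite /qmul !qE; ring. Qed.

Lemma qmul1r : right_id (mkquat 1 0 0 0) qmul.
Proof. by move=> p; apply: quatP; rewrite /qmul !qE; ring. Qed.

Lemma qmulDl : left_distributive qmul +%R.
Proof. by move=> p q r; apply: quatP; rewrite /qmul !qE; ring. Qed.

Lemma qmulDr : right_distributive qmul +%R.
Proof. by move=> p q r; apply: quatP; rewrite /qmul !qE; ring. Qed.

Lemma qone_neq0 : mkquat 1 0 0 0 != 0 :> H.
Proof.
by apply/eqP => /(congr1 (qcoord^~ 0)); rewrite !qE => /eqP; rewrite oner_eq0.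
Qed.

HB.instance Definition _ := GRing.Zmodule_isNzRing.Build H
  qmulA qmul1l qmul1r qmulDl qmulDr qone_neq0.

Lemma qnormsq_eq0 q : (qnormsq q == 0) = (q == 0).
Proof.
apply/idP/eqP => [|->]; last by rewrite /qnormsq !qE !expr0n /= !addr0.
rewrite /qnormsq !paddr_eq0 ?addr_ge0 ?sqr_ge0// !sqrf_eq0.
by move=> /andP[/andP[/andP[/eqP ? /eqP ?] /eqP ?] /eqP ?]; apply: quatP;
  rewrite qcoord0.
Qed.

Lemma qmulVq : {in [pred q : H | q != 0], left_inverse 1 qinv *%R}.
Proof.
move=> q /=; rewrite inE -qnormsq_eq0 => q0; apply: quatP;
by move: q0; rewrite /GRing.mul /GRing.one /= /qmul /qinv /qconj !qE /qnormsq;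
  move=> ?; field.
Qed.

Lemma qmulqV : {in [pred q : H | q != 0], right_inverse 1 qinv *%R}.
Proof.
move=> q /=; rewrite inE -qnormsq_eq0 => q0; apply: quatP;
by move: q0; rewrite /GRing.mul /GRing.one /= /qmul /qinv /qconj !qE /qnormsq;
  move=> ?; field.
Qed.

Lemma qunitP (p q : H) : q * p = 1 /\ p * q = 1 -> [pred q : H | q != 0] p.
Proof.
move=> [_ pq1] /=; apply/eqP => p0; move: pq1 (oner_neq0 H).
by rewrite p0 mul0r => <-; rewrite eqxx.
Qed.

Lemma qinv_out : {in [predC [pred q : H | q != 0]], qinv =1 id}.
Proof.
move=> q; rewrite !inE negbK => /eqP ->.
by apply: quatP; rewrite /qinv /qconj !qE ?oppr0 mulr0.
Qed.

HB.instance Definition _ := GRing.NzRing_hasMulInverse.Build H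
  qmulVq qmulqV qunitP qinv_out.

Lemma qnormM (p q : H) : qnorm (p * q) = qnorm p * qnorm q.
Proof.
rewrite /qnorm -sqrtrM; last by rewrite /qnormsq !addr_ge0 ?sqr_ge0.
congr Num.sqrt; rewrite (_ : p * q = qmul p q)//.
by rewrite /qnormsq /qmul !qE; ring.
Qed.

Definition quat_atlas : atlas R H :=
  single_chart [set: H] (fun q => q : 'rV[R]_4) (fun v => v).

Definition qball : set H := [set q | qnorm q < 1].

Definition qpseries (a : nat -> H) (q : H) : H :=
  limn (series (fun n => q ^+ n * a n)).

Definition has_expansion (f : H -> H) (a : nat -> H) : Prop :=
  forall q, qball q -> series (fun n => q ^+ n * a n) @ \oo --> f q.

(* The coefficients of the expansion, which are unique when they exist. *)
Definition qcoefs (f : H -> H) : nat -> H :=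
  xget (fun=> 0) [set a | has_expansion f a].

Definition star_mul (f g : H -> H) : H -> H :=
  qpseries (fun n => \sum_(k < n.+1) qcoefs f k * qcoefs g (n - k)%N).

Definition reg_conj (f : H -> H) : H -> H :=
  qpseries (fun n => qconj (qcoefs f n)).

Definition symmetrization (f : H -> H) : H -> H := star_mul f (reg_conj f).

Definition star_inv (f : H -> H) : H -> H :=
  fun q => (symmetrization f q)^-1 * reg_conj f q.

Definition affine (a b : H) : H -> H := fun q => q * a + b.

Definition adjmx (A : 'M[H]_2) : 'M[H]_2 := (map_mx qconj A)^T.

Definition I11 : 'M[H]_2 := diag_mx (\row_i (-1) ^+ (i : nat)).

Definition Sp11 : set 'M[H]_2 := [set A | adjmx A *m I11 *m A = I11].

(* M_2(H) identified with R^16 through the real coordinates of the entries. *)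
Definition qmx_coords (A : 'M[H]_2) : 'rV[R]_(2 * 2 * 4) :=
  mxvec (\matrix_(i < 2 * 2) (mxvec A 0 i : 'rV[R]_4)).

Definition qmx_of_coords (v : 'rV[R]_(2 * 2 * 4)) : 'M[H]_2 :=
  vec_mx (\row_(i < 2 * 2) (row i (vec_mx v) : H)).

Definition qmx_atlas : atlas R 'M[H]_2 :=
  single_chart [set: 'M[H]_2] qmx_coords qmx_of_coords.

Definition Sp11_inv (A : Sp11) : Sp11 :=
  xget A [set B | val A *m val B = 1%:M /\ val B *m val A = 1%:M].

Definition Sp1 : set H := [set u | qnorm u = 1].

Lemma Sp1_mul_subproof (u v : Sp1) : val u * val v \in Sp1.
Proof.
apply/mem_set; rewrite /Sp1 /= qnormM.
by rewrite (set_mem (valP u)) (set_mem (valP v)) mulr1.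
Qed.

Definition Sp1_mul (u v : Sp1) : Sp1 :=
  exist (fun x => x \in Sp1) _ (Sp1_mul_subproof u v).

Definition coset (A : Sp11) : set Sp11 :=
  [set B | exists u : Sp1, val B = val A *m (val u)%:M].

(* Sp(1,1) / Sp(1) I_2, as the set of left cosets. *)
Definition Sp11_quot : set (set Sp11) := range coset.

Definition Sp11_proj (A : Sp11) : Sp11_quot :=
  exist (fun X => X \in Sp11_quot) (coset A) (mem_set (imageT coset A)).

Lemma qball0 : 0 \in qball.
Proof.
apply/mem_set; rewrite /qball /= /qnorm.
have /eqP -> : qnormsq 0 == 0 by rewrite qnormsq_eq0.
by rewrite sqrtr0 ltr01.
Qed.

Definition origin : qball := exist (fun q => q \in qball) 0 qball0.

Definition qball_atlas : atlas R qball :=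
  single_chart [set: qball] (fun q => val q : 'rV[R]_4)
    (fun v => insubd origin (v : H)).

(* F_A(q) = (q c + d)^{-*} * (q a + b), for A = (a c; b d). *)
Definition mobius_fun (A : 'M[H]_2) : H -> H :=
  star_mul (star_inv (affine (A 0 1) (A 1 1))) (affine (A 0 0) (A 1 0)).

(* F_A as a self-map of the ball; since F_A maps the ball into itself, the
   default value of [insubd] is never used. *)
Definition mobius (A : Sp11) : qball -> qball :=
  fun q => insubd origin (mobius_fun (val A) (val q)).

Definition Mob : set (qball -> qball) := range mobius.

(* The map A Sp(1) I_2 |-> F_{A^-1}, computed on a representative. *)
Definition mobius_of_coset (X : Sp11_quot) : Mob :=
  let A := sval (cid2 (set_mem (valP X))) in
  exist (fun F => F \in Mob) (mobius (Sp11_inv A))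
    (mem_set (imageT mobius (Sp11_inv A))).

Definition Mob0 : set Mob := [set F | val F origin = origin].

(* F |-> F^-1(0), for the inverse of the bijection F of the ball. *)
Definition inverse_orbit (F : Mob) : qball :=
  'pinv_(fun=> origin) [set: qball] (val F) origin.

End quaternions.

Arguments Sp11 : clear implicits.
Arguments Sp1 : clear implicits.
Arguments Sp11_quot : clear implicits.
Arguments qball : clear implicits.
Arguments Mob : clear implicits.
Arguments Mob0 : clear implicits.
Arguments Sp11_proj : clear implicits.
Arguments mobius_of_coset : clear implicits.
Arguments Sp1_mul : clear implicits.
Arguments inverse_orbit : clear implicits.

(* Main.v *)
Require Import Defs.
From HB Require Import structures.
From mathcomp Require Import all_boot all_order all_algebra.
From mathcomp Require Import all_classical all_reals all_analysis.
From mathcomp Require Import ring lra.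
Set Implicit Arguments.
Unset Strict Implicit.
Unset Printing Implicit Defensive.
Import Order.TTheory GRing.Theory Num.Theory.
Import numFieldNormedType.Exports.
Local Open Scope classical_set_scope.
Local Open Scope ring_scope.

(** In the product coordinates of the ball and of Sp(1) everything is explicit.
    If A has entries (a c; b d), the transformation of the inverse of A is
        q |-> M_al(q) x,  where  M_al(q) = (1 - q conj(al))^{-*} * (q - al),
    al = b d^{-1} lies in the ball and x = conj(a d^{-1}) is a unit quaternion
    ([mobius_inv_val]). The map M_al preserves the ball and vanishes at al only
    ([mob_model_ball], [mob_model_eq0]). Hence (al, x) |-> [mob al x] is a
    bijection from the product of the ball and Sp(1) onto the set of Moebius
    transformations, the inverse orbit map reads off al
    ([inverse_orbit_mob]), and composing with the rotation q |-> q u on the left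
    replaces x by x u ([mob_comp]). In these coordinates the inverse orbit map is
    a projection, the transformations fixing 0 are the rotations, and they act
    by translation of the fibres.

    The formulas for M_al come from power series. The regular reciprocal of
    q c + d, defined by the symmetrization, is the sum of the series whose
    coefficients solve d e_0 = 1, d e_{n+1} + c e_n = 0
    ([star_inv_expansion]); the product with an affine function is then explicit
    ([star_mul_affine], [mobius_funE]). Replacing q by its conjugate
    T = g^{-1} q g with g = 1 - q al turns M_al(q) into the value at T of the
    classical transformation (1 - T conj(al))^{-1} (T - al) ([mob_modelE]), to
    which the usual identity for the disc applies.

    It remains to see that the bijection is a diffeomorphism, the manifold
    structures being known only through embeddings, one submersion and one
    diffeomorphism. Two universal properties suffice. A map into an
    embedded submanifold is smooth as soon as it is smooth into the ambient
    manifold ([embedding_lift]); a map out of the base of a submersion is smooth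
    as soon as its pullback is ([submersion_descent]). Both are local statements
    about open sets of R^n. The first one says that a continuous map is smooth
    when its composite with an immersion is ([Cinfty_immersion_lift]); the
    second one needs a local section of a submersion, obtained from the
    contraction principle ([local_inverse]). By descent, al and x are smooth
    functions of the transformation because b d^{-1} and conj(a d^{-1}) are smooth
    on Sp(1,1) ([smooth_mob_data]). Conversely [mob al x] depends smoothly on
    (al, x) because it is the class of the explicit matrix [boost]
    ([smooth_mob]).

    The action is proper because (F', F) |-> (F_0, F), with F' = F_0 o F, is
    continuous on the closed set of pairs in a common fibre: preimages of compact
    sets are images of compact sets. *)

(** * Calculus of continuously differentiable maps *)

Section CkCalculus.
Context (R : realType).
Implicit Types V W : normedModType R.

Lemma near_eq_differentiable V W (f g : V -> W) (x : V) :
  {near x, f =1 g} -> differentiable f x -> differentiable g x.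
Proof.
move=> fg df; have fgx : f x = g x := nbhs_singleton fg.
have dfx := diff_locallyx df.
have [_ fe] := (diff_locallyxP x f).1 df.
have fg0 : \forall h \near (0 : V), g (h + x) = f (h + x).
  have := fg; rewrite (near_shift 0 x) subr0 /= => H.
  by apply: filterS H => h /= ->.
have := @diff_unique _ _ _ g ('d f x) x.
have dc : continuous ('d f x) by exact: diff_continuous.
have gE : g \o shift x = cst (g x) + 'd f x +o_ (0 : V) id.
  apply/eqaddoP => e e0 /=.
  have /eqaddoP/(_ e e0) : f \o shift x = cst (f x) + 'd f x +o_ (0 : V) id.
    exact: diff_locally.
  move=> /= H; near=> h.
  have -> : (g \o shift x - (cst (g x) + 'd f x)) h =
    (f \o shift x - (cst (f x) + 'd f x)) h.
    rewrite /= !fctE /= -fgx.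
    suff -> : g (h + x) = f (h + x) by [].
    by near: h.
  by near: h.
move=> /(_ dc gE) gd.
apply/diff_locallyP; rewrite gd.
by split.
Unshelve. all: by end_near. Qed.

Lemma Ck_sub k V W (U U' : set V) (f : V -> W) :
  U `<=` U' -> Ck k U' f -> Ck k U f.
Proof.
elim: k f => [|k IH] f UU' /=; first by move=> + x /UU'; apply.
by move=> [d D]; split=> [x /UU' /d//|v]; exact: IH (D v).
Qed.

Lemma Ck_continuous k V W (U : set V) (f : V -> W) :
  Ck k U f -> forall x, U x -> {for x, continuous f}.
Proof.
case: k => [//|k] [d _] x Ux.
exact/differentiable_continuous/d.
Qed.

Lemma CkW k V W (U : set V) (f : V -> W) : Ck k.+1 U f -> Ck k U f.
Proof.
elim: k f => [|k IH] f; first exact: Ck_continuous.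
by move=> [d D]; split=> // v; exact: IH (D v).
Qed.

Lemma Ck_eq k V W (U : set V) (f g : V -> W) : open U ->
  {in U, f =1 g} -> Ck k U f -> Ck k U g.
Proof.
move=> oU; elim: k f g => [|k IH] f g fg.
  move=> /= fc x Ux; rewrite /prop_for /continuous_at -(fg x (mem_set Ux)).
  apply: cvg_trans (fc x Ux).
  apply: near_eq_cvg; apply: filterS (open_nbhs_nbhs (conj oU Ux)) => y Uy.
  by rewrite fg// inE.
have nfg x : U x -> {near x, f =1 g}.
  move=> Ux; apply: filterS (open_nbhs_nbhs (conj oU Ux)) => y Uy.
  by rewrite fg// inE.
move=> [d D]; split.
  by move=> x Ux; apply: near_eq_differentiable (nfg x Ux) (d x Ux).
move=> v; apply: IH (D v) => x /set_mem Ux.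
exact: near_eq_derive (nfg x Ux).
Qed.

Lemma Ck_cst k V W (U : set V) (a : W) : Ck k U (cst a).
Proof.
elim: k a => [|k IH] a; first by move=> x _; exact: cst_continuous.
split; first by move=> x _; exact: differentiable_cst.
move=> v; rewrite (_ : (fun x => _) = cst 0); first exact: IH.
by apply/funext => x; rewrite derive_cst.
Qed.

Lemma CkD k V W (U : set V) (f g : V -> W) : open U ->
  Ck k U f -> Ck k U g -> Ck k U (f \+ g).
Proof.
move=> oU; elim: k f g => [|k IH] f g.
  by move=> fc gc x Ux; apply: continuousD; [exact: fc | exact: gc].
move=> [df Df] [dg Dg]; split.
  by move=> x Ux; apply: differentiableD; [exact: df|exact: dg].
move=> v; apply: (@Ck_eq _ _ _ _ ((fun x => 'D_v f x) \+ (fun x => 'D_v g x))) => //.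
  move=> x /set_mem Ux /=; rewrite deriveD//; apply: diff_derivable.
  - exact: df.
  - exact: dg.
exact: IH (Df v) (Dg v).
Qed.

(** Continuous linear maps are the only outer maps for which the chain rule
    needs no product rule; the coordinate-wise criterion [Ck_rV] is derived
    from this case. *)
Lemma Ck_lin k V W W' (U : set V) (f : V -> W) (L : {linear W -> W'}) :
  open U -> continuous L -> Ck k U f -> Ck k U (L \o f).
Proof.
move=> oU cL; elim: k f => [|k IH] f.
  by move=> fc x Ux; apply: continuous_comp; [exact: fc|exact: cL].
move=> [df Df]; split.
  move=> x Ux; apply: differentiable_comp; first exact: df.
  exact: linear_differentiable.
move=> v; apply: (@Ck_eq _ _ _ _ (L \o (fun x => 'D_v f x))) => //; last exact: IH (Df v).
move=> x /set_mem Ux /=; rewrite !deriveE.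
- have dL : differentiable L (f x) by exact: linear_differentiable.
  rewrite (diff_comp (df x Ux) dL) /=.
  by rewrite diff_lin.
- apply: differentiable_comp; first exact: df.
  exact: linear_differentiable.
- exact: df.
Qed.

Lemma Ck_id k V (U : set V) : Ck k U (@id V).
Proof.
case: k => [|k]; first by move=> x _; exact: cvg_id.
split=> [x _|v]; first exact: ex_diff.
rewrite (_ : (fun x => _) = cst v); first exact: Ck_cst.
by apply/funext => x; rewrite derive_id.
Qed.

Lemma CkM k V (U : set V) (f g : V -> R) : open U ->
  Ck k U f -> Ck k U g -> Ck k U (f \* g).
Proof.
move=> oU; elim: k f g => [|k IH] f g.
  by move=> fc gc x Ux; apply: continuousM; [exact: fc | exact: gc].
move=> fC gC; have [df Df] := fC; have [dg Dg] := gC; split.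
  by move=> x Ux; apply: differentiableM; [exact: df|exact: dg].
move=> v; apply: (@Ck_eq _ _ _ _
   ((f \* (fun x => 'D_v g x)) \+ (g \* (fun x => 'D_v f x)))) => //.
  move=> x /set_mem Ux /=; rewrite deriveM//; apply: diff_derivable.
  - exact: df.
  - exact: dg.
exact: CkD oU (IH _ _ (CkW fC) (Dg v)) (IH _ _ (CkW gC) (Df v)).
Qed.

Lemma CkMl k V (U : set V) (c : R) (f : V -> R) : open U ->
  Ck k U f -> Ck k U (fun x => c * f x).
Proof. by move=> oU; apply: (CkM oU (Ck_cst k U c)). Qed.

Lemma CkV k V (U : set V) (f : V -> R) : open U ->
  (forall x, U x -> f x != 0) -> Ck k U f -> Ck k U (fun x => (f x)^-1).
Proof.
move=> oU f0; elim: k f f0 => [|k IH] f f0.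
  by move=> fc x Ux; apply: continuousV; [exact: f0 | exact: fc].
move=> fC; have [df Df] := fC; split.
  by move=> x Ux; apply: differentiableV; [exact: df|exact: f0].
move=> v; apply: (@Ck_eq _ _ _ _
   ((cst (-1)) \* ((fun x => (f x)^-1) \* (fun x => (f x)^-1)) \* (fun x => 'D_v f x))) => //.
  move=> x /set_mem Ux /=; rewrite deriveV//; last 2 first.
  - exact: f0.
  - by apply: diff_derivable; exact: df.
  by rewrite /GRing.scale /= expr2 invfM mulN1r.
have fV : Ck k U (fun x => (f x)^-1) by apply: IH => //; exact: CkW.
exact: CkM oU (CkM oU (Ck_cst k U _) (CkM oU fV fV)) (Df v).
Qed.

Lemma Ck_sum k V W (U : set V) (I : Type) (r : seq I) (P : pred I) (f : I -> V -> W) :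
  open U -> (forall i, P i -> Ck k U (f i)) ->
  Ck k U (fun x => \sum_(i <- r | P i) f i x).
Proof.
move=> oU fC; elim: r => [|i r IH].
  rewrite (_ : (fun _ => _) = cst 0); first exact: Ck_cst.
  by apply/funext => x; rewrite big_nil.
have [Pi|nPi] := boolP (P i).
  rewrite (_ : (fun _ => _) = f i \+ (fun x => \sum_(i <- r | P i) f i x)).
    exact: CkD (fC i Pi) IH.
  by apply/funext => x; rewrite big_cons Pi.
rewrite (_ : (fun _ => _) = (fun x => \sum_(i <- r | P i) f i x))//.
by apply/funext => x; rewrite big_cons (negbTE nPi).
Qed.

Lemma Ck_prod k V (U : set V) (I : Type) (r : seq I) (P : pred I) (f : I -> V -> R) :
  open U -> (forall i, P i -> Ck k U (f i)) ->
  Ck k U (fun x => \prod_(i <- r | P i) f i x).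
Proof.
move=> oU fC; elim: r => [|i r IH].
  rewrite (_ : (fun _ => _) = cst 1); first exact: Ck_cst.
  by apply/funext => x; rewrite big_nil.
have [Pi|nPi] := boolP (P i).
  rewrite (_ : (fun _ => _) = f i \* (fun x => \prod_(i <- r | P i) f i x)).
    exact: CkM (fC i Pi) IH.
  by apply/funext => x; rewrite big_cons Pi.
rewrite (_ : (fun _ => _) = (fun x => \prod_(i <- r | P i) f i x))//.
by apply/funext => x; rewrite big_cons (negbTE nPi).
Qed.

Lemma Ck_coord k V n (U : set V) (f : V -> 'rV[R]_n) i : open U ->
  Ck k U f -> Ck k U (fun x => f x 0 i).
Proof.
move=> oU fC.
have lin : linear (fun M : 'rV[R]_n => M 0 i : R).
  by move=> a M N; rewrite !mxE.
pose L : {linear 'rV[R]_n -> R} :=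
  HB.pack (fun M : 'rV[R]_n => M 0 i) (GRing.isLinear.Build _ _ _ _ _ lin).
have := @Ck_lin k _ _ _ U f L oU; apply => //.
exact: coord_continuous.
Qed.

(** A vector is the sum of its coordinates times the basis vectors, so
    smoothness of vector-valued maps reduces to products and sums of scalar
    ones. *)
Lemma Ck_rV k V n (U : set V) (f : V -> 'rV[R]_n) : open U ->
  (forall i, Ck k U (fun x => f x 0 i)) -> Ck k U f.
Proof.
move=> oU fC.
rewrite (_ : f = fun x => \sum_i (f x 0 i *: delta_mx 0 i)); last first.
  by apply/funext => x; rewrite {1}[f x]row_sum_delta.
apply: Ck_sum => // i _.
pose w : 'rV[R]_n := delta_mx 0 i.
have cL : continuous ( *:%R^~ w : R -> 'rV[R]_n).
  by move=> x; apply: scalel_continuous.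
have lin : linear ( *:%R^~ w : R -> 'rV[R]_n).
  by move=> a x y; rewrite scalerDl scalerA.
pose L : {linear R -> 'rV[R]_n} :=
  HB.pack ( *:%R^~ w) (GRing.isLinear.Build _ _ _ _ _ lin).
exact: (@Ck_lin k _ _ _ U (fun x => f x 0 i) L oU cL (fC i)).
Qed.

(** The chain rule in partial derivatives: in this form the derivative of a
    composite is again made of sums, products and composites, which lets
    [Ck_compR] proceed by induction on the order. *)
Lemma derive_comp V n W (f : V -> 'rV[R]_n) (g : 'rV[R]_n -> W) (x v : V) :
  differentiable f x -> differentiable g (f x) ->
  'D_v (g \o f) x = \sum_i ('D_v f x 0 i *: 'D_(delta_mx 0 i) g (f x)).
Proof.
move=> df dg; rewrite deriveE; last exact: differentiable_comp.
rewrite diff_comp//= -(deriveE v df).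
rewrite [X in 'd g _ X](row_sum_delta ('D_v f x)) linear_sum.
by apply: eq_bigr => i _; rewrite linearZ -deriveE.
Qed.

Lemma Ck_compR k V n (U : set V) (O : set 'rV[R]_n) (f : V -> 'rV[R]_n)
    (g : 'rV[R]_n -> R) :
  open U -> (forall x, U x -> O (f x)) ->
  Ck k U f -> Ck k O g -> Ck k U (g \o f).
Proof.
move=> oU UO; elim: k f g UO => [|k IH] f g UO.
  by move=> fc gc x Ux; apply: continuous_comp; [exact: fc | exact/gc/UO].
move=> fC gC; have [df Df] := fC; have [dg Dg] := gC; split.
  by move=> x Ux; apply: differentiable_comp; [exact: df|exact/dg/UO].
move=> v; apply: (@Ck_eq _ _ _ _ (fun x =>
   \sum_i ('D_v f x 0 i * 'D_(delta_mx 0 i) g (f x)))) => //.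
  move=> x /set_mem Ux; rewrite derive_comp//; [exact: df|exact/dg/UO].
apply: Ck_sum => // i _; apply: (CkM oU (f := fun x => 'D_v f x 0 i)
  (g := (fun y => 'D_(delta_mx 0 i) g y) \o f)).
  exact: Ck_coord (Df v).
exact: IH UO (CkW fC) (Dg _).
Qed.

Lemma Ck_comp k V n m (U : set V) (O : set 'rV[R]_n) (f : V -> 'rV[R]_n)
    (g : 'rV[R]_n -> 'rV[R]_m) :
  open U -> open O -> (forall x, U x -> O (f x)) ->
  Ck k U f -> Ck k O g -> Ck k U (g \o f).
Proof.
move=> oU oO UO fC gC; apply: Ck_rV => // i.
exact: (Ck_compR oU UO fC (Ck_coord i oO gC)).
Qed.

Lemma Ck_sqrt k V (U : set V) (f : V -> R) : open U ->
  (forall x, U x -> 0 < f x) -> Ck k U f -> Ck k U (fun x => Num.sqrt (f x)).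
Proof.
move=> oU f0; elim: k f f0 => [|k IH] f f0.
  move=> fc x Ux; apply: (@continuous_comp _ _ _ f Num.sqrt); first exact: fc.
  exact: sqrt_continuous.
move=> fC; have [df Df] := fC.
have ds x : U x -> differentiable (Num.sqrt : R -> R) (f x).
  move=> Ux; apply/derivable1_diffP.
  by have [] := is_derive1_sqrt (f0 x Ux).
split.
  by move=> x Ux; apply: (@differentiable_comp _ _ _ _ f Num.sqrt); [exact: df|exact: ds].
move=> v; apply: (@Ck_eq _ _ _ _
   ((fun x => (2 * Num.sqrt (f x))^-1) \* (fun x => 'D_v f x))) => //.
  move=> x /set_mem Ux /=; rewrite [RHS]deriveE; last first.
    by apply: (@differentiable_comp _ _ _ _ f Num.sqrt); [exact: df|exact: ds].
  rewrite (@diff_comp _ _ _ _ f Num.sqrt _ (df x Ux) (ds x Ux)) /=.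
  rewrite -(deriveE v (df x Ux)) (diff1E (ds x Ux)).
  by rewrite derive1E derive_sqrt ?f0// mulrC.
have sC : Ck k U (fun x => Num.sqrt (f x)) := IH _ f0 (CkW fC).
have s2C : Ck k U (fun x => 2 * Num.sqrt (f x)).
  exact: (CkM oU (Ck_cst k U (2 : R)) sC).
apply: CkM (Df v) => //; apply: (CkV oU _ s2C).
by move=> x Ux; rewrite mulf_neq0// gt_eqF// sqrtr_gt0 f0.
Qed.

End CkCalculus.

(** * Lifting through immersions and local inversion *)

Section InverseFunction.
Context (R : realType).
Implicit Types V W : normedModType R.

Lemma Ck_mulmx k V n m (U : set V) (f : V -> 'rV[R]_n) (A : V -> 'M[R]_(n, m)) :
  open U -> Ck k U f -> (forall i j, Ck k U (fun x => A x i j)) ->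
  Ck k U (fun x => f x *m A x).
Proof.
move=> oU fC AC; apply: Ck_rV => // j.
rewrite (_ : (fun x => _) = (fun x => \sum_i f x 0 i * A x i j)); last first.
  by apply/funext => x; rewrite mxE.
apply: Ck_sum => // i _.
exact: (CkM oU (Ck_coord i oU fC) (AC i j)).
Qed.

Lemma mulmxr_continuous n m (A : 'M[R]_(n, m)) :
  continuous (mulmxr A : 'rV[R]_n -> 'rV[R]_m).
Proof.
move=> x; have := @Ck_mulmx 0 _ n m setT id (fun=> A) openT.
apply => //; first exact: Ck_id.
by move=> i j; apply: Ck_cst.
Qed.

Lemma Ck_det k V n (U : set V) (A : V -> 'M[R]_n) : open U ->
  (forall i j, Ck k U (fun x => A x i j)) -> Ck k U (fun x => \det (A x)).
Proof.
move=> oU AC; rewrite /determinant; apply: Ck_sum => // s _.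
by apply: CkMl => //; apply: Ck_prod.
Qed.

(** Cramer's rule expresses the inverse by determinants. *)
Lemma Ck_invmx k V n (U : set V) (A : V -> 'M[R]_n) : open U ->
  (forall x, U x -> \det (A x) != 0) ->
  (forall i j, Ck k U (fun x => A x i j)) ->
  forall i j, Ck k U (fun x => invmx (A x) i j).
Proof.
move=> oU dA AC i j.
apply: (@Ck_eq _ _ _ _ _ ((fun x => (\det (A x))^-1) \* (fun x => cofactor (A x) j i))) => //.
  by move=> x /set_mem Ux; rewrite /invmx unitmxE unitfE (dA x Ux) !mxE.
apply: CkM => //; first by apply: CkV => //; exact: Ck_det.
apply: CkMl => //; apply: Ck_det => // i' j'.
by rewrite (_ : (fun x => _) = (fun x => A x (lift j i') (lift i j')))//;
  apply/funext => x; rewrite !mxE.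
Qed.

(** Vectors are rows, so the differential is right multiplication by this
    matrix: the gradients are its columns. *)
Definition jacobian_mx n m (f : 'rV[R]_n -> 'rV[R]_m) (x : 'rV[R]_n) :=
  \matrix_(i < n, j < m) 'D_(delta_mx 0 i) f x 0 j.

Lemma derive_jacobian_mx n m (f : 'rV[R]_n -> 'rV[R]_m) x v :
  differentiable f x -> 'd f x v = v *m jacobian_mx f x.
Proof.
move=> df; rewrite {1}[v]row_sum_delta linear_sum; apply/rowP => j.
rewrite summxE !mxE; apply: eq_bigr => i _.
by rewrite linearZ -deriveE// !mxE.
Qed.

Lemma open_neq0 V (U : set V) (f : V -> R) : open U -> Ck 0 U f ->
  open [set x | U x /\ f x != 0].
Proof.
move=> oU fC; rewrite openE => x [Ux fx0].
have nU := open_nbhs_nbhs (conj oU Ux).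
have nf : \forall y \near x, f y != 0.
  have n0 : nbhs (f x) [set y : R | y != 0].
    exact: open_nbhs_nbhs (conj (@open_neq R 0) fx0).
  exact: (fC x Ux _ n0).
by rewrite /interior; near=> y; split; near: y.
Unshelve. all: by end_near. Qed.

(** If k o g and k are differentiable, the differential A of k at g x being
    invertible, then D = g (x + h) - g x satisfies w = D A + o(D) = d(k o g) h
    + o(h), where w is the increment of k o g. Solving for D gives D = df h +
    o(h) + o(D) with df = d(k o g) A^{-1}, and the term o(D) is absorbed into
    the left-hand side since |D| <= |df h| + |D - df h|. *)
Lemma differentiable_of_comp V n (g : V -> 'rV[R]_n) (k : 'rV[R]_n -> 'rV[R]_n) x :
  {for x, continuous g} -> differentiable k (g x) -> differentiable (k \o g) x ->
  \det (jacobian_mx k (g x)) != 0 ->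
  differentiable g x /\
  forall v, 'd g x v = 'd (k \o g) x v *m invmx (jacobian_mx k (g x)).
Proof.
move=> gc dk dkg; set A := jacobian_mx k (g x) => A0.
have Au : A \in unitmx by rewrite unitmxE unitfE.
pose df := mulmxr (invmx A) \o 'd (k \o g) x.
have cdf : continuous df.
  move=> y; apply: continuous_comp; first exact: (diff_continuous dkg).
  exact: mulmxr_continuous.
have [C C0 HC] := linear_lipschitz (@mulmxr_continuous n n (invmx A)).
have [M M0 HM] := linear_lipschitz cdf.
have gE : g \o shift x = cst (g x) + df +o_ (0 : V) id.
  apply/eqaddoP => e e0 /=.
  (* With these bounds |E| <= (e/2) |h| + |E| / 2 for the error E below. *)
  pose e2 := e / (4 * C).
  have e20 : 0 < e2 by rewrite divr_gt0// mulr_gt0.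
  pose e1 := Num.min ((2 * C)^-1) (e / (4 * C * M)).
  have e10 : 0 < e1 by rewrite lt_min invr_gt0 divr_gt0 ?mulr_gt0.
  have e1a : C * e1 <= 1/2.
    apply: (@le_trans _ _ (C * (2 * C)^-1)); first by rewrite ler_pM2l// ge_min lexx.
    by rewrite invfM mulrCA divff ?gt_eqF// mulr1 div1r.
  have e1b : C * e1 * M <= e / 4.
    apply: (@le_trans _ _ (C * (e / (4 * C * M)) * M)).
      by rewrite ler_pM2r// ler_pM2l// ge_min lexx orbT.
    by rewrite le_eqVlt; apply/orP; left; apply/eqP; field; rewrite !gt_eqF.
  have /eqaddoP/(_ e1 e10) H1 := diff_locally dk.
  have /eqaddoP/(_ e2 e20) H2 := diff_locally dkg.
  have {}H1 : \forall h \near (0 : V),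
    `|k (g (h + x)) - k (g x) - 'd k (g x) (g (h + x) - g x)| <= e1 * `|g (h + x) - g x|.
    have cD : (fun h : V => g (h + x) - g x) @ (0 : V) --> (0 : 'rV[R]_n).
      rewrite -(subrr (g x)); apply: cvgB; last exact: cvg_cst.
      have cS : (fun h : V => h + x) @ (0 : V) --> x.
        rewrite -[X in _ --> X](add0r x).
        by apply: cvgD; [exact: cvg_id|exact: cvg_cst].
      exact: cvg_comp cS gc.
    have := cD _ H1; rewrite /nbhs /= /nbhs /=; apply: filterS => h /=.
    by rewrite !fctE /= subrK opprD addrA.
  near=> h.
  have h1 : `|k (g (h + x)) - k (g x) - 'd k (g x) (g (h + x) - g x)| <= e1 * `|g (h + x) - g x|.
    by near: h.
  have h2 : `|k (g (h + x)) - k (g x) - 'd (k \o g) x h| <= e2 * `|h|.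
    rewrite -addrA -opprD.
    by near: h; apply: H2.
  rewrite !fctE /= opprD addrA.
  move: h1 h2; rewrite (derive_jacobian_mx _ dk) -/A.
  set D := g (h + x) - g x; set w := k _ - k _ => h1 h2.
  rewrite -/(df h).
  set E := D - df h.
  have EE : E = (w - 'd (k \o g) x h - (w - D *m A)) *m invmx A.
    rewrite /E opprB [X in X *m _]addrC addrA subrK mulmxBl.
    by rewrite -mulmxA mulmxV// mulmx1.
  have le1 : `|E| <= C * (e2 * `|h| + e1 * `|D|).
    rewrite EE; apply: le_trans (HC _) _; rewrite ler_pM2l//.
    exact: le_trans (ler_normB _ _) (lerD h2 h1).
  have le2 : `|D| <= M * `|h| + `|E|.
    by rewrite -[D](subrK (df h)) addrC; apply: le_trans (ler_normD _ _) (lerD (HM _) _).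
  have Ce2 : C * e2 = e / 4 by rewrite /e2; field; rewrite gt_eqF.
  have le3 : `|E| <= e / 4 * `|h| + e / 4 * `|h| + 1 / 2 * `|E|.
    apply: le_trans le1 _; rewrite mulrDr mulrA Ce2 -addrA lerD2l.
    rewrite mulrA; apply: (@le_trans _ _ (C * e1 * (M * `|h| + `|E|))).
      by rewrite ler_pM2l ?mulr_gt0.
    by rewrite mulrDr mulrA lerD// ler_wpM2r.
  have aux (a b c : R) : a <= c / 4 * b + c / 4 * b + 1 / 2 * a -> a <= c * b.
    by move=> ?; lra.
  exact: aux le3.
have dgE := diff_unique cdf gE.
split; last first.
  by move=> v; have /(congr1 (fun F : V -> 'rV[R]_n => F v)) := dgE.
by apply/diff_locallyP; rewrite dgE.
Unshelve. all: by end_near. Qed.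

Lemma Ck_jacobian_mx k n m (O : set 'rV[R]_n) (f : 'rV[R]_n -> 'rV[R]_m) i j :
  open O -> Ck k.+1 O f -> Ck k O (fun y => jacobian_mx f y i j).
Proof.
move=> oO [_ Df].
rewrite (_ : (fun y => _) = (fun y => 'D_(delta_mx 0 i) f y 0 j)).
  exact: Ck_coord (Df _).
by apply/funext => y; rewrite mxE.
Qed.

(** Bootstrapping: by [differentiable_of_comp] the derivative of g is d(k o g)
    multiplied by the inverse Jacobian of k at g, an expression of class C^j
    as soon as g is, so that g is then of class C^{j+1}. *)
Lemma Cinfty_of_comp V n (U : set V) (O : set 'rV[R]_n) (g : V -> 'rV[R]_n)
    (k : 'rV[R]_n -> 'rV[R]_n) :
  open U -> open O -> (forall x, U x -> O (g x)) ->
  Ck 0 U g -> Cinfty O k -> Cinfty U (k \o g) ->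
  (forall x, U x -> \det (jacobian_mx k (g x)) != 0) ->
  Cinfty U g.
Proof.
move=> oU oO UO gc kC kgC J0.
have dk x : U x -> differentiable k (g x).
  by move=> Ux; have [d _] := kC 1; apply/d/UO.
have dkg x : U x -> differentiable (k \o g) x.
  by move=> Ux; have [d _] := kgC 1; exact: d.
have dg x : U x -> differentiable g x /\
    forall v, 'd g x v = 'd (k \o g) x v *m invmx (jacobian_mx k (g x)).
  move=> Ux; apply: differentiable_of_comp.
  - exact: gc.
  - exact: dk.
  - exact: dkg.
  - exact: J0.
elim=> [//|j IH]; split=> [x Ux|v]; first by have [] := dg x Ux.
apply: (@Ck_eq _ _ _ _ _ (fun x => 'D_v (k \o g) x *m invmx (jacobian_mx k (g x)))) => //.
  move=> x /set_mem Ux; have [dgx E] := dg x Ux.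
  rewrite (deriveE v dgx) E -deriveE//; exact: dkg.
apply: Ck_mulmx => //; first by have [_] := kgC j.+1; apply.
apply: Ck_invmx => // a b.
apply: (Ck_compR (g := fun y => jacobian_mx k y a b) oU UO IH).
exact: Ck_jacobian_mx oO (kC j.+1).
Qed.

Lemma Cinfty_comp V n m (U : set V) (O : set 'rV[R]_n) (f : V -> 'rV[R]_n)
    (g : 'rV[R]_n -> 'rV[R]_m) :
  open U -> open O -> (forall x, U x -> O (f x)) ->
  Cinfty U f -> Cinfty O g -> Cinfty U (g \o f).
Proof. by move=> oU oO UO fC gC k; exact: Ck_comp oU oO UO (fC k) (gC k). Qed.

(** Where the Jacobian J of k has a right inverse L, composing k with L gives
    a map whose Jacobian is invertible nearby, and [Cinfty_of_comp] applies to
    it. *)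
Lemma Cinfty_immersion_lift V n m (U : set V) (O : set 'rV[R]_n) (g : V -> 'rV[R]_n)
    (k : 'rV[R]_n -> 'rV[R]_m) x0 :
  open U -> open O -> (forall x, U x -> O (g x)) ->
  Ck 0 U g -> Cinfty O k -> Cinfty U (k \o g) ->
  U x0 -> injective ('d k (g x0)) ->
  exists U', [/\ open U', U' x0, U' `<=` U & Cinfty U' g].
Proof.
move=> oU oO UO gc kC kgC Ux0 inj.
have dk y : O y -> differentiable k y by have [d _] := kC 1; exact: d.
set J := jacobian_mx k (g x0).
have Jfree : row_free J.
  rewrite -kermx_eq0; apply/eqP/row_matrixP => i.
  apply: inj; rewrite !(derive_jacobian_mx _ (dk _ (UO _ Ux0))) -/J -row_mul mulmx_ker.
  by rewrite !row0 mul0mx.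
have [L JL] := row_freeP Jfree.
pose k' := mulmxr L \o k.
have k'C : Cinfty O k'.
  move=> j; apply: (Ck_mulmx (A := fun=> L) oO (kC j)) => a b; exact: Ck_cst.
have Jk' y : O y -> jacobian_mx k' y = jacobian_mx k y *m L.
  move=> Oy; apply/row_matrixP => i.
  have dk' : differentiable k' y by have [d _] := k'C 1; exact: d.
  rewrite row_mul !rowE.
  have <- := derive_jacobian_mx (delta_mx 0 i) dk'.
  have <- := derive_jacobian_mx (delta_mx 0 i) (dk y Oy).
  have dL : differentiable (mulmxr L : 'rV[R]_m -> 'rV[R]_n) (k y).
    exact/linear_differentiable/mulmxr_continuous.
  rewrite (diff_comp (dk y Oy) dL) /=.
  by rewrite diff_lin//; exact: mulmxr_continuous.
pose U' := [set x | U x /\ \det (jacobian_mx k' (g x)) != 0].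
have oU' : open U'.
  apply: open_neq0 => //; apply: Ck_det => // a b.
  apply: (Ck_compR (g := fun y => jacobian_mx k' y a b) oU UO gc).
  exact: Ck_jacobian_mx oO (k'C 1).
have U'U : U' `<=` U by move=> x [].
exists U'; split => //.
  by split => //; rewrite Jk' ?JL ?det1 ?oner_neq0//; exact: UO.
apply: (Cinfty_of_comp oU' oO _ _ k'C) => [x /U'U /UO//| | |].
- exact: Ck_sub gc.
- move=> j; apply: (Ck_mulmx (A := fun=> L) (f := k \o g) oU').
    exact: Ck_sub U'U (kgC j).
  by move=> a b; exact: Ck_cst.
- by move=> x [].
Qed.

HB.instance Definition _ m n := Complete.on 'M[R]_(m, n).

Lemma coord_le_norm n (v : 'rV[R]_n) i : `|v 0 i| <= `|v|.
Proof.
rewrite [leRHS]/Num.norm /= mx_normrE.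
exact: (le_bigmax _ (fun ij : 'I_1 * 'I_n => `|v ij.1 ij.2|) (0, i)).
Qed.

Lemma norm_le_coord n (v : 'rV[R]_n) c :
  0 <= c -> (forall i, `|v 0 i| <= c) -> `|v| <= c.
Proof.
move=> c0 H; rewrite [leLHS]/Num.norm /= mx_normrE.
by apply/bigmax_leP; split=> // -[a i] _ /=; rewrite ord1.
Qed.

Lemma line_is_diff V (z u : V) (t : R) :
  is_diff t (fun s : R => z + s *: u) ( *:%R^~ u).
Proof.
have -> : (fun s : R => z + s *: u) = (cst z : R -> V) + ( *:%R^~ u : R -> V) by [].
by rewrite -[X in is_diff _ _ X]add0r; apply: is_diffD.
Qed.

Lemma line_differentiable V (z u : V) (t : R) :
  differentiable (fun s : R => z + s *: u) t.
Proof. by have [] := line_is_diff z u t. Qed.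

Lemma derive_line V (z u : V) (t : R) : 'D_1 (fun s : R => z + s *: u) t = u.
Proof.
rewrite deriveE; last exact: line_differentiable.
by rewrite (diff_val (is_diff_def := line_is_diff z u t)) scale1r.
Qed.

Lemma derive_coord V m (f : V -> 'rV[R]_m) x v i :
  differentiable f x -> 'D_v (fun x => f x 0 i) x = 'D_v f x 0 i.
Proof.
by move=> df; rewrite derive_mx ?mxE//; exact: diff_derivable.
Qed.

(** The mean value theorem is applied to each coordinate along the segment
    from z to y; the factor n is the number of terms in the expansion of y -
    z, whose coordinates are bounded by the sup norm. *)
Lemma lipschitz_of_derive n m (f : 'rV[R]_n -> 'rV[R]_m) x0 r e : 0 <= e ->
  (forall y, ball x0 r y -> differentiable f y) ->
  (forall y j, ball x0 r y -> `|'D_(delta_mx 0 j) f y| <= e) ->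
  forall y z, ball x0 r y -> ball x0 r z -> `|f y - f z| <= n%:R * e * `|y - z|.
Proof.
move=> e0 df De y z By Bz.
apply: norm_le_coord => [|i]; first by rewrite !mulr_ge0.
pose h := fun t : R => z + t *: (y - z).
have Bh (t : R) : t \in `[0, 1] -> ball x0 r (h t).
  rewrite in_itv /= => /andP[t0 t1].
  move: By Bz; rewrite -!ball_normE /= => By Bz.
  have -> : x0 - h t = (1 - t) *: (x0 - z) + t *: (x0 - y).
    rewrite /h; apply/rowP => k; rewrite !mxE; ring.
  have := ler_normD ((1 - t) *: (x0 - z)) (t *: (x0 - y)).
  move=> /le_lt_trans; apply; rewrite !normrZ !ger0_norm ?subr_ge0//.
  have [->|tn] := eqVneq t 0; first by rewrite subr0 mul1r mul0r addr0.
  have tp : 0 < t by rewrite lt_neqAle eq_sym tn.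
  have -> : r = (1 - t) * r + t * r by ring.
  apply: ler_ltD; last by rewrite ltr_pM2l.
  by rewrite ler_wpM2l ?subr_ge0// ltW.
(* One coordinate at a time: there is no mean value theorem for vectors. *)
pose g : 'rV[R]_n -> R := fun v => f v 0 i.
have dg (t : R) : t \in `[0, 1] -> differentiable g (h t).
  move=> /Bh/df dft.
  apply: (@differentiable_comp _ _ _ _ f (fun w : 'rV[R]_m => w 0 i : R)) => //.
  exact: differentiable_coord.
have dgh (t : R) : t \in `[0, 1] -> differentiable (g \o h) t.
  move=> tI; apply: differentiable_comp (dg t tI).
  exact: line_differentiable.
have Dgh (t : R) : t \in `[0, 1] -> `|'D_1 (g \o h) t| <= n%:R * e * `|y - z|.
  move=> tI; rewrite derive_comp; last 2 first.
  - exact: line_differentiable.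
  - exact: dg.
  rewrite derive_line; apply: le_trans (ler_norm_sum _ _ _) _.
  apply: (@le_trans _ _ (\sum_(j < n) (`|y - z| * e))).
    apply: ler_sum => j _; rewrite normrZ ler_pM//; first exact: coord_le_norm.
    rewrite (derive_coord _ _ (df _ (Bh _ tI))).
    exact: le_trans (coord_le_norm _ _) (De _ _ (Bh _ tI)).
  by rewrite sumr_const card_ord [`|_| * e]mulrC -(mulr_natl (e * _)) mulrA.
have [||c c01] := @MVT_segment R (g \o h) (fun t => 'D_1 (g \o h) t) 0 1 ler01.
- move=> t tI; apply: derivableP; apply: diff_derivable; apply: dgh.
  by apply: subset_itvW tI.
- apply: derivable_within_continuous => t tI.
  by apply: diff_derivable; apply: dgh.
have h1 : h 1 = y by rewrite /h scale1r addrC subrK.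
have h0 : h 0 = z by rewrite /h scale0r addr0.
rewrite subr0 mulr1 /= h1 h0 => E.
have -> : (f y - f z) 0 i = g y - g z by rewrite !mxE.
by rewrite E; exact: Dgh.
Qed.

(** Write F = id + phi. The partial derivatives of phi vanish at x0, so phi is
    (1/2)-Lipschitz on a small ball, and for z near F x0 the map y |-> z - phi
    y is a contraction of a closed ball into itself; its fixed point s z
    solves F y = z. Continuity of s follows from |y - y'| <= 2 |F y - F y'|.
    The smoothness of s is a separate matter, settled by
    [Cinfty_immersion_lift]. *)
Lemma local_inverse n (F : 'rV[R]_n -> 'rV[R]_n) (O : set 'rV[R]_n) x0 :
  open O -> O x0 -> Ck 1 O F -> (forall v, 'd F x0 v = v) ->
  exists (V : set 'rV[R]_n) (s : 'rV[R]_n -> 'rV[R]_n), [/\ open V, V (F x0), (forall z, V z -> O (s z) /\ F (s z) = z),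
    s (F x0) = x0 & Ck 0 V s].
Proof.
move=> oO Ox0 [dF DF] F1.
pose phi : 'rV[R]_n -> 'rV[R]_n := F \- id.
have dphi y : O y -> differentiable phi y.
  by move=> Oy; apply: differentiableB; [exact: dF|exact: ex_diff].
have Dphi y v : O y -> 'D_v phi y = 'D_v F y - v.
  move=> Oy; rewrite /phi deriveB ?derive_id//.
  by apply: diff_derivable; exact: dF.
(* The Lipschitz constant n e is at most 1/2, also when n = 0. *)
pose e : R := (2 * n.+1%:R)^-1.
have e0 : 0 < e by rewrite invr_gt0 mulr_gt0.
have ne : n%:R * e <= 1 / 2.
  rewrite /e invfM mulrCA div1r ler_piMr ?invr_ge0// ler_pdivrMr// mul1r.
  by rewrite ler_nat.
have nearO : \forall y \near x0, O y := open_nbhs_nbhs (conj oO Ox0).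
have nearD : \forall y \near x0, forall j : 'I_n, `|'D_(delta_mx 0 j) phi y| <= e.
  apply: (@filter_forall _ 'I_n
    (fun j => [set y | `|'D_(delta_mx 0 j) phi y| <= e]) (nbhs x0)) => j /=.
  have := DF (delta_mx 0 j) x0 Ox0 => /cvgrPdist_le/(_ e e0).
  rewrite deriveE ?F1; last exact: dF.
  move=> H; apply: filterS2 nearO H => y Oy Hy.
  by rewrite /= (Dphi _ _ Oy) distrC.
have /nbhs_ballP[r /= r0 Br] : \forall y \near x0,
    O y /\ forall j : 'I_n, `|'D_(delta_mx 0 j) phi y| <= e.
  by near=> y; split; near: y.
have phiL y z : ball x0 r y -> ball x0 r z -> `|phi y - phi z| <= 1 / 2 * `|y - z|.
  move=> By Bz; apply: (@le_trans _ _ (n%:R * e * `|y - z|)).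
    apply: (lipschitz_of_derive (ltW e0) _ _ By Bz) => [w Bw|w j Bw].
      by apply: dphi; have [] := Br _ Bw.
    by have [_] := Br _ Bw; apply.
  by rewrite ler_wpM2r.
have FL y z : ball x0 r y -> ball x0 r z -> `|y - z| <= 2 * `|F y - F z|.
  move=> By Bz; have := phiL y z By Bz.
  have : `|y - z| <= `|F y - F z| + `|phi y - phi z|.
    rewrite -[X in X <= _]normrN; apply: le_trans (ler_normB _ _).
    rewrite /phi /= le_eqVlt; apply/orP; left; apply/eqP; rewrite -[LHS]normrN.
    by congr (`| _ |); apply/rowP => k; rewrite !mxE; ring.
  lra.
pose D := closed_ball x0 (r / 2).
have DE y : D y <-> `|x0 - y| <= r / 2.
  by rewrite /D closed_ballE// ?divr_gt0.
have DB y : D y -> ball x0 r y.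
  move=> /DE Dy; rewrite -ball_normE /=; apply: le_lt_trans Dy _.
  by rewrite ltr_pdivrMr// ltr_pMr// ltr1n.
(* Half the radius of D, so that r/4 + (1/2)(r/2) <= r/2 keeps T inside D. *)
pose V := ball (F x0) (r / 4).
have Dx0 : D x0 by apply/DE; rewrite subrr normr0 divr_ge0// ltW.
have ex z : V z -> exists y, D y /\ F y = z.
  move=> Vz; pose T y := z - phi y.
  have TD : set_fun D D T.
    move=> y Dy; apply/DE.
    have := phiL y x0 (DB _ Dy) (DB _ Dx0).
    move: Vz; rewrite /V -ball_normE /= => Vz.
    move/DE : Dy => Dy.
    have -> : x0 - T y = (F x0 - z) + (phi y - phi x0).
      by rewrite /T /phi; apply/rowP => k; rewrite !mxE; ring.
    rewrite (distrC y x0) => L.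
    apply: le_trans (ler_normD _ _) _; lra.
  pose Tf : {fun D >-> D} := HB.pack T (isFun.Build _ _ D D T TD).
  have half0 : (0 : R) <= 1 / 2 by rewrite divr_ge0.
  have [] := @banach_fixed_point R 'rV[R]_n D Tf.
  - exists (NngNum half0); split => /=; first by rewrite ltr_pdivrMr// mul1r ltr1n.
    move=> [y y'] /= [Dy Dy'].
    have := phiL y' y (DB _ Dy') (DB _ Dy).
    rewrite [in X in _ -> X]distrC.
    have -> : T y' - T y = phi y - phi y'.
      by rewrite /T; apply/rowP => k; rewrite !mxE; ring.
    by rewrite (distrC (phi y)) (distrC y).
  - exact: closed_ball_closed.
  - by exists x0.
  move=> y Dy yT; exists y; split => //.
  move: yT; rewrite /= /T /phi /= => yT.
  by apply/rowP => k; move/rowP/(_ k) : yT; rewrite !mxE; lra.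
pose s z := xget x0 [set y | D y /\ F y = z].
have sP z : V z -> D (s z) /\ F (s z) = z.
  by move=> Vz; have [y Hy] := ex z Vz; rewrite /s; case: xgetP => [w _ //|/(_ y)].
have VF : V (F x0) by apply: ballxx; rewrite divr_gt0.
exists V, s; split => //.
- by rewrite /V; exact: ball_open.
- by move=> z /sP[Dz Fz]; split=> //; have [] := Br _ (DB _ Dz).
- have [Ds Fs] := sP _ VF.
  have := FL _ _ (DB _ Ds) (DB _ Dx0); rewrite Fs subrr normr0 mulr0 normr_le0.
  by rewrite subr_eq0 => /eqP.
- move=> z Vz; suff : s @ nbhs (z : 'rV[R]_n) --> (s z : 'rV[R]_n) by [].
  apply/cvgrPdist_lt => eps eps0.
  have nV : \forall w \near z, V w.
    by apply: open_nbhs_nbhs; split=> //; exact: ball_open.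
  near=> w; have Vw : V w by near: w.
  have [Dz Fz] := sP _ Vz; have [Dw Fw] := sP _ Vw.
  apply: le_lt_trans (FL _ _ (DB _ Dz) (DB _ Dw)) _.
  rewrite Fz Fw -ltr_pdivlMl//.
  near: w; have : (id : 'rV[R]_n -> 'rV[R]_n) @ z --> z by exact: cvg_id.
  by move=> /cvgrPdist_lt; apply; rewrite mulr_gt0// invr_gt0.
Unshelve. all: by end_near. Qed.

End InverseFunction.

(** * The topology defined by an atlas *)

Section Topology.
Context (R : realType) (T : choiceType).
Implicit Type S : atlas R T.

(** The clauses of [is_manifold] about charts alone. Smoothness is defined
    from them, and unlike the separation and countability clauses they pass to
    products by inspection. *)
Definition is_atlas S : Prop :=
  [/\ (forall c, acharts S c ->
        {in cdom c, cancel (cmap c) (cinv c)} /\ open (cmap c @` cdom c)),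
      (forall c c', acharts S c -> acharts S c' ->
        let W := cmap c @` (cdom c `&` cdom c') in
        open W /\ Cinfty W (cmap c' \o cinv c)) &
      (forall x, exists2 c, acharts S c & cdom c x)].

Lemma manifold_atlas S : is_manifold S -> is_atlas S.
Proof. by case. Qed.

Lemma chartK S c x : is_atlas S -> acharts S c -> cdom c x -> cinv c (cmap c x) = x.
Proof. by move=> [H _ _] /H[H' _] cx; apply: H'; rewrite inE. Qed.

Lemma chart_inj S c x y : is_atlas S -> acharts S c -> cdom c x -> cdom c y ->
  cmap c x = cmap c y -> x = y.
Proof. by move=> aS Sc cx cy e; rewrite -(chartK aS Sc cx) e (chartK aS Sc). Qed.

Lemma open_preimage_within (V W : topologicalType) (U : set V) (f : V -> W) (O : set W) :
  open U -> (forall x, U x -> {for x, continuous f}) -> open O ->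
  open (U `&` f @^-1` O).
Proof.
by move=> oU cf; move: O; apply/continuous_inP => // x /set_mem/cf.
Qed.

Lemma open_mspace_subbase S (c : chart R T (adim S)) (V : set 'rV[R]_(adim S)) :
  acharts S c -> open V -> open (cdom c `&` cmap c @^-1` V : set (mspace S)).
Proof.
move=> Sc oV; set U := _ `&` _.
have SU : mspace_subbase S U by exists c => //; exists V.
exists [set U]; last by rewrite bigcup_set1.
move=> _ ->; exact: finI_from1.
Qed.

(** The topology is generated by the sets dom(c') /\ c'^{-1}(V). Read in a
    chart c, such a set is the preimage of V under the transition map from c
    to c', which is continuous on an open set; finite intersections and unions
    are then formed inside the chart, where c is injective. *)
Lemma open_mspaceP S (U : set T) : is_atlas S ->
  open (U : set (mspace S)) <->
  forall c, acharts S c -> open (cmap c @` (cdom c `&` U)).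
Proof.
move=> aS; have [S1 S2 S3] := aS; split; last first.
  move=> oU.
  rewrite (_ : U = \bigcup_(c in acharts S) (cdom c `&` cmap c @^-1` (cmap c @` (cdom c `&` U)))).
    apply: (@bigcup_open (mspace S)) => c Sc.
    by apply: open_mspace_subbase => //; exact: oU.
  apply/seteqP; split=> [x Ux|x [c Sc [cx [y [cy Uy]] /(chart_inj aS Sc cy cx) <-]]]//.
  have [c Sc cx] := S3 x; exists c => //; split=> //; by exists x.
move=> [D' sD <-] c Sc.
rewrite setI_bigcupr image_bigcup; apply: bigcup_open => A /sD [F sF <-].
have openI A1 A2 : open (cmap c @` (cdom c `&` A1)) -> open (cmap c @` (cdom c `&` A2)) ->
    open (cmap c @` (cdom c `&` (A1 `&` A2))).
  rewrite (_ : cmap c @` (cdom c `&` (A1 `&` A2)) =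
    cmap c @` (cdom c `&` A1) `&` cmap c @` (cdom c `&` A2)); first exact: openI.
  apply/seteqP; split=> [_ [x [cx [A1x A2x]] <-]|_ [[x [cx A1x] <-] [y [cy A2y] e]]].
    by split; exists x.
  by have E := chart_inj aS Sc cy cx e; subst y; exists x.
rewrite [isBaseTopological.b _]bigcap_fset big_seq.
elim/big_ind : _ => //; first by rewrite setIT; have [] := S1 _ Sc.
move=> B /sF/set_mem [c' Sc' [V oV <-]] /=.
have [oW CW] := S2 c c' Sc Sc'.
rewrite (_ : cmap c @` _ = cmap c @` (cdom c `&` cdom c') `&`
   (cmap c' \o cinv c) @^-1` V).
  by apply: open_preimage_within => //; exact: (Ck_continuous (CW 0)).
apply/seteqP; split=> [_ [x [cx [c'x Vx]] <-]|_ [[x [cx c'x] <-]]].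
  by split; [exists x|rewrite /= (chartK aS Sc)].
by rewrite /= (chartK aS Sc)// => Vx; exists x.
Qed.

End Topology.

(** * Smooth maps between manifolds *)

Section SmoothMaps.
Context (R : realType).
Implicit Types T : choiceType.

(** The inclusion of the open set N in the image of dom(c) /\ f^{-1}(dom(c'))
    carries the continuity of f at x. *)
Definition chart_smooth T T' n n' (c : chart R T n) (c' : chart R T' n')
    (f : T -> T') (x : T) : Prop :=
  exists N : set 'rV[R]_n,
    [/\ open N, N (cmap c x), N `<=` cmap c @` (cdom c `&` f @^-1` cdom c') &
        Cinfty N (cmap c' \o f \o cinv c)].

(** One pair of charts is enough by [smooth_at_chart]; being a condition at a
    point, this notion composes without tracking domains, unlike
    [smooth_on]. *)
Definition smooth_at T T' (S : atlas R T) (S' : atlas R T') (f : T -> T') x : Prop :=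
  exists c c', [/\ acharts S c, acharts S' c', cdom c x, cdom c' (f x) &
    chart_smooth c c' f x].

Lemma Cinfty_sub (V W : normedModType R) (U U' : set V) (f : V -> W) :
  U `<=` U' -> Cinfty U' f -> Cinfty U f.
Proof. by move=> UU' fC k; exact: Ck_sub (fC k). Qed.

Lemma Cinfty_eq (V W : normedModType R) (U : set V) (f g : V -> W) : open U ->
  {in U, f =1 g} -> Cinfty U f -> Cinfty U g.
Proof. by move=> oU fg fC k; exact: Ck_eq fg (fC k). Qed.

(** Every clause of [Ck] is a condition at the points of the set, so it can be
    checked on singletons. *)
Lemma Cinfty_local (V W : normedModType R) (U : set V) (f : V -> W) :
  (forall x, U x -> exists2 N : set V, N x & Cinfty N f) -> Cinfty U f.
Proof.
move=> H k; have {H}: forall x, U x -> Ck k [set x] f.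
  move=> x /H[N Nx fC]; apply: Ck_sub (fC k); by move=> _ ->.
elim: k f => [|k IH] f fC; first by move=> x Ux; exact: (fC x Ux x).
split=> [x Ux|v]; first by have [d _] := fC x Ux; exact: d.
by apply: IH => x Ux; have [_] := fC x Ux; apply.
Qed.

Lemma open_preimage_Cinfty n m (N : set 'rV[R]_n) (F : 'rV[R]_n -> 'rV[R]_m) O :
  open N -> Cinfty N F -> open O -> open (N `&` F @^-1` O).
Proof.
move=> oN FC oO; apply: open_preimage_within => //.
exact: (Ck_continuous (FC 0)).
Qed.

Lemma chart_smooth_comp T T' T'' n n' n'' (c : chart R T n) (c' : chart R T' n')
    (c'' : chart R T'' n'') f g x :
  {in cdom c, cancel (cmap c) (cinv c)} -> {in cdom c', cancel (cmap c') (cinv c')} ->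
  cdom c x -> cdom c' (f x) ->
  chart_smooth c c' f x -> chart_smooth c' c'' g (f x) ->
  chart_smooth c c'' (g \o f) x.
Proof.
move=> cK c'K cx c'fx [N [oN Nx sN NC]] [N' [oN' N'x sN' N'C]].
pose F := cmap c' \o f \o cinv c.
have E y : (N `&` F @^-1` N') y -> exists z, [/\ cdom c z, cdom c' (f z), cdom c'' (g (f z)) &
    cmap c z = y].
  move=> [/sN[z [cz c'z] <-]] /sN' [w [cw c''w]].
  rewrite /F /= cK ?inE// => /(congr1 (cinv c')); rewrite !c'K ?inE// => E.
  by exists z; split=> //; rewrite -E.
have oN'' : open (N `&` F @^-1` N') by exact: open_preimage_Cinfty.
exists (N `&` F @^-1` N'); split => //.
- by split=> //=; rewrite /F /= cK ?inE.
- by move=> y /E [z [cz _ c''z <-]]; exists z.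
- apply: (@Cinfty_eq _ _ _ ((cmap c'' \o g \o cinv c') \o F)) => //.
    by move=> y /set_mem/E [z [cz c'z _ <-]]; rewrite /F /= cK ?inE// c'K ?inE.
  apply: (Cinfty_comp oN'' oN' _ _ N'C); first by move=> y [].
  by apply: Cinfty_sub NC => y [].
Qed.

Lemma chart_smooth_id T (S : atlas R T) c c' x : is_atlas S ->
  acharts S c -> acharts S c' -> cdom c x -> cdom c' x -> chart_smooth c c' id x.
Proof.
move=> [S1 S2 _] Sc Sc' cx c'x; have [oW CW] := S2 c c' Sc Sc'.
by exists (cmap c @` (cdom c `&` cdom c')); split=> //; exists x.
Qed.

Lemma smooth_at_chart T T' (S : atlas R T) (S' : atlas R T') f x c c' :
  is_atlas S -> is_atlas S' -> smooth_at S S' f x ->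
  acharts S c -> acharts S' c' -> cdom c x -> cdom c' (f x) ->
  chart_smooth c c' f x.
Proof.
move=> aS aS' [d [d' [Sd Sd' dx d'x H]]] Sc Sc' cx c'x.
have [aS1 _ _] := aS; have [aS'1 _ _] := aS'.
have cK c0 : acharts S c0 -> {in cdom c0, cancel (cmap c0) (cinv c0)} by move=> /aS1[].
have c'K c0 : acharts S' c0 -> {in cdom c0, cancel (cmap c0) (cinv c0)} by move=> /aS'1[].
have H1 := chart_smooth_id aS Sc Sd cx dx.
have H2 := chart_smooth_id aS' Sd' Sc' d'x c'x.
apply: (@chart_smooth_comp _ _ _ _ _ _ c d c' id f x (cK _ Sc) (cK _ Sd) cx dx H1).
exact: (@chart_smooth_comp _ _ _ _ _ _ d d' c' f id x (cK _ Sd) (c'K _ Sd') dx d'x H H2).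
Qed.

Lemma smooth_at_comp T T' T'' (S : atlas R T) (S' : atlas R T') (S'' : atlas R T'') f g x :
  is_atlas S -> is_atlas S' -> is_atlas S'' ->
  smooth_at S S' f x -> smooth_at S' S'' g (f x) -> smooth_at S S'' (g \o f) x.
Proof.
move=> aS aS' aS'' [c [c' [Sc Sc' cx c'x H]]] G.
have [_ _ /(_ (g (f x))) [c'' Sc'' c''x]] := aS''.
have {}G := smooth_at_chart aS' aS'' G Sc' Sc'' c'x c''x.
exists c, c''; split=> //.
have [aS1 _ _] := aS; have [aS'1 _ _] := aS'.
by apply: chart_smooth_comp H G => //; [have [] := aS1 c Sc|have [] := aS'1 c' Sc'].
Qed.

Lemma smoothP T T' (S : atlas R T) (S' : atlas R T') f :
  is_atlas S -> is_atlas S' -> smooth S S' f <-> forall x, smooth_at S S' f x.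
Proof.
move=> aS aS'; have [aS1 _ aS3] := aS; have [_ _ aS'3] := aS'; split=> [fS x|fS c c' Sc Sc'].
  have [c Sc cx] := aS3 x; have [c' Sc' c'x] := aS'3 (f x).
  exists c, c'; split=> //; have [oW WC] := fS c c' Sc Sc'.
  rewrite setIT in oW WC.
  by exists (cmap c @` (cdom c `&` f @^-1` cdom c')); split=> //; exists x.
rewrite setIT => W; have H y : W y -> exists N : set 'rV_(adim S),
    [/\ open N, N y, N `<=` W & Cinfty N (cmap c' \o f \o cinv c)].
  by move=> [x [cx c'x] <-]; exact: (smooth_at_chart aS aS' (fS x)).
split.
  rewrite openE => y /H [N [oN Ny NW _]]; rewrite /interior.
  by apply: filterS NW _; exact: open_nbhs_nbhs.
by apply: Cinfty_local => y /H [N [_ Ny _ NC]]; exists N.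
Qed.

Lemma smooth_at_cst T T' (S : atlas R T) (S' : atlas R T') y x :
  is_atlas S -> is_atlas S' -> smooth_at S S' (fun=> y) x.
Proof.
move=> [aS1 _ aS3] [_ _ aS'3]; have [c Sc cx] := aS3 x; have [c' Sc' c'y] := aS'3 y.
exists c, c'; split=> //; exists (cmap c @` cdom c).
have [cK oc] := aS1 c Sc; split=> //.
  by move=> _ [z cz <-]; exists z.
by move=> k; exact: Ck_cst.
Qed.

Lemma smooth_at_id T (S : atlas R T) x : is_atlas S -> smooth_at S S id x.
Proof.
move=> aS; have [_ _ aS3] := aS; have [c Sc cx] := aS3 x.
by exists c, c; split=> //; exact: chart_smooth_id.
Qed.

Lemma smooth_open T T' (S : atlas R T) (S' : atlas R T') f (V : set T') :
  is_atlas S -> is_atlas S' -> smooth S S' f ->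
  open (V : set (mspace S')) -> open (f @^-1` V : set (mspace S)).
Proof.
move=> aS aS' fS /(open_mspaceP _ aS') oV; apply/(open_mspaceP _ aS) => c Sc.
rewrite openE => _ [x [cx Vx] <-].
have [_ _ /(_ (f x)) [c' Sc' c'x]] := aS'.
have [oW WC] := fS c c' Sc Sc'; rewrite setIT in oW WC.
have oN := open_preimage_Cinfty oW WC (oV c' Sc').
have Nx : ((cmap c @` (cdom c `&` f @^-1` cdom c')) `&`
   (cmap c' \o f \o cinv c) @^-1` (cmap c' @` (cdom c' `&` V))) (cmap c x).
  by split; [exists x|exists (f x); rewrite //= (chartK aS Sc)].
apply: filterS (open_nbhs_nbhs (conj oN Nx)) => _ [[z [cz c'z] <-] [w [c'w Vw]]].
rewrite /= (chartK aS Sc)// => /(chart_inj aS' Sc' c'w c'z) E; subst w.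
by exists z.
Qed.

Lemma smooth_continuous T T' (S : atlas R T) (S' : atlas R T') f :
  is_atlas S -> is_atlas S' -> smooth S S' f ->
  continuous (f : mspace S -> mspace S').
Proof. by move=> aS aS' fS; apply/continuousP => V; exact: smooth_open. Qed.

(** The embedding i makes h continuous, since the topology of its domain is
    induced; then in charts h is a continuous lift of the smooth map i o h
    through an immersion. *)
Lemma embedding_lift T T' T'' (S : atlas R T) (S' : atlas R T') (S'' : atlas R T'')
    (i : T -> T') (h : T'' -> T) :
  is_atlas S -> is_atlas S' -> is_atlas S'' ->
  embedding S S' i -> (forall x, smooth_at S'' S' (i \o h) x) ->
  forall x, smooth_at S'' S h x.
Proof.
move=> aS aS' aS'' [iS _ iI iO] ihA x.
have ihS : smooth S'' S' (i \o h) by apply/smoothP.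
have hO (U : set T) : open (U : set (mspace S)) -> open (h @^-1` U : set (mspace S'')).
  by move=> /iO [V oV ->]; exact: (smooth_open (f := i \o h) aS'' aS' ihS oV).
have [aS''1 _ /(_ x) [d Sd dx]] := aS''.
have [aS1 _ /(_ (h x)) [c Sc cx]] := aS.
have [_ _ /(_ (i (h x))) [c' Sc' c'x]] := aS'.
have [oO OC] := iS c c' Sc Sc'; rewrite setIT in oO OC.
have [oW WC] := ihS d c' Sd Sc'; rewrite setIT in oW WC.
set O := cmap c @` _ in oO OC; set W := cmap d @` _ in oW WC.
have oc B : open B -> open (cmap d @` (cdom d `&` h @^-1` (cdom c `&` cmap c @^-1` B))).
  move=> oB; have := hO _ (open_mspace_subbase Sc oB).
  by move=> /(open_mspaceP _ aS'')/(_ d Sd).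
pose U := W `&` cmap d @` (cdom d `&` h @^-1` cdom c).
have oU : open U.
  apply: openI => //; have := oc _ openT.
  by rewrite preimage_setT setIT.
have UE y : U y -> exists z, [/\ cdom d z, cdom c (h z), cdom c' (i (h z)) & cmap d z = y].
  move=> [[z [dz c'z] <-] [w [dw cw] /(chart_inj aS'' Sd dw dz) E]].
  by subst w; exists z.
have Ux : U (cmap d x) by split; exists x.
have [||||U' [oU' U'x U'U U'C]] := @Cinfty_immersion_lift R _ _ _ U O
   (cmap c \o h \o cinv d) (cmap c' \o i \o cinv c) (cmap d x) oU oO _ _ OC _ Ux.
- by move=> y /UE [z [dz cz c'z <-]]; rewrite /= (chartK aS'' Sd)//; exists (h z).
- suff cg : {in U, continuous (cmap c \o h \o cinv d)}.
    by move=> y Uy; apply: cg; exact/mem_set.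
  apply/continuous_inP => // B oB; rewrite (_ : _ `&` _ = U `&` cmap d @` (cdom d `&` h @^-1` (cdom c `&` cmap c @^-1` B))).
    by apply: openI => //; exact: oc.
  apply/seteqP; split=> w [Uw]; have [z [dz cz c'z E]] := UE _ Uw; subst w.
    by rewrite /= (chartK aS'' Sd)// => Bz; split=> //; exists z.
  move=> [z' [dz' [cz' Bz']] /(chart_inj aS'' Sd dz' dz) E]; subst z'.
  by split=> //; rewrite /= (chartK aS'' Sd).
- apply: (@Cinfty_eq _ _ _ (cmap c' \o (i \o h) \o cinv d)) => //.
    move=> y /set_mem/UE [z [dz cz c'z <-]] /=.
    by rewrite (chartK aS'' Sd)// (chartK aS Sc).
  by apply: Cinfty_sub WC => y [].
- by rewrite /= (chartK aS'' Sd)//; exact: (iI (h x) c c' Sc Sc').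
exists d, c; split=> //; exists U'; split=> //.
by move=> y /U'U [_].
Qed.

End SmoothMaps.

(** * Submersions *)

Section Submersions.
Context (R : realType).
Implicit Types T : choiceType.

Lemma Cinfty_differentiable n m (U : set 'rV[R]_n) (f : 'rV[R]_n -> 'rV[R]_m) x :
  Cinfty U f -> U x -> differentiable f x.
Proof. by move=> fC Ux; have [d _] := fC 1; exact: d. Qed.

Lemma Cinfty_affine n m (U : set 'rV[R]_n) (L : 'M[R]_(n, m)) (a : 'rV[R]_m) :
  open U -> Cinfty U (fun u => a + u *m L).
Proof.
move=> oU k; apply: (CkD oU (Ck_cst k U a)).
by apply: Ck_mulmx => //; [exact: Ck_id|move=> i j; exact: Ck_cst].
Qed.

Lemma diff_affine n m (L : 'M[R]_(n, m)) (a : 'rV[R]_m) (x w : 'rV[R]_n) :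
  'd (fun u : 'rV[R]_n => a + u *m L) x w = w *m L.
Proof.
have cL := @mulmxr_continuous R n m L.
have dL : differentiable (mulmxr L : 'rV[R]_n -> 'rV[R]_m) x by exact: linear_differentiable.
have -> : (fun u : 'rV[R]_n => a + u *m L) = cst a + (mulmxr L : 'rV[R]_n -> 'rV[R]_m) by [].
rewrite diffD//.
have E1 := congr1 (fun F : 'rV[R]_n -> 'rV[R]_m => F w) (diff_lin x cL).
have E2 := congr1 (fun F : 'rV[R]_n -> 'rV[R]_m => F w) (diff_cst a x).
by rewrite -[RHS]E1 -[RHS]add0r -[X in _ = X + _]E2.
Qed.

(** In charts, the Jacobian of p at x has a left inverse L on rows. Along the
    affine slice through x with direction the image of L, p has identity
    differential, hence a local inverse s there; then h = (h o p) o s near p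
    x. *)
Lemma submersion_descent T T' T'' (S : atlas R T) (S' : atlas R T') (S'' : atlas R T'')
    (p : T -> T') (h : T' -> T'') :
  is_atlas S -> is_atlas S' -> is_atlas S'' ->
  submersion S S' p -> (forall x, smooth_at S S'' (h \o p) x) ->
  forall y, smooth_at S' S'' h y.
Proof.
move=> aS aS' aS'' [pS p_surj dp_surj] hpA y.
have hpS : smooth S S'' (h \o p) by apply/smoothP.
have [x _ pxy] := p_surj y I; subst y.
have [_ _ /(_ x) [c Sc cx]] := aS.
have [_ _ /(_ (p x)) [c' Sc' c'x]] := aS'.
have [_ _ /(_ (h (p x))) [d Sd dx]] := aS''.
have [oWp WpC] := pS c c' Sc Sc'; rewrite setIT in oWp WpC.
have [oWh WhC] := hpS c d Sc Sd; rewrite setIT in oWh WhC.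
set Wp := cmap c @` _ in oWp WpC; set Wh := cmap c @` _ in oWh WhC.
pose W := Wp `&` Wh; have oW : open W by exact: openI.
have Wx : W (cmap c x) by split; exists x.
have WE w : W w -> exists z, [/\ cdom c z, cdom c' (p z), cdom d (h (p z)) & cmap c z = w].
  by move=> [[z [cz c'z] <-] [u [cu du] /(chart_inj aS Sc cu cz) E]]; subst u; exists z.
pose P := cmap c' \o p \o cinv c; pose H := cmap d \o (h \o p) \o cinv c.
have PC : Cinfty W P by apply: Cinfty_sub WpC => w [].
have HC : Cinfty W H by apply: Cinfty_sub WhC => w [].
have dPx := Cinfty_differentiable PC Wx.
pose J := jacobian_mx P (cmap c x).
have /row_fullP[L LJ] : row_full J.
  rewrite -sub1mx; apply/row_subP => i.
  have [v _ dPv] := dp_surj x c c' Sc Sc' cx c'x (row i 1%:M) I.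
  rewrite -dPv /chart_diff -/P (derive_jacobian_mx _ dPx).
  exact: submxMl.
pose A u := cmap c x + u *m L.
have AC : Cinfty setT A := Cinfty_affine L (cmap c x) openT.
pose O := A @^-1` W.
have oO : open O.
  have := open_preimage_Cinfty openT AC oW; by rewrite setTI.
have A0 : A 0 = cmap c x by rewrite /A mul0mx addr0.
have O0 : O 0 by rewrite /O /= A0.
pose F := P \o A.
have FC : Cinfty O F.
  apply: (Cinfty_comp oO oW _ _ PC) => //; exact: Cinfty_sub AC.
have dF v : 'd F 0 v = v.
  have dPA0 : differentiable P (A 0) by rewrite A0.
  rewrite (diff_comp (Cinfty_differentiable AC (I : setT 0)) dPA0) /=.
  by rewrite A0 (derive_jacobian_mx _ dPx) (diff_affine L) -mulmxA LJ mulmx1.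
have [V [s [oV VF0 sP sF0 sC]]] := local_inverse oO O0 (FC 1) dF.
have F0 : F 0 = cmap c' (p x) by rewrite /F /= A0 /P /= (chartK aS Sc).
have [|||V' [oV' V'x V'V sC']] := @Cinfty_immersion_lift R _ _ _ V O s F (F 0) oV oO _ sC FC _ VF0.
- by move=> z /sP[].
- apply: (@Cinfty_eq _ _ _ _ id) => //; last by move=> k; exact: Ck_id.
  by move=> z /set_mem/sP[].
- by rewrite sF0 => u v; rewrite !dF.
exists c', d; split=> //; exists V'.
have V'E z : V' z -> exists w, [/\ cdom c w, cdom c' (p w), cdom d (h (p w)),
    cmap c w = A (s z) & cmap c' (p w) = z].
  move=> /V'V/sP[Osz Fsz]; have [w [cw c'w dw E]] := WE _ Osz.
  exists w; split=> //; rewrite -[in RHS]Fsz /F /= -E /P /= (chartK aS Sc)//.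
split=> //.
- by rewrite -F0.
- by move=> z /V'E [w [cw c'w dw _ <-]]; exists (p w).
- apply: (@Cinfty_eq _ _ _ _ (H \o (A \o s))) => //.
    move=> z /set_mem/V'E [w [cw c'w dw E1 E2]]; rewrite /= -E1 /H /= (chartK aS Sc)//.
    by rewrite -E2 (chartK aS' Sc').
  apply: (Cinfty_comp oV' oW _ _ HC); first by move=> z /V'V/sP[].
  exact: (Cinfty_comp oV' openT _ sC' AC).
Qed.

(** If s is a smooth section through x, then dp o ds is the identity by the
    chain rule. *)
Lemma submersion_of_sections T T' (S : atlas R T) (S' : atlas R T') (p : T -> T') :
  is_atlas S -> is_atlas S' -> smooth S S' p -> set_surj setT setT p ->
  (forall x, exists2 s : T' -> T, smooth S' S s & s (p x) = x /\ cancel s p) ->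
  submersion S S' p.
Proof.
move=> aS aS' pS p_surj sec; split=> // x c c' Sc Sc' cx c'x v _.
have [s sS [spx sK]] := sec x.
have sA := (smoothP _ aS' aS).1 sS (p x).
have csx : cdom c (s (p x)) by rewrite spx.
have [N [oN Nx NE NC]] := smooth_at_chart aS' aS sA Sc' Sc c'x csx.
have [oW WC] := pS c c' Sc Sc'; rewrite setIT in oW WC.
set P := cmap c' \o p \o cinv c in WC; set G := cmap c \o s \o cinv c' in NC.
have Gx : G (cmap c' (p x)) = cmap c x by rewrite /G /= (chartK aS' Sc')// spx.
have dG := Cinfty_differentiable NC Nx.
have dP : differentiable P (G (cmap c' (p x))).
  by rewrite Gx; apply: Cinfty_differentiable WC _; exists x.
exists ('d G (cmap c' (p x)) v) => //.
rewrite /chart_diff -/P -Gx.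
have /= E := congr1 (fun F : _ -> _ => F v) (diff_comp dG dP).
rewrite -[LHS]E -deriveE; last exact: differentiable_comp.
rewrite -[RHS](derive_id (cmap c' (p x))).
apply: near_eq_derive; apply: filterS (open_nbhs_nbhs (conj oN Nx)) => _ /NE[w [c'w cw] <-].
by rewrite /P /G /= (chartK aS' Sc')// (chartK aS Sc)// sK.
Qed.

End Submersions.

(** * Products of manifolds *)

Section Products.
Context (R : realType).
Implicit Types T : choiceType.

Lemma Cinfty_row_mx (V : normedModType R) n m (U : set V) (f : V -> 'rV[R]_n)
    (g : V -> 'rV[R]_m) :
  open U -> Cinfty U f -> Cinfty U g -> Cinfty U (fun x => row_mx (f x) (g x)).
Proof.
move=> oU fC gC k; apply: Ck_rV => // i.
case: (split_ordP i) => j ->.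
  rewrite (_ : (fun x => _) = (fun x => f x 0 j)); first exact: Ck_coord.
  by apply/funext => x; rewrite row_mxEl.
rewrite (_ : (fun x => _) = (fun x => g x 0 j)); first exact: Ck_coord.
by apply/funext => x; rewrite row_mxEr.
Qed.

Lemma Cinfty_lsubmx n m (U : set 'rV[R]_(n + m)) :
  open U -> Cinfty U (lsubmx : _ -> 'rV[R]_n).
Proof.
move=> oU k; apply: Ck_rV => // i.
rewrite (_ : (fun x => _) = (fun x : 'rV[R]_(n + m) => x 0 (lshift m i))); first exact: (Ck_coord _ oU (Ck_id k U)).
by apply/funext => x; rewrite mxE.
Qed.

Lemma Cinfty_rsubmx n m (U : set 'rV[R]_(n + m)) :
  open U -> Cinfty U (rsubmx : _ -> 'rV[R]_m).
Proof.
move=> oU k; apply: Ck_rV => // i.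
rewrite (_ : (fun x => _) = (fun x : 'rV[R]_(n + m) => x 0 (rshift n i))); first exact: (Ck_coord _ oU (Ck_id k U)).
by apply/funext => x; rewrite mxE.
Qed.

Lemma prod_chart_image T T' n n' (c : chart R T n) (c' : chart R T' n') A B :
  cmap (prod_chart c c') @` (A `*` B) =
  lsubmx @^-1` (cmap c @` A) `&` rsubmx @^-1` (cmap c' @` B).
Proof.
apply/seteqP; split=> [_ [[x y] /= [Ax By] <-]|v [[x Ax xv] [y By yv]]].
  by rewrite /= row_mxKl row_mxKr; split; [exists x|exists y].
by exists (x, y) => //=; rewrite xv yv hsubmxK.
Qed.

Lemma open_prod_image n n' (A : set 'rV[R]_n) (B : set 'rV[R]_n') : open A -> open B ->
  open (lsubmx @^-1` A `&` rsubmx @^-1` B).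
Proof.
move=> oA oB; apply: openI.
  by have := open_preimage_Cinfty openT (@Cinfty_lsubmx n n' setT openT) oA; rewrite setTI.
by have := open_preimage_Cinfty openT (@Cinfty_rsubmx n n' setT openT) oB; rewrite setTI.
Qed.

Lemma prod_is_atlas T T' (S : atlas R T) (S' : atlas R T') :
  is_atlas S -> is_atlas S' -> is_atlas (prod_atlas S S').
Proof.
move=> [S1 S2 S3] [S'1 S'2 S'3]; split.
- move=> _ [c Sc [c' Sc' <-]]; have [cK oc] := S1 c Sc; have [c'K oc'] := S'1 c' Sc'.
  split; last by rewrite /= (prod_chart_image c c'); exact: open_prod_image.
  move=> [x y] /set_mem [/= cx c'y].
  by rewrite /= row_mxKl row_mxKr cK ?c'K ?inE.
- move=> _ _ [c Sc [c' Sc' <-]] [d Sd [d' Sd' <-]].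
  have [oW WC] := S2 c d Sc Sd; have [oW' WC'] := S'2 c' d' Sc' Sd'.
  have E : cmap (prod_chart c c') @` (cdom (prod_chart c c') `&` cdom (prod_chart d d')) =
      lsubmx @^-1` (cmap c @` (cdom c `&` cdom d)) `&`
      rsubmx @^-1` (cmap c' @` (cdom c' `&` cdom d')).
    rewrite -prod_chart_image; congr image; apply/seteqP.
    by split=> -[x y] /= => [[[? ?] [? ?]]|[[? ?] [? ?]]].
  rewrite E; set W0 := _ `&` _.
  have oW0 : open W0 by exact: open_prod_image.
  split=> //; apply: Cinfty_row_mx => //.
    apply: (Cinfty_comp oW0 oW _ _ WC); first by move=> v [].
    exact: Cinfty_lsubmx.
  apply: (Cinfty_comp oW0 oW' _ _ WC'); first by move=> v [].
  exact: Cinfty_rsubmx.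
- move=> [x y]; have [c Sc cx] := S3 x; have [c' Sc' cy] := S'3 y.
  by exists (prod_chart c c') => //; exists c => //; exists c'.
Qed.

Lemma smooth_at_pair T T' T'' (S : atlas R T) (S' : atlas R T') (S'' : atlas R T'') f g x :
  is_atlas S -> smooth_at S S' f x -> smooth_at S S'' g x ->
  is_atlas S' -> is_atlas S'' ->
  smooth_at S (prod_atlas S' S'') (fun x => (f x, g x)) x.
Proof.
move=> aS [c [c' [Sc Sc' cx c'x fS]]] gS aS' aS''.
have [_ _ /(_ (g x)) [c'' Sc'' c''x]] := aS''.
have [N2 [oN2 N2x sN2 N2C]] := smooth_at_chart aS aS'' gS Sc Sc'' cx c''x.
have [N1 [oN1 N1x sN1 N1C]] := fS.
exists c, (prod_chart c' c''); split=> //; first by exists c' => //; exists c''.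
exists (N1 `&` N2); split=> //.
- exact: openI.
- move=> y [/sN1[z [cz c'z] <-] /sN2[w [cw c''w]]] /(chart_inj aS Sc cw cz) E.
  by subst w; exists z.
- apply: Cinfty_row_mx; first exact: openI.
    by apply: Cinfty_sub N1C => y [].
  by apply: Cinfty_sub N2C => y [].
Qed.

Lemma smooth_at_fst T T' (S : atlas R T) (S' : atlas R T') p :
  is_atlas S -> is_atlas S' -> smooth_at (prod_atlas S S') S fst p.
Proof.
move=> [S1 S2 S3] [S'1 S'2 S'3]; case: p => x y.
have [c Sc cx] := S3 x; have [c' Sc' cy] := S'3 y.
exists (prod_chart c c'), c; split=> //; first by exists c => //; exists c'.
have [cK oc] := S1 c Sc; have [c'K oc'] := S'1 c' Sc'.
exists (cmap (prod_chart c c') @` (cdom c `*` cdom c')).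
have oN : open (cmap (prod_chart c c') @` (cdom c `*` cdom c')).
  by rewrite prod_chart_image; exact: open_prod_image.
split=> //.
- by exists (x, y).
- by move=> _ [[a b] [ca cb] <-]; exists (a, b).
- apply: (@Cinfty_eq _ _ _ _ lsubmx) => //; last exact: Cinfty_lsubmx.
  by move=> _ /set_mem[[a b] [/= ca cb] <-] /=; rewrite row_mxKl cK ?inE.
Qed.

Lemma smooth_at_snd T T' (S : atlas R T) (S' : atlas R T') p :
  is_atlas S -> is_atlas S' -> smooth_at (prod_atlas S S') S' snd p.
Proof.
move=> [S1 S2 S3] [S'1 S'2 S'3]; case: p => x y.
have [c Sc cx] := S3 x; have [c' Sc' cy] := S'3 y.
exists (prod_chart c c'), c'; split=> //; first by exists c => //; exists c'.
have [cK oc] := S1 c Sc; have [c'K oc'] := S'1 c' Sc'.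
exists (cmap (prod_chart c c') @` (cdom c `*` cdom c')).
have oN : open (cmap (prod_chart c c') @` (cdom c `*` cdom c')).
  by rewrite prod_chart_image; exact: open_prod_image.
split=> //.
- by exists (x, y).
- by move=> _ [[a b] [ca cb] <-]; exists (a, b).
- apply: (@Cinfty_eq _ _ _ _ rsubmx) => //; last exact: Cinfty_rsubmx.
  by move=> _ /set_mem[[a b] [/= ca cb] <-] /=; rewrite row_mxKr c'K ?inE.
Qed.

End Products.

(** * Manifolds with one chart *)

Section SingleChart.
Context (R : realType) (T : choiceType) (n : nat).
Variables (phi : T -> 'rV[R]_n) (psi : 'rV[R]_n -> T).
Hypotheses (phiK : cancel phi psi) (phi_open : open (range phi)).
Let S := single_chart setT phi psi.

Lemma single_chart_atlas : is_atlas S.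
Proof.
split.
- by move=> _ ->; split=> [x _|] /=.
- move=> _ _ -> -> /=; rewrite setIT; split=> //.
  apply: (@Cinfty_eq _ _ _ _ id) => //; last by move=> k; exact: Ck_id.
  by move=> _ /set_mem[x _ <-] /=; rewrite phiK.
- by move=> x; exists (Chart setT phi psi).
Qed.

Lemma open_single_chart (V : set 'rV[R]_n) : open V -> open (phi @^-1` V : set (mspace S)).
Proof.
move=> oV; have := @open_mspace_subbase R T S (Chart setT phi psi) V erefl oV.
by rewrite setTI.
Qed.

Lemma single_chart_hausdorff : hausdorff_space (mspace S).
Proof.
move=> x y clxy; apply: (can_inj phiK).
apply: (@norm_hausdorff R 'rV[R]_n) => A B /= nA nB.
have nbhs_pre z C : nbhs (phi z) C -> nbhs (z : mspace S) (phi @^-1` C).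
  move=> nC; rewrite nbhsE; exists (phi @^-1` C°).
    by split; [exact: open_single_chart (@open_interior _ C)|].
  by move=> w; exact: interior_subset.
by have [z [Az Bz]] := clxy _ _ (nbhs_pre _ _ nA) (nbhs_pre _ _ nB); exists (phi z).
Qed.

(** Rational points are dense for the sup norm, which makes the balls with
    rational centre and radius 1/(k+1) a countable basis in
    [single_chart_second_countable]. *)
Lemma rat_approx (x : 'rV[R]_n) (e : R) : 0 < e ->
  exists q : 'rV[rat]_n, ball (map_mx ratr q : 'rV[R]_n) e x.
Proof.
move=> e0; have /choice[q Hq] i : exists q : rat, ball (ratr q : R) e (x 0 i).
  have [q] := @rat_in_itvoo R (x 0 i - e) (x 0 i + e) ltac:(lra).
  rewrite in_itv /= => /andP[q1 q2]; exists q.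
  by rewrite -ball_normE /= ltr_distlC; apply/andP; split; lra.
exists (\row_i q i); split=> // a i; rewrite !mxE (ord1 a).
exact: Hq.
Qed.

Lemma single_chart_second_countable : @second_countable (mspace S).
Proof.
pose B (i : 'rV[rat]_n * nat) : set (mspace S) :=
  phi @^-1` ball (map_mx ratr i.1 : 'rV[R]_n) (i.2.+1%:R^-1).
exists (range B).
  exact: sub_countable (card_image_le _ _) (countableP _).
split=> [_ [i _ <-]|x A].
  by apply: open_single_chart; exact: ball_open.
have Hn : nbhs x = [set A0 | exists2 B0 : set (mspace S), open_nbhs x B0 & B0 `<=` A0].
  exact: nbhsE.
move=> xA; have : nbhs x A by exact: xA.
rewrite Hn => -[D [/(open_mspaceP _ single_chart_atlas) oD Dx] DA].
have := oD _ erefl; rewrite /= setTI => oDx.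
have /nbhs_ballP[e /= e0 eD] : nbhs (phi x) (phi @` D).
  by apply: open_nbhs_nbhs; split=> //; exists x.
have [k ke] : exists k : nat, k.+1%:R^-1 < e / 2.
  have [N _ /(_ N)/(_ (leqnn _)) ?] := @near_infty_natSinv_lt R (PosNum (divr_gt0 e0 (ltr0Sn R 1))).
  by exists N.
have [q qx] := @rat_approx (phi x) (k.+1%:R^-1) ltac:(by rewrite invr_gt0).
exists (B (q, k)); first by split=> //; exists (q, k).
move=> y By; apply: DA.
have [|z Dz /(can_inj phiK) <-//] := eD (phi y).
apply: (@le_ball _ _ _ (k.+1%:R^-1 + k.+1%:R^-1)).
  by rewrite ltW// [ltRHS]splitr ltrD.
exact: ball_triangle (ball_sym qx) By.
Qed.

Lemma single_chart_manifold : is_manifold S.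
Proof.
have [S1 S2 S3] := single_chart_atlas; split=> //.
- exact: single_chart_hausdorff.
- exact: single_chart_second_countable.
Qed.

End SingleChart.

(** * The algebra of quaternions *)

Section QuaternionAlgebra.
Context (R : realType).
Local Notation H := (quat R).
Implicit Types p q : H.

Let qE := (qcoord_mk, qcoordD, qcoordZ, qcoord0).

Lemma qcoordN q k : qcoord (- q) k = - qcoord q k.
Proof. by rewrite /qcoord mxE. Qed.

Lemma qmulE p q : p * q = qmul p q. Proof. by []. Qed.

Lemma qoneE : (1 : H) = mkquat 1 0 0 0. Proof. by []. Qed.

Lemma qscalerAl (a : R) p q : a *: (p * q) = (a *: p) * q.
Proof. by apply: quatP; rewrite !qmulE /qmul !qE; ring. Qed.

HB.instance Definition _ := GRing.Lmodule_isLalgebra.Build R H qscalerAl.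

Lemma qscalerAr (a : R) p q : a *: (p * q) = p * (a *: q).
Proof. by apply: quatP; rewrite !qmulE /qmul !qE; ring. Qed.

HB.instance Definition _ := GRing.Lalgebra_isAlgebra.Build R H qscalerAr.

Lemma qconjM p q : qconj (p * q) = qconj q * qconj p.
Proof. by apply: quatP; rewrite /qconj !qmulE /qmul !qE; ring. Qed.

Lemma qconjN p : qconj (- p) = - qconj p.
Proof. by apply: quatP; rewrite /qconj ?qcoordN !qE; ring. Qed.

Lemma qconjK : involutive (@qconj R).
Proof. by move=> p; apply: quatP; rewrite /qconj !qE; ring. Qed.

Lemma qconjZ (a : R) p : qconj (a *: p) = a *: qconj p.
Proof. by apply: quatP; rewrite /qconj !qE; ring. Qed.

Lemma qconj1 : qconj 1 = 1 :> H.
Proof. by apply: quatP; rewrite /qconj qoneE !qE; ring. Qed.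

Lemma qconj0 : qconj 0 = 0 :> H.
Proof. by apply: quatP; rewrite /qconj !qE; ring. Qed.

Lemma mulqqJ q : q * qconj q = (qnormsq q)%:A.
Proof. by apply: quatP; rewrite /qconj qmulE /qmul qoneE !qE /qnormsq; ring. Qed.

Lemma mulqJq q : qconj q * q = (qnormsq q)%:A.
Proof. by apply: quatP; rewrite /qconj qmulE /qmul qoneE !qE /qnormsq; ring. Qed.

Lemma qnormsq_conj q : qnormsq (qconj q) = qnormsq q.
Proof. by rewrite /qnormsq /qconj !qE; ring. Qed.

Lemma qnormsqN q : qnormsq (- q) = qnormsq q.
Proof. by rewrite /qnormsq !qcoordN; ring. Qed.

Lemma qnormsqM p q : qnormsq (p * q) = qnormsq p * qnormsq q.
Proof. by rewrite qmulE /qnormsq /qmul !qE; ring. Qed.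

Lemma qnormsq_ge0 q : 0 <= qnormsq q.
Proof. by rewrite /qnormsq !addr_ge0 ?sqr_ge0. Qed.

Lemma qnormsq1 : qnormsq 1 = 1 :> R.
Proof. by rewrite /qnormsq qoneE !qE; ring. Qed.

Lemma qnormsqZ (a : R) q : qnormsq (a *: q) = a ^+ 2 * qnormsq q.
Proof. by rewrite /qnormsq !qE; ring. Qed.

Lemma qnorm_sqr q : qnorm q ^+ 2 = qnormsq q.
Proof. by rewrite /qnorm sqr_sqrtr// qnormsq_ge0. Qed.

Lemma qballP q : qball R q <-> qnormsq q < 1.
Proof.
rewrite /qball /= -qnorm_sqr; split=> h.
  by rewrite expr_lt1// sqrtr_ge0.
by rewrite -(@expr_lt1 _ 2) ?sqrtr_ge0.
Qed.

Lemma Sp1P q : Sp1 R q <-> qnormsq q = 1.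
Proof.
rewrite /Sp1 /= -qnorm_sqr; split=> [->|/eqP]; first by rewrite expr1n.
by rewrite sqrp_eq1 ?sqrtr_ge0// => /eqP.
Qed.

Lemma qunit q : q != 0 -> q \is a GRing.unit.
Proof. by []. Qed.

Lemma qconj_eq0 q : (qconj q == 0) = (q == 0).
Proof. by rewrite -!qnormsq_eq0 qnormsq_conj. Qed.

Lemma qinvE q : q^-1 = (qnormsq q)^-1 *: qconj q.
Proof. by []. Qed.

Lemma qconjV q : qconj q^-1 = (qconj q)^-1.
Proof. by rewrite !qinvE qconjZ qnormsq_conj qconjK. Qed.

Lemma qnormsqV q : qnormsq q^-1 = (qnormsq q)^-1.
Proof.
rewrite qinvE qnormsqZ qnormsq_conj.
have [->|q0] := eqVneq (qnormsq q) 0; first by rewrite mulr0 invr0.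
by field.
Qed.

Lemma qtraceC p q : p * qconj q + q * qconj p = qconj p * q + qconj q * p.
Proof. by apply: quatP; rewrite /qconj !qmulE /qmul !qE; ring. Qed.

Definition qtrace (p : H) : R := 2 * qcoord p 0.

Lemma qaddJ p : p + qconj p = (qtrace p)%:A.
Proof. by apply: quatP; rewrite /qconj /qtrace qoneE !qE; ring. Qed.

Lemma qmulfI q : q != 0 -> injective (fun p => q * p).
Proof. by move=> q0 x y /= /(congr1 (fun z => q^-1 * z)); rewrite !mulKr// qunit. Qed.

Lemma qmulf_eq0 p q : (p * q == 0) = (p == 0) || (q == 0).
Proof. by rewrite -!qnormsq_eq0 qnormsqM mulf_eq0. Qed.

Lemma qinv_eq0 p : (p^-1 == 0) = (p == 0).
Proof. by rewrite -!qnormsq_eq0 qnormsqV invr_eq0. Qed.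

Lemma qinvM p q : (p * q)^-1 = q^-1 * p^-1.
Proof.
have [->|p0] := eqVneq p 0; first by rewrite mul0r invr0 mulr0.
have [->|q0] := eqVneq q 0; first by rewrite mulr0 invr0 mul0r.
by rewrite invrM ?qunit.
Qed.

End QuaternionAlgebra.

(** * Quaternionic power series *)

Section QuaternionSeries.
Context (R : realType).
Local Notation H := (quat R).
Implicit Types (p q : H) (f g : H -> H) (a b : nat -> H).

Lemma norm_qcoord_le q k : `|qcoord q k| <= `|q : 'rV[R]_4|.
Proof. exact: coord_le_norm. Qed.

Lemma le_qnorm q : `|q : 'rV[R]_4| <= qnorm q.
Proof.
apply: norm_le_coord => [|i]; first exact: sqrtr_ge0.
rewrite -sqrtr_sqr ler_wsqrtr// /qnormsq.
have -> : (q : 'rV[R]_4) 0 i = qcoord q i by rewrite /qcoord inord_val.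
have := sqr_ge0 (qcoord q 0); have := sqr_ge0 (qcoord q 1).
have := sqr_ge0 (qcoord q 2); have := sqr_ge0 (qcoord q 3).
by case: i => [[|[|[|[|//]]]] _] /=; move: (_ ^+ 2) (_ ^+ 2) (_ ^+ 2) (_ ^+ 2) => *; lra.
Qed.

Lemma qnorm_le q : qnorm q <= 2 * `|q : 'rV[R]_4|.
Proof.
have n0 : 0 <= 2 * `|q : 'rV[R]_4| by rewrite mulr_ge0.
rewrite -(ger0_norm n0) -sqrtr_sqr ler_wsqrtr// exprMn /qnormsq.
have le k : qcoord q k ^+ 2 <= `|q : 'rV[R]_4| ^+ 2.
  by rewrite -(real_normK (num_real (qcoord q k))) ler_sqr ?nnegrE// norm_qcoord_le.
have := le 0%N; have := le 1%N; have := le 2%N; have := le 3%N.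
by move: (_ ^+ 2) (_ ^+ 2) (_ ^+ 2) (_ ^+ 2) (_ ^+ 2) => *; lra.
Qed.

(** The topology of the quaternions is that of the sup norm, whereas only the
    Euclidean norm is multiplicative; the two are compared in [le_qnorm] and
    [qnorm_le]. *)
Lemma qcvgP (u : nat -> H) (l : H) :
  u @ \oo --> l <-> (fun n => qnorm (u n - l)) @ \oo --> (0 : R).
Proof.
pose v : nat -> 'rV[R]_4 := u.
split=> [ul|/cvgrPdist_lt ul].
  have /cvgrPdist_lt vl : v @ \oo --> (l : 'rV[R]_4) by exact: ul.
  apply/cvgrPdist_lt => e e0.
  have e20 : 0 < e / 2 by rewrite divr_gt0.
  apply: filterS (vl _ e20) => n.
  rewrite sub0r normrN ger0_norm ?sqrtr_ge0// => h.
  apply: le_lt_trans (qnorm_le _) _.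
  by rewrite mulrC -ltr_pdivlMr// -[_ - _]opprB normrN.
suff : v @ \oo --> (l : 'rV[R]_4) by [].
apply/cvgrPdist_lt => e e0; apply: filterS (ul _ e0) => n.
rewrite sub0r normrN ger0_norm ?sqrtr_ge0//.
by rewrite -normrN opprB; apply: le_lt_trans; exact: le_qnorm.
Qed.

Lemma qcvgD (u v : nat -> H) (l m : H) :
  u @ \oo --> l -> v @ \oo --> m -> (fun n => u n + v n) @ \oo --> l + m.
Proof.
move=> ul vm; pose u' : nat -> 'rV[R]_4 := u; pose v' : nat -> 'rV[R]_4 := v.
exact: (@cvgD _ 'rV[R]_4 _ _ _ u' v' (l : 'rV[R]_4) (m : 'rV[R]_4) ul vm).
Qed.

Lemma qcvg_cst (l : H) : (fun _ : nat => l) @ \oo --> l.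
Proof. exact: cvg_cst. Qed.

Lemma qcvgM (u : nat -> H) (l p q : H) :
  u @ \oo --> l -> (fun n => p * u n * q) @ \oo --> p * l * q.
Proof.
move=> /qcvgP ul; apply/qcvgP.
rewrite (_ : (fun n => _) = (fun n => qnorm p * qnorm (u n - l) * qnorm q)); last first.
  by apply/funext => n; rewrite -mulrBl -mulrBr !qnormM.
rewrite [X in _ --> X](_ : 0 = qnorm p * 0 * qnorm q); last by rewrite mulr0 mul0r.
by apply: cvgMl; apply: cvgMr.
Qed.

Lemma qcvg_near_cst (u : nat -> H) (l : H) N : (forall n, (N <= n)%N -> u n = l) -> u @ \oo --> l.
Proof.
move=> ul; apply/qcvgP; apply/cvgrPdist_lt => e e0; exists N => // n /= Nn.
by rewrite ul// subrr /qnorm (eqP (_ : qnormsq _ == 0)) ?qnormsq_eq0// sqrtr0 subrr normr0.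
Qed.

Lemma qcvg_shiftS (u : nat -> H) (l : H) : (fun n => u n.+1) @ \oo --> l <-> u @ \oo --> l.
Proof.
have E := cvg_shiftS (fun n => qnorm (u n - l)) (nbhs (0 : R)).
by split=> /qcvgP h; apply/qcvgP; [rewrite -E|rewrite E].
Qed.

Lemma qpseries_eq a q (l : H) : series (fun n => q ^+ n * a n) @ \oo --> l -> qpseries a q = l.
Proof. by move=> al; apply/cvg_lim. Qed.

(** Convergence at t = 1/2 bounds |c_n| by M 2^n. For small t the partial sums
    then stay within 4 M t <= |c_0| / 2 of c_0, so their limit 0 forces
    c_0 = 0. *)
Lemma real_series_coef0 (c : nat -> R) :
  (forall t : R, 0 < t < 1 -> series (fun n => t ^+ n * c n) @ \oo --> (0 : R)) -> c 0%N = 0.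
Proof.
move=> H0.
have [M M0 HM] : exists2 M, 0 < M & forall n, `|c n| <= M * 2 ^+ n.
  have h12 : 0 < (2^-1 : R) < 1 by rewrite invr_gt0 ltr0n /= invf_lt1// ltr1n.
  have cvs : cvgn (series (fun n => 2^-1 ^+ n * c n)).
    by apply/cvg_ex; exists 0; exact: H0.
  have /cvg_seq_bounded/pinfty_ex_gt0[M M0 HM] := cvgP _ (cvg_series_cvg_0 cvs).
  exists M => // n; have /= := HM n I; rewrite normrM normrX ger0_norm ?invr_ge0//.
  have E0 : 0 < (2 : R) ^+ n by exact: exprn_gt0.
  by rewrite exprVn [_ * `|_|]mulrC (ler_pdivrMr _ _ E0).
apply/eqP/negPn/negP => c0.
have c0' : 0 < `|c 0%N| by rewrite normr_gt0.
pose t : R := Num.min (1 / 4) (`|c 0%N| / (8 * M)).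
have t0 : 0 < t by rewrite lt_min !divr_gt0// mulr_gt0.
have t4 : t <= 1 / 4 by rewrite ge_min lexx.
have tM : 4 * M * t <= `|c 0%N| / 2.
  have : t <= `|c 0%N| / (8 * M) by rewrite ge_min lexx orbT.
  rewrite ler_pdivlMr ?mulr_gt0// => h.
  by rewrite ler_pdivlMr//; move: h; rewrite [t * _]mulrC; lra.
(* The second term makes the induction work: each step adds at most
   M (2t)^(m+1) to the first one and takes more than that off the second. *)
have Sm m : `|series (fun n => t ^+ n * c n) m.+1 - c 0%N| + 4 * M * t * (2 * t) ^+ m <= 4 * M * t.
  elim: m => [|m IH].
    by rewrite /series /= big_nat1 expr0 mul1r subrr normr0 add0r mulr1.
  apply: le_trans IH; rewrite /series /= [in leLHS]big_nat_recr//= addrAC.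
  set s := \sum_(0 <= _ < _) _ - c 0%N.
  apply: (@le_trans _ _ (`|s| + M * (2 * t) ^+ m.+1 + 4 * M * t * (2 * t) ^+ m.+1)).
    rewrite lerD2r; apply: le_trans (ler_normD _ _) _; rewrite lerD2l normrM normrX gtr0_norm//.
    have -> : M * (2 * t) ^+ m.+1 = t ^+ m.+1 * (M * 2 ^+ m.+1) by rewrite exprMn; ring.
    by rewrite ler_pM2l ?exprn_gt0.
  rewrite -addrA lerD2l !exprS.
  have X0 : 0 < (2 * t) ^+ m by rewrite exprn_gt0// mulr_gt0.
  set X := (2 * t) ^+ m in X0 *.
  have -> : M * (2 * t * X) + 4 * M * t * (2 * t * X) = (M * X * t) * (2 * (1 + 4 * t)) by ring.
  have -> : 4 * M * t * X = (M * X * t) * 4 by ring.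
  by rewrite ler_pM2l ?mulr_gt0//; lra.
have t1 : 0 < t < 1 by rewrite t0 /=; lra.
have c02 : 0 < `|c 0%N| / 2 by rewrite divr_gt0.
have /cvgrPdist_lt/(_ _ c02) [N _ /(_ N.+1)] := H0 t t1.
rewrite /= leqnSn => /(_ isT); rewrite sub0r normrN => h.
have := Sm N; set S := series _ _ in h * => hS.
have : `|c 0%N| <= `|S - c 0%N| + `|S|.
  by rewrite -[X in `|X|](subKr S) distrC; apply: ler_normB.
have : 0 < 4 * M * t * (2 * t) ^+ N by rewrite !mulr_gt0// exprn_gt0// mulr_gt0.
by lra.
Qed.

(** Once the coefficients below n vanish, dividing the series by t^n reduces
    to the constant coefficient. *)
Lemma real_series_uniq (c : nat -> R) :
  (forall t : R, 0 < t < 1 -> series (fun n => t ^+ n * c n) @ \oo --> (0 : R)) ->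
  forall n, c n = 0.
Proof.
move=> H0 n; elim/ltn_ind: n => n IH.
rewrite -[n]addn0; apply: (@real_series_coef0 (fun j => c (n + j)%N)) => t t01.
have t0 : 0 < t by case/andP: t01.
have : (fun m => t ^- n * series (fun n => t ^+ n * c n) (m + n)%N) @ \oo --> (t ^- n * 0 : R).
  by apply: cvgMr; rewrite (cvg_shiftn n); exact: H0.
rewrite mulr0; apply: cvg_trans; apply: near_eq_cvg; apply: nearW => m.
have E : \sum_(0 <= k < m + n) t ^+ k * c k = t ^+ n * \sum_(0 <= k < m) t ^+ k * c (n + k)%N.
  rewrite (big_cat_nat (n := n)) ?leq_addl//= big_nat big1 ?add0r; last first.
    by move=> i /andP[_ i_n]; rewrite IH// mulr0.
  rewrite -{1}[n]add0n big_addn addnK big_distrr /=.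
  by apply: eq_bigr => i _; rewrite mulrA -exprD addnC.
by rewrite /series /= E mulKr// unitfE expf_neq0// gt_eqF.
Qed.

Lemma qcoord_sum (I : Type) (r : seq I) (P : pred I) (F : I -> H) k :
  qcoord (\sum_(i <- r | P i) F i) k = \sum_(i <- r | P i) qcoord (F i) k.
Proof.
by apply: (big_morph (fun q : H => qcoord q k)); [move=> p q; exact: qcoordD|exact: qcoord0].
Qed.

(** On the real points of the ball a quaternionic series is a quadruple of
    real series, one for each coordinate. *)
Lemma expansion_uniq f a b : has_expansion f a -> has_expansion f b -> a = b.
Proof.
move=> fa fb; apply/funext => n.
suff E k : qcoord (a n) k - qcoord (b n) k = 0 by apply: quatP; apply/eqP; rewrite -subr_eq0 E.
apply: (@real_series_uniq (fun n => qcoord (a n) k - qcoord (b n) k)) => t /andP[t0 t1].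
have Bt : qball R (t *: 1).
  by apply/qballP; rewrite qnormsqZ qnormsq1 mulr1 expr_lt1// ltW.
have cvk u l : u @ \oo --> (l : H) -> (fun n => qcoord (u n) k) @ \oo --> qcoord l k.
  move=> ul; pose v : nat -> 'rV[R]_4 := u.
  have vl : v @ \oo --> (l : 'rV[R]_4) by exact: ul.
  apply: (@cvg_comp _ _ _ v (fun M : 'rV[R]_4 => M 0 (inord k)) _ (nbhs (l : 'rV[R]_4)) _ vl).
  exact: coord_continuous.
have := @cvgB _ _ _ _ _ _ _ _ _ (cvk _ _ (fa _ Bt)) (cvk _ _ (fb _ Bt)); rewrite subrr => /(_ _).
apply: cvg_trans; apply: near_eq_cvg; apply: nearW => m /=.
rewrite /series /= [RHS](_ : _ = qcoord (\sum_(0 <= i < m) ((t *: 1) ^+ i * a i)) k -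
   qcoord (\sum_(0 <= i < m) ((t *: 1) ^+ i * b i)) k)//.
rewrite !qcoord_sum -sumrB; apply: eq_bigr => i _.
by rewrite exprZn expr1n -!scalerAl !mul1r !qcoordZ mulrBr.
Qed.

Lemma qcoefs_eq f a : has_expansion f a -> qcoefs f = a.
Proof.
move=> fa; rewrite /qcoefs; case: xgetP => [b _ fb|/(_ a)//].
exact: expansion_uniq fb fa.
Qed.

Lemma qseries_finite a q N : (forall n, (N <= n)%N -> a n = 0) ->
  series (fun n => q ^+ n * a n) @ \oo --> \sum_(0 <= n < N) q ^+ n * a n.
Proof.
move=> a0; apply: (@qcvg_near_cst _ _ N) => n Nn.
rewrite /series /= (big_cat_nat (n := N))//= [X in _ + X]big_nat [X in _ + X]big1 ?addr0// => i /andP[Ni _].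
by rewrite a0// mulr0.
Qed.

End QuaternionSeries.

(** * Regular reciprocals of affine functions *)

Section MobiusFormula.
Context (R : realType).
Local Notation H := (quat R).
Implicit Types (a b c d p q : H).

Definition affine_coefs (a b : H) (n : nat) : H :=
  if n is n'.+1 then (if n' is 0%N then a else 0) else b.

Lemma affine_coefs_finite a b n : (2 <= n)%N -> affine_coefs a b n = 0.
Proof. by case: n => [|[|n]]. Qed.

Lemma affine_series (a b q : H) :
  series (fun n => q ^+ n * affine_coefs a b n) @ \oo --> affine a b q.
Proof.
have -> : affine a b q = \sum_(0 <= n < 2) q ^+ n * affine_coefs a b n.
  by rewrite /affine big_nat_recr//= big_nat1 expr0 mul1r expr1 addrC.
exact: qseries_finite (@affine_coefs_finite a b).
Qed.

Lemma affine_qcoefs a b : qcoefs (affine a b) = affine_coefs a b.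
Proof. by apply: qcoefs_eq => q _; exact: affine_series. Qed.

Lemma reg_conj_affine a b : reg_conj (affine a b) = affine (qconj a) (qconj b).
Proof.
apply/funext => q; rewrite /reg_conj affine_qcoefs; apply: qpseries_eq.
rewrite (_ : (fun n => _) = (fun n => q ^+ n * affine_coefs (qconj a) (qconj b) n)).
  exact: affine_series.
by apply/funext => -[|[|n]] //=; rewrite qconj0.
Qed.

(** Twice the real part of conj(d) c; it is the middle coefficient of the
    symmetrization of q c + d, and being real ([qdot2E]) it commutes
    with q. *)
Definition qdot2 (c d : H) : H := qconj d * c + qconj c * d.

Lemma symmetrization_affine c d q : symmetrization (affine c d) q =
  (qnormsq d)%:A + q * qdot2 c d + q ^+ 2 * (qnormsq c)%:A.
Proof.
rewrite /symmetrization /star_mul reg_conj_affine !affine_qcoefs.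
apply: qpseries_eq.
pose m (n : nat) := \sum_(k < n.+1) affine_coefs c d k * affine_coefs (qconj c) (qconj d) (n - k)%N.
have m0 n : (3 <= n)%N -> m n = 0.
  move=> n3; rewrite /m big1// => k _.
  have [k2|k2] := leqP 2 k; first by rewrite affine_coefs_finite// mul0r.
  rewrite [X in _ * X]affine_coefs_finite ?mulr0//.
  by rewrite ltn_subRL addn1; exact: leq_ltn_trans k2 n3.
rewrite (_ : _ + _ = \sum_(0 <= n < 3) q ^+ n * m n); first exact: qseries_finite m0.
rewrite big_nat_recr// [X in _ = X + _]big_nat_recr// big_nat1 expr0 mul1r expr1.
have -> : m 0%N = (qnormsq d)%:A by rewrite /m big_ord_recl big_ord0 addr0 /= mulqqJ.
have -> : m 1%N = qdot2 c d.
  by rewrite /m !big_ord_recl big_ord0 addr0 /= /qdot2 -qtraceC.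
have -> // : m 2%N = (qnormsq c)%:A.
by rewrite /m !big_ord_recl big_ord0 addr0 /= mulr0 mul0r add0r addr0 mulqqJ.
Qed.

Lemma affine_neq0 c d q : qnormsq c < qnormsq d -> qnormsq q < 1 -> affine c d q != 0.
Proof.
move=> cd q1; apply/eqP => /eqP; rewrite /affine addr_eq0 => /eqP E.
have := congr1 (@qnormsq R) E; rewrite qnormsqM qnormsqN => E'.
have := qnormsq_ge0 c; have := qnormsq_ge0 q => q0 c0.
have : qnormsq q * qnormsq c <= 1 * qnormsq c by rewrite ler_wpM2r// ltW.
by rewrite E' mul1r leNgt cd.
Qed.

(** The rule for evaluating a regular product at a point where the left factor
    f does not vanish: (f * g)(q) = f(q) g(f(q)^{-1} q f(q)), here with g the
    regular conjugate of f. *)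
Lemma symmetrizationE c d q : affine c d q != 0 ->
  symmetrization (affine c d) q = affine c d q *
    affine (qconj c) (qconj d) ((affine c d q)^-1 * q * affine c d q).
Proof.
have E w : w != 0 -> w * affine (qconj c) (qconj d) (w^-1 * q * w) =
    q * w * qconj c + w * qconj d.
  by move=> w0; rewrite /affine mulrDr !mulrA mulrV ?qunit// mul1r.
move=> w0; rewrite (E _ w0) symmetrization_affine /affine.
rewrite -!mulqqJ expr2 /qdot2 -qtraceC !mulrDr !mulrDl -!mulrA.
move: (d * qconj d) (q * (d * _)) (q * (c * _)) (q * (q * _)) => x y z t.
by apply: quatP; rewrite !qcoordD; ring.
Qed.

Lemma qdot2E c d : exists r : R, qdot2 c d = r%:A.
Proof.
exists (qtrace (qconj d * c)); rewrite -qaddJ qconjM qconjK.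
by [].
Qed.

(** The coefficients e_n of the regular reciprocal of q c + d: d e_0 = 1 and d
    e_{n+1} = - c e_n express that the regular product of the two is 1. *)
Definition inv_coefs (c d : H) (n : nat) : H := (- (d^-1 * c)) ^+ n * d^-1.

Lemma inv_coefsS c d n : d != 0 -> d * inv_coefs c d n.+1 = - (c * inv_coefs c d n).
Proof.
move=> d0; rewrite /inv_coefs exprS !mulrA mulrN mulrA mulrV ?qunit// mul1r.
by rewrite !mulNr.
Qed.

Lemma qnormsq_scale d q : qnormsq d *: q = qconj d * (d * q).
Proof. by rewrite mulrA mulqJq mulr_algl. Qed.

Lemma inv_coefs0 c d : d != 0 -> d * inv_coefs c d 0 = 1.
Proof. by move=> d0; rewrite /inv_coefs expr0 mul1r mulrV ?qunit. Qed.

(** The recurrence of order two which the symmetrization, a real quadratic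
    polynomial, imposes on its quotient. *)
Lemma inv_coefsSS c d n : d != 0 ->
  qnormsq d *: inv_coefs c d n.+2 + qdot2 c d * inv_coefs c d n.+1
  = - (qnormsq c *: inv_coefs c d n).
Proof.
move=> d0.
rewrite (qnormsq_scale d).
rewrite (qnormsq_scale c).
rewrite /qdot2 mulrDl -(mulrA (qconj d)) -(mulrA (qconj c)).
rewrite (inv_coefsS _ n.+1 d0) (inv_coefsS _ n d0).
by rewrite !mulrN addKr.
Qed.

(** Multiplying the partial sum by the symmetrization makes all terms
    telescope by [inv_coefsSS], except the first two, which form the regular
    conjugate, and the last two. *)
Lemma star_inv_partial c d q N : d != 0 ->
  symmetrization (affine c d) q * series (fun n => q ^+ n * inv_coefs c d n) N =
  affine (qconj c) (qconj d) q
  - (q ^+ N * (qnormsq d *: inv_coefs c d N) +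
     q ^+ N.+1 * (qnormsq d *: inv_coefs c d N.+1 + qdot2 c d * inv_coefs c d N)).
Proof.
move=> d0; have [r rE] := qdot2E c d.
elim: N => [|N IH].
  rewrite /series /= big_geq// mulr0 expr0 mul1r expr1.
  rewrite !(qnormsq_scale d) /qdot2 mulrDl -(mulrA (qconj d)) -(mulrA (qconj c)).
  rewrite (inv_coefsS _ 0 d0) (inv_coefs0 _ d0).
  by rewrite !mulr1 mulrN addKr /affine [qconj d + _]addrC subrr.
rewrite /series /= big_nat_recr//= mulrDr IH inv_coefsSS//.
have step e : symmetrization (affine c d) q * (q ^+ N * e) =
    q ^+ N * (qnormsq d *: e) + q ^+ N.+1 * (qdot2 c d * e)
    + q ^+ N.+2 * (qnormsq c *: e).
  rewrite symmetrization_affine rE expr2 (exprS q N.+1) (exprS q N).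
  move: (q ^+ N) => Q.
  by rewrite !mulrDl -!mulrA !mulr_algl -!scalerAr.
rewrite step.
rewrite mulrDr mulrN.
move: (q ^+ N * _) (q ^+ N.+1 * _) (q ^+ N.+1 * _) (q ^+ N.+2 * _) (affine _ _ _) => x y z t u.
by apply: quatP; rewrite !(qcoordD, qcoordN); ring.
Qed.

(** As |d^{-1} c| < 1, the two remaining terms in [star_inv_partial] tend to
    0. *)
Lemma star_inv_expansion c d q : qnormsq c < qnormsq d -> qball R q ->
  series (fun n => q ^+ n * inv_coefs c d n) @ \oo --> star_inv (affine c d) q.
Proof.
move=> cd Bq; have q1 : qnormsq q < 1 by apply/qballP.
have d0 : d != 0.
  by rewrite -qnormsq_eq0 gt_eqF// (le_lt_trans _ cd)// qnormsq_ge0.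
have f0 := affine_neq0 cd q1.
pose D := symmetrization (affine c d) q.
have D0 : D != 0.
  rewrite /D symmetrizationE// qmulf_eq0 negb_or f0; apply: affine_neq0.
    by rewrite !qnormsq_conj.
  rewrite !qnormsqM qnormsqV mulrAC mulVf ?mul1r//.
  by rewrite qnormsq_eq0.
pose u n := q ^+ n * inv_coefs c d n.
have nd0 : 0 < qnormsq d by rewrite (le_lt_trans _ cd)// qnormsq_ge0.
have u0 : u @ \oo --> (0 : H).
  apply/qcvgP.
  have z1 : `|qnorm q * qnorm (d^-1 * c)| < 1.
    rewrite -qnormM ger0_norm ?sqrtr_ge0//.
    suff : qball R (q * (d^-1 * c)) by [].
    apply/qballP; rewrite !qnormsqM qnormsqV.
    apply: (@le_lt_trans _ _ (1 * ((qnormsq d)^-1 * qnormsq c))).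
      by rewrite ler_wpM2r ?mulr_ge0 ?invr_ge0 ?qnormsq_ge0// ltW.
    by rewrite mul1r mulrC ltr_pdivrMr// mul1r.
  have := @cvg_geometric R (qnorm d^-1) _ z1.
  apply: cvg_trans; apply: near_eq_cvg; apply: nearW => n.
  have qnormX (x : H) k : qnorm (x ^+ k) = qnorm x ^+ k.
    elim: k => [|k IH]; last by rewrite !exprS qnormM IH.
    by rewrite !expr0 /qnorm qnormsq1 sqrtr1.
  have qnormN (x : H) : qnorm (- x) = qnorm x by rewrite /qnorm qnormsqN.
  rewrite subr0 /u /inv_coefs (qnormM (q ^+ n)) (qnormM (_ ^+ n)) !qnormX qnormN.
  by rewrite mulrA -exprMn [RHS]mulrC.
have uS : (fun n => u n.+1) @ \oo --> (0 : H).
  exact/(@qcvg_shiftS R u 0).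
have [r rE] := qdot2E c d.
pose B n := qnormsq d *: u n + (qnormsq d *: u n.+1 + r *: (q * u n)).
have B0 : B @ \oo --> (0 : H).
  have Z (x : R) (p : H) v : v @ \oo --> (0 : H) -> (fun n => x *: (p * v n)) @ \oo --> (0 : H).
    move=> v0; have := @qcvgM R v 0 (x *: p) 1 v0; rewrite mulr0 mul0r.
    by apply: cvg_trans; apply: near_eq_cvg; apply: nearW => n; rewrite mulr1 scalerAl.
  have Z1 (x : R) v : v @ \oo --> (0 : H) -> (fun n => x *: v n) @ \oo --> (0 : H).
    move=> /(Z x 1); apply: cvg_trans; apply: near_eq_cvg; apply: nearW => n.
    by rewrite mul1r.
  have := qcvgD (Z1 (qnormsq d) _ u0) (qcvgD (Z1 (qnormsq d) _ uS) (Z r q _ u0)).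
  by rewrite !addr0.
have SE n : series u n = D^-1 * affine (qconj c) (qconj d) q * 1 + (- D^-1) * B n * 1.
  rewrite !mulr1 mulNr -mulrBr.
  suff <- : D * series u n = affine (qconj c) (qconj d) q - B n by rewrite mulKr// qunit.
  rewrite star_inv_partial//; congr (_ - _); rewrite /B rE mulrDr mulr_algl -!scalerAr.
  have -> : q * u n = q ^+ n.+1 * inv_coefs c d n by rewrite /u exprS mulrA.
  by [].
have := qcvgD (@qcvg_cst R (D^-1 * affine (qconj c) (qconj d) q * 1)) (@qcvgM R B 0 (- D^-1) 1 B0).
rewrite mulr0 mul0r addr0 mulr1 /star_inv reg_conj_affine.
apply: cvg_trans; apply: near_eq_cvg; apply: nearW => n.
by rewrite -/(u) (SE n) (mulr1 (D^-1 * affine (qconj c) (qconj d) q)).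
Qed.

(** The n-th coefficient of the product is e_{n-1} a + e_n b: the factor q of
    the shifted part stays on the left of h(q), which gives q h(q) a rather
    than h(q) q a. *)
Lemma star_mul_affine (h : H -> H) (e : nat -> H) a b q :
  has_expansion h e -> qball R q ->
  star_mul h (affine a b) q = q * h q * a + h q * b.
Proof.
move=> he Bq; rewrite /star_mul (qcoefs_eq he) affine_qcoefs.
apply: qpseries_eq.
pose m (n : nat) := \sum_(k < n.+1) e k * affine_coefs a b (n - k)%N.
have m0 : m 0%N = e 0%N * b by rewrite /m big_ord_recl big_ord0 addr0.
have mS n : m n.+1 = e n * a + e n.+1 * b.
  rewrite /m !big_ord_recr /= subnn subSn// subnn /= big1 ?add0r// => i _.
  by rewrite affine_coefs_finite ?mulr0// ltn_subRL addn1 ltnS ltn_ord.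
pose S N := series (fun n => q ^+ n * e n) N.
have mE N : series (fun n => q ^+ n * m n) N.+1 = q * S N * a + S N.+1 * b.
  elim: N => [|N IH].
    by rewrite /S /series /= !big_nat1 big_geq// mulr0 mul0r add0r !expr0 !mul1r m0.
  have SS k : S k.+1 = S k + q ^+ k * e k by rewrite /S seriesSr.
  rewrite seriesSr IH mS !SS.
  rewrite exprS; move: (q ^+ N) (S N) => Q SN; rewrite !(mulrDr, mulrDl, mulrA).
  by rewrite addrACA.
have Sh : S @ \oo --> h q by exact: he.
have : (fun N => series (fun n => q ^+ n * m n) N.+1) @ \oo --> q * h q * a + h q * b.
  have hS : (fun N => S N.+1) @ \oo --> h q.
    exact/(@qcvg_shiftS R S (h q)).
  have := qcvgD (@qcvgM R S (h q) q a Sh) (@qcvgM R _ (h q) 1 b hS); rewrite mul1r.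
  apply: cvg_trans; apply: near_eq_cvg; apply: nearW => n.
  by rewrite mE mul1r.
exact: (iffLR (@qcvg_shiftS R (series (fun n => q ^+ n * m n)) _)).
Qed.

Lemma mobius_funE (A : 'M[H]_2) q : qnormsq (A 0 1) < qnormsq (A 1 1) -> qball R q ->
  let h := star_inv (affine (A 0 1) (A 1 1)) q in
  mobius_fun A q = q * h * A 0 0 + h * A 1 0.
Proof.
move=> cd Bq; apply: (@star_mul_affine _ (inv_coefs (A 0 1) (A 1 1))) => // p Bp.
exact: star_inv_expansion.
Qed.

End MobiusFormula.

(** * The transformation vanishing at a given point *)

Section MobiusNormalForm.
Context (R : realType).
Local Notation H := (quat R).
Implicit Types (a b c d p q x al : H).

Definition mob_core al q : H := star_inv (affine (- qconj al) 1) q.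

(** The value at q of the regular product (1 - q conj(al))^{-*} * (q - al), by
    [star_mul_affine]. *)
Definition mob_model al q : H := q * mob_core al q - mob_core al q * al.

Lemma star_inv_affineE c d q :
  star_inv (affine c d) q = (symmetrization (affine c d) q)^-1 * affine (qconj c) (qconj d) q.
Proof. by rewrite /star_inv reg_conj_affine. Qed.

Lemma qinvZ (r : R) q : (r *: q)^-1 = r^-1 *: q^-1.
Proof.
rewrite !qinvE qnormsqZ qconjZ !scalerA; congr (_ *: _).
have [->|r0] := eqVneq r 0; first by rewrite mulr0 invr0 mul0r.
have [->|n0] := eqVneq (qnormsq q) 0; first by rewrite mulr0 !invr0 mul0r mulr0.
by field; rewrite n0 r0.
Qed.

(** A constant left factor d multiplies the symmetrization by |d|^2 and the
    regular conjugate by conj(d) on the right. *)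
Lemma star_inv_scale p d q : d != 0 ->
  star_inv (affine (d * p) d) q = star_inv (affine p 1) q * d^-1.
Proof.
move=> d0; rewrite !star_inv_affineE.
have -> : symmetrization (affine (d * p) d) q = qnormsq d *: symmetrization (affine p 1) q.
  rewrite !symmetrization_affine /qdot2 qnormsqM qconjM qnormsq1 qconj1 !mulr1 mul1r.
  have -> : qconj d * (d * p) + qconj p * qconj d * d = qnormsq d *: (p + qconj p).
    by rewrite mulrA mulqJq mulr_algl -mulrA mulqJq mulr_algr scalerDr.
  by rewrite -!scalerAr -scalerA !scalerDr !mulr1 scale1r.
have nd0 : qnormsq d != 0 by rewrite qnormsq_eq0.
have -> : affine (qconj (d * p)) (qconj d) q = affine (qconj p) (qconj 1) q * qconj d.
  by rewrite /affine qconjM qconj1 mulrDl mul1r mulrA.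
by rewrite qinvZ (qinvE d) -scalerAl -scalerAr mulrA.
Qed.

(** The symmetrization only depends on the norm and the real part of al. It is
    thus the same for 1 - q conj(al) and for 1 - q al; the second one is the
    regular conjugate of the first. *)
Lemma symmetrization_core al q : symmetrization (affine (- qconj al) 1) q =
  symmetrization (affine (- al) 1) q.
Proof.
rewrite !symmetrization_affine /qdot2 !qnormsqN qnormsq_conj qconj1 !mul1r !mulr1.
by rewrite !qconjN qconjK [- qconj al + _]addrC.
Qed.

Lemma symmetrization_comm c d q :
  q * symmetrization (affine c d) q = symmetrization (affine c d) q * q.
Proof.
have [r rE] := qdot2E c d; rewrite symmetrization_affine rE.
rewrite !mulr_algr !(mulrDl, mulrDr) -!scalerAl -!scalerAr mulr1 mul1r.
by rewrite -exprS -exprSr.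
Qed.

(** The reciprocal is (f^s)^{-1} f^c for f = 1 - q conj(al). Factoring f^s =
    g(q) f(T) with g = f^c by [symmetrizationE] leaves f(T)^{-1}. *)
Lemma mob_coreE al q : qnormsq al < 1 -> qnormsq q < 1 ->
  let T := (affine (- al) 1 q)^-1 * q * affine (- al) 1 q in
  qnormsq T < 1 /\ mob_core al q = (affine (- qconj al) 1 T)^-1.
Proof.
move=> al1 q1 T.
have g0 : affine (- al) 1 q != 0 by apply: affine_neq0 => //; rewrite qnormsqN qnormsq1.
have T1 : qnormsq T < 1.
  by rewrite /T !qnormsqM qnormsqV mulrAC mulVf ?mul1r// qnormsq_eq0.
split=> //; rewrite /mob_core star_inv_affineE symmetrization_core qconjN qconjK qconj1.
rewrite (symmetrizationE g0) qconjN qconj1 -/T qinvM -mulrA mulVr ?qunit//.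
by rewrite mulr1.
Qed.

(** Conjugation by g(q) = 1 - q al, an isometry, trades the regular
    transformation for the classical one. *)
Lemma mob_modelE al q : qnormsq al < 1 -> qnormsq q < 1 ->
  let T := (affine (- al) 1 q)^-1 * q * affine (- al) 1 q in
  qnormsq T < 1 /\ mob_model al q = (affine (- qconj al) 1 T)^-1 * (T - al).
Proof.
move=> al1 q1 T; have [T1 cE] := mob_coreE al1 q1; split=> //.
have g0 : affine (- al) 1 q != 0 by apply: affine_neq0 => //; rewrite qnormsqN qnormsq1.
have D0 : symmetrization (affine (- al) 1) q != 0.
  rewrite symmetrizationE// qmulf_eq0 negb_or g0; apply: affine_neq0 => //.
  by rewrite !qnormsq_conj qnormsqN qnormsq1.
rewrite mulrBr -cE /mob_model; congr (_ - _).
rewrite /mob_core star_inv_affineE symmetrization_core qconjN qconjK qconj1.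
have DC : GRing.comm q (symmetrization (affine (- al) 1) q)^-1.
  by apply: commrV; exact: symmetrization_comm.
rewrite mulrA DC -!mulrA; congr (_ * _).
by rewrite /T !mulrA mulrV ?qunit// mul1r.
Qed.

Lemma classical_disc_identity al t :
  qnormsq (1 - t * qconj al) - qnormsq (t - al) = (1 - qnormsq t) * (1 - qnormsq al).
Proof.
rewrite qmulE qoneE /qnormsq /qmul /qconj !(qcoordD, qcoordN, qcoord_mk).
by move: (qcoord _ _) (qcoord _ _) (qcoord _ _) (qcoord _ _) (qcoord _ _) (qcoord _ _) (qcoord _ _) (qcoord _ _) => *; ring.
Qed.

Lemma mob_model_ball al q : qnormsq al < 1 -> qnormsq q < 1 -> qnormsq (mob_model al q) < 1.
Proof.
move=> al1 q1; have [T1 ->] := mob_modelE al1 q1.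
move: ((affine (- al) 1 q)^-1 * q * _) T1 => t t1.
have w0 : affine (- qconj al) 1 t != 0.
  by apply: affine_neq0 => //; rewrite qnormsqN qnormsq_conj qnormsq1.
have w0' : 0 < qnormsq (affine (- qconj al) 1 t) by rewrite lt_neqAle eq_sym qnormsq_eq0 w0 qnormsq_ge0.
rewrite qnormsqM qnormsqV mulrC ltr_pdivrMr// mul1r.
rewrite -subr_gt0 /affine mulrN [- _ + 1]addrC classical_disc_identity.
by rewrite mulr_gt0// subr_gt0.
Qed.

(** By [mob_modelE] a zero satisfies T = al, that is q (1 - q al) = (1 - q al)
    al. With y = q - al this reads y = q y al, and |q|, |al| < 1 forces
    y = 0. *)
Lemma mob_model_eq0 al q : qnormsq al < 1 -> qnormsq q < 1 ->
  mob_model al q = 0 <-> q = al.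
Proof.
move=> al1 q1; have [T1 ->] := mob_modelE al1 q1.
set g := affine (- al) 1 q; set T := _ * g.
have g0 : g != 0 by apply: affine_neq0 => //; rewrite qnormsqN qnormsq1.
have w0 : affine (- qconj al) 1 T != 0.
  by apply: affine_neq0 => //; rewrite qnormsqN qnormsq_conj qnormsq1.
have E : (T = al) <-> q * g = g * al.
  rewrite /T; split=> [<-|E]; first by rewrite !mulrA mulrV ?qunit// mul1r.
  by rewrite -mulrA E mulKr// qunit.
transitivity (T = al).
  split=> [/eqP|->]; last by rewrite subrr mulr0.
  by rewrite qmulf_eq0 qinv_eq0 (negbTE w0) /= subr_eq0 => /eqP.
rewrite E /g /affine; split=> [F|->]; last first.
  by rewrite mulrDl mulrDr mulr1 mul1r mulrN -[RHS]/(_ + _) mulrN mulNr mulrA.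
apply/eqP; rewrite -subr_eq0 -qnormsq_eq0; apply/negPn/negP => y0.
have yE : q - al = q * (q - al) * al.
  apply/eqP; rewrite -subr_eq0; apply/eqP.
  move: F; rewrite mulrDr mulrDl mulrN mulr1 mul1r mulrN mulNr => /eqP; rewrite -subr_eq0 => /eqP F.
  rewrite -[RHS]F mulrBr mulrBl -!mulrA.
  move: (q * (q * al)) (q * (al * al)) => x y.
  by apply: quatP; rewrite !(qcoordD, qcoordN); ring.
have := congr1 (@qnormsq R) yE; rewrite !qnormsqM => nE.
have yp : 0 < qnormsq (q - al) by rewrite lt_neqAle eq_sym y0 qnormsq_ge0.
have q0 := qnormsq_ge0 q; have al0 := qnormsq_ge0 al.
have : qnormsq q * qnormsq (q - al) * qnormsq al < qnormsq (q - al).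
  rewrite mulrAC -[ltRHS]mul1r ltr_pM2r//.
  by apply: le_lt_trans al1; rewrite ler_piMl// ltW.
by rewrite -nE ltxx.
Qed.

Lemma mob_model0 q : mob_model 0 q = q.
Proof.
rewrite /mob_model mulr0 subr0 /mob_core star_inv_affineE symmetrization_affine.
rewrite qconj0 oppr0 /qdot2 qconj0 mulr0 mul0r addr0 mulr0 addr0 qnormsq1 scale1r.
rewrite (eqP (_ : qnormsq (0 : H) == 0)) ?qnormsq_eq0// scale0r mulr0 addr0 invr1 mul1r.
by rewrite /affine mulr0 add0r qconj1 mulr1.
Qed.

End MobiusNormalForm.

(** * Matrices of Sp(1,1) *)

Section Sp11Group.
Context (R : realType).
Local Notation H := (quat R).
Implicit Types (a b c d p q x al : H).

Definition qmx (a c b d : H) : 'M[H]_2 :=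
  \matrix_(i, j) (if i == 0 then (if j == 0 then a else c) else (if j == 0 then b else d)).

Lemma qmxE a c b d : (qmx a c b d 0 0 = a) * (qmx a c b d 0 1 = c) *
  (qmx a c b d 1 0 = b) * (qmx a c b d 1 1 = d).
Proof. by rewrite /qmx !mxE. Qed.

Lemma mx2P (A B : 'M[H]_2) : A 0 0 = B 0 0 -> A 0 1 = B 0 1 ->
  A 1 0 = B 1 0 -> A 1 1 = B 1 1 -> A = B.
Proof.
move=> e0 e1 e2 e3; apply/matrixP => i j.
have E2 (k : 'I_2) : k = 0 \/ k = 1.
  by case: k => [[|[|//]]] ?; [left|right]; apply/val_inj.
by case: (E2 i) => ->; case: (E2 j) => ->.
Qed.

Lemma mul_mx2 (A B : 'M[H]_2) i j : (A *m B) i j = A i 0 * B 0 j + A i 1 * B 1 j.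
Proof. by rewrite mxE !big_ord_recl big_ord0 addr0; congr (_ + A i _ * B _ j); apply/val_inj. Qed.

Lemma Sp11P (A : 'M[H]_2) : Sp11 R A <->
  [/\ qnormsq (A 0 0) = 1 + qnormsq (A 1 0), qnormsq (A 1 1) = 1 + qnormsq (A 0 1) &
      qconj (A 0 0) * A 0 1 = qconj (A 1 0) * A 1 1].
Proof.
have I00 : (I11 R) 0 0 = 1 by rewrite !mxE /= expr0 mulr1n.
have I11' : (I11 R) 1 1 = -1 by rewrite !mxE /= expr1 mulr1n.
have I01 : (I11 R) 0 1 = 0 by rewrite !mxE /= mulr0n.
have I10 : (I11 R) 1 0 = 0 by rewrite !mxE /= mulr0n.
have E i j : (adjmx A *m I11 R *m A) i j = qconj (A 0 i) * A 0 j - qconj (A 1 i) * A 1 j.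
  rewrite !mul_mx2 I00 I01 I10 I11' /adjmx !mxE !mulr0 addr0 add0r mulr1.
  by rewrite mulrN1 mulNr.
have S1 : injective (fun r : R => r%:A : H).
  move=> r s /= /(congr1 (fun q : H => qcoord q 0)).
  by rewrite !qcoordZ qoneE !qcoord_mk !mulr1.
split=> [AI|[h1 h2 h3]].
  have := congr1 (fun M : 'M[H]_2 => M 0 0) AI; rewrite E I00 !mulqJq -scalerBl => e1.
  have {e1} h1 : qnormsq (A 0 0) - qnormsq (A 1 0) = 1 by apply: S1; rewrite /= e1 scale1r.
  have := congr1 (fun M : 'M[H]_2 => M 1 1) AI; rewrite E I11' !mulqJq -scalerBl => e2.
  have {e2} h2 : qnormsq (A 0 1) - qnormsq (A 1 1) = -1 by apply: S1; rewrite /= e2 scaleN1r.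
  have := congr1 (fun M : 'M[H]_2 => M 0 1) AI; rewrite E I01 => /eqP; rewrite subr_eq0 => /eqP h3.
  split=> //; first by rewrite -h1 subrK.
  by move: h2; move: (qnormsq _) (qnormsq _) => x y; lra.
rewrite /Sp11 /=; apply: mx2P; rewrite E ?I00 ?I01 ?I10 ?I11'.
- by rewrite !mulqJq -scalerBl h1 addrK scale1r.
- by rewrite h3 subrr.
- have := congr1 (@qconj R) h3; rewrite !qconjM !qconjK => ->.
  by rewrite subrr.
- by rewrite !mulqJq -scalerBl h2 opprD addrCA subrr addr0 scaleN1r.
Qed.

(** The defining relation says that the columns of A are orthonormal for the
    indefinite form; so are then the rows, which yields a two-sided inverse in
    [Sp11_inv_val]. *)
Lemma Sp11_rows a b c d : qnormsq a = 1 + qnormsq b -> qnormsq d = 1 + qnormsq c ->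
  qconj a * c = qconj b * d ->
  qnormsq b = qnormsq c /\ a * qconj b = c * qconj d.
Proof.
move=> h1 h2 h3.
have bc : qnormsq b = qnormsq c.
  have := congr1 (@qnormsq R) h3; rewrite !qnormsqM !qnormsq_conj h1 h2.
  by move: (qnormsq b) (qnormsq c) => x y; lra.
split=> //.
have : qnormsq d *: (a * qconj b) = qnormsq a *: (c * qconj d).
  have := congr1 (fun z => a * z * qconj d) h3.
  rewrite !mulrA mulqqJ -!mulrA mulqqJ mulr_algl => ->.
  by rewrite mulr_algr -scalerAr.
rewrite h1 h2 bc => /(congr1 (fun z => (1 + qnormsq c)^-1 *: z)).
rewrite !scalerA mulVf ?scale1r//.
by rewrite gt_eqF// ltr_wpDr// qnormsq_ge0.
Qed.

Lemma Sp11_in (A : Sp11 R) : Sp11 R (val A).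
Proof. exact: set_mem (valP A). Qed.

(** The matrix I A^* I, with I the diagonal matrix of the form. *)
Definition qmx_inv (A : 'M[H]_2) : 'M[H]_2 :=
  qmx (qconj (A 0 0)) (- qconj (A 1 0)) (- qconj (A 0 1)) (qconj (A 1 1)).

Lemma Sp11_inv_val (A : Sp11 R) : val (Sp11_inv A) = qmx_inv (val A).
Proof.
have [h1 h2 h3] := (Sp11P _).1 (Sp11_in A); have [bc h4] := Sp11_rows h1 h2 h3.
have h3' := congr1 (@qconj R) h3; rewrite !qconjM !qconjK in h3'.
have h4' := congr1 (@qconj R) h4; rewrite !qconjM !qconjK in h4'.
set B := qmx_inv (val A).
have BA : B *m val A = 1%:M.
  apply: mx2P; rewrite mul_mx2 !qmxE !mxE /= ?mulNr ?mulqJq.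
  - by rewrite -scalerBl h1 addrK scale1r.
  - by rewrite h3 subrr.
  - by rewrite h3' addNr.
  - by rewrite addrC -scalerBl h2 addrK scale1r.
have AB : val A *m B = 1%:M.
  apply: mx2P; rewrite mul_mx2 !qmxE !mxE /= ?mulrN ?mulqqJ.
  - by rewrite -scalerBl h1 bc addrK scale1r.
  - by rewrite h4 addNr.
  - by rewrite h4' subrr.
  - by rewrite addrC -scalerBl h2 bc addrK scale1r.
have SB : Sp11 R B.
  apply/Sp11P; rewrite !qmxE !qnormsqN !qnormsq_conj; split.
  - by rewrite h1 bc.
  - by rewrite h2 bc.
  - by rewrite qconjN !qconjK mulrN mulNr h4.
rewrite /Sp11_inv; case: xgetP => [C _ [AC _]|/(_ (exist _ B (mem_set SB)))].
  by rewrite -[LHS]mul1mx -BA -mulmxA AC mulmx1.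
by case; split.
Qed.

(** The matrix (a c; b d) gives al = b d^{-1}, the zero of the transformation
    of its inverse. *)
Definition mx_zero (A : 'M[H]_2) : H := A 1 0 * (A 1 1)^-1.
(** For the matrix (a c; b d), the unit x = conj(a d^{-1}) by which the normal
    form [mob_model] is multiplied. *)
Definition mx_phase (A : 'M[H]_2) : H := qconj (A 0 0 * (A 1 1)^-1).

Lemma Sp11_d_neq0 (A : Sp11 R) : val A 1 1 != 0.
Proof.
have [_ h2 _] := (Sp11P _).1 (Sp11_in A).
by rewrite -qnormsq_eq0 h2 gt_eqF// ltr_wpDr// qnormsq_ge0.
Qed.

Lemma mx_zero_ball (A : Sp11 R) : qnormsq (mx_zero (val A)) < 1.
Proof.
have [h1 h2 h3] := (Sp11P _).1 (Sp11_in A); have [bc h4] := Sp11_rows h1 h2 h3.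
have c0 := qnormsq_ge0 (val A 0 1).
rewrite qnormsqM qnormsqV h2 bc ltr_pdivrMr; last by rewrite ltr_wpDr.
by rewrite mul1r ltrDr.
Qed.

Lemma mx_phase_Sp1 (A : Sp11 R) : qnormsq (mx_phase (val A)) = 1.
Proof.
have [h1 h2 h3] := (Sp11P _).1 (Sp11_in A); have [bc h4] := Sp11_rows h1 h2 h3.
have c0 := qnormsq_ge0 (val A 0 1).
by rewrite qnormsq_conj qnormsqM qnormsqV h1 h2 bc divff// gt_eqF// ltr_wpDr.
Qed.

(** The inverse matrix gives (- q conj(b) + conj(d))^{-*} * (q conj(a) -
    conj(c)). Taking conj(d) out of the denominator leaves the core with
    parameter al, and the relation conj(d)^{-1} conj(c) = al x between the
    rows of A lets x come out on the right. *)
Lemma mobius_inv_val (A : Sp11 R) (q : qball R) :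
  val (mobius (Sp11_inv A) q) =
  mob_model (mx_zero (val A)) (val q) * mx_phase (val A).
Proof.
have [h1 h2 h3] := (Sp11P _).1 (Sp11_in A); have [bc h4] := Sp11_rows h1 h2 h3.
have d0 := Sp11_d_neq0 A.
have Bq : qball R (val q) by exact: set_mem (valP q).
have q1 : qnormsq (val q) < 1 by apply/qballP.
have E : mobius_fun (val (Sp11_inv A)) (val q) =
    mob_model (mx_zero (val A)) (val q) * mx_phase (val A).
  rewrite Sp11_inv_val mobius_funE ?qmxE//; last first.
    by rewrite qnormsqN !qnormsq_conj h2 bc ltrDr.
  have d0' : qconj (val A 1 1) != 0 by rewrite qconj_eq0.
  have cE : - qconj (val A 1 0) = qconj (val A 1 1) * - qconj (mx_zero (val A)).
    by rewrite /mx_zero qconjM qconjV mulrN mulrA mulrV ?qunit// mul1r.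
  rewrite {1 2}cE (star_inv_scale _ _ d0') -/(mob_core _ _) /mob_model.
  have xE : mx_phase (val A) = (qconj (val A 1 1))^-1 * qconj (val A 0 0).
    by rewrite /mx_phase qconjM qconjV.
  have key : (qconj (val A 1 1))^-1 * qconj (val A 0 1) =
      mx_zero (val A) * ((qconj (val A 1 1))^-1 * qconj (val A 0 0)).
    have h5 : val A 1 0 * qconj (val A 0 0) = val A 1 1 * qconj (val A 0 1).
      by have := congr1 (@qconj R) h4; rewrite !qconjM !qconjK.
    rewrite /mx_zero -(mulrA (val A 1 0)) (mulrA (val A 1 1)^-1) -qinvM mulqJq.
    rewrite qinvZ invr1 mulr_algl -scalerAr h5 scalerAl.
    by rewrite qinvE qnormsq_conj qconjK.
  rewrite xE; move: (mob_core _ _) => K.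
  by rewrite mulrBl mulrN -!mulrA key /mx_zero -!mulrA.
rewrite /mobius insubdK// E; apply: mem_set; apply/qballP.
rewrite qnormsqM mx_phase_Sp1 mulr1; apply: mob_model_ball => //.
exact: mx_zero_ball.
Qed.

End Sp11Group.

(** * Zero and phase of a Moebius transformation *)

Section MobStructure.
Context (R : realType).
Local Notation H := (quat R).

Lemma qball_in (q : qball R) : qnormsq (val q) < 1.
Proof. by apply/qballP; exact: set_mem (valP q). Qed.

Lemma Sp1_in (u : Sp1 R) : qnormsq (val u) = 1.
Proof. by apply/Sp1P; exact: set_mem (valP u). Qed.

Lemma Sp1_neq0 (u : Sp1 R) : val u != 0.
Proof. by rewrite -qnormsq_eq0 Sp1_in oner_eq0. Qed.

Definition mk_qball (q : H) (h : qnormsq q < 1) : qball R :=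
  exist (fun q => q \in qball R) q (mem_set ((qballP q).2 h)).

Definition mk_Sp1 (u : H) (h : qnormsq u = 1) : Sp1 R :=
  exist (fun q => q \in Sp1 R) u (mem_set ((Sp1P u).2 h)).

Definition mat_zero (A : Sp11 R) : qball R := mk_qball (mx_zero_ball A).

Definition mat_phase (A : Sp11 R) : Sp1 R := mk_Sp1 (mx_phase_Sp1 A).

(** The Lorentz factor, as a real quaternion. *)
Definition gamma (al : H) : H := ((Num.sqrt (1 - qnormsq al))^-1)%:A.

(** A representative, smooth in (al, x), of the coset with zero al and phase
    x. It is normalised by a real entry d; thus it is a global section of the
    quotient by Sp(1). *)
Definition boost (al x : H) : 'M[H]_2 :=
  qmx (gamma al * qconj x) (gamma al * (qconj x * qconj al)) (gamma al * al) (gamma al).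

Lemma qnormsq_gamma al : qnormsq al < 1 -> qnormsq (gamma al) = (1 - qnormsq al)^-1.
Proof.
move=> al1; rewrite /gamma qnormsqZ qnormsq1 mulr1 exprVn sqr_sqrtr//.
by rewrite subr_ge0 ltW.
Qed.

Lemma boost_Sp11 (al : qball R) (x : Sp1 R) : Sp11 R (boost (val al) (val x)).
Proof.
have al1 := qball_in al; have x1 := Sp1_in x.
have n0 : 1 - qnormsq (val al) != 0 by rewrite subr_eq0 gt_eqF.
have E : (1 - qnormsq (val al))^-1 = 1 + (1 - qnormsq (val al))^-1 * qnormsq (val al).
  by field.
apply/Sp11P; rewrite !qmxE; split.
- by rewrite !qnormsqM qnormsq_gamma// qnormsq_conj x1 mulr1.
- by rewrite !qnormsqM qnormsq_gamma// !qnormsq_conj x1 mul1r.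
- rewrite /gamma !mulr_algl !mulr_algr !qconjZ qconjK -!scalerAl -!scalerAr; congr (_ *: (_ *: _)).
  by rewrite mulrA mulqqJ x1 scale1r mul1r.
Qed.

Definition mat_boost (al : qball R) (x : Sp1 R) : Sp11 R :=
  exist (fun A => A \in Sp11 R) (boost (val al) (val x)) (mem_set (boost_Sp11 al x)).

Lemma gamma_neq0 al : qnormsq al < 1 -> gamma al != 0.
Proof.
move=> al1; rewrite -qnormsq_eq0 qnormsq_gamma// invr_eq0 subr_eq0 gt_eqF//.
Qed.

Lemma gamma_comm al q : gamma al * q = q * gamma al.
Proof. by rewrite /gamma mulr_algl mulr_algr. Qed.

Lemma mat_zero_boost al x : mat_zero (mat_boost al x) = al.
Proof.
apply: val_inj; rewrite /= /mx_zero !qmxE gamma_comm mulrK// qunit// gamma_neq0//.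
exact: qball_in.
Qed.

Lemma mat_phase_boost al x : mat_phase (mat_boost al x) = x.
Proof.
apply: val_inj; rewrite /= /mx_phase !qmxE gamma_comm mulrK ?qconjK// qunit// gamma_neq0//.
exact: qball_in.
Qed.

Definition coset_rep (X : Sp11_quot R) : Sp11 R := sval (cid2 (set_mem (valP X))).

Lemma coset_repK : cancel coset_rep (Sp11_proj R).
Proof. by move=> X; apply: val_inj; rewrite /= /coset_rep; case: cid2. Qed.

(** Right multiplication by a unit u multiplies all entries by u, and so
    cancels in the quotients b d^{-1} and a d^{-1}. *)
Lemma Sp11_proj_inv (A B : Sp11 R) : Sp11_proj R A = Sp11_proj R B ->
  mat_zero A = mat_zero B /\ mat_phase A = mat_phase B.
Proof.
move=> /(congr1 val) /= AB.
have : coset A A.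
  have one1 : qnormsq (1 : H) = 1 := qnormsq1 R.
  by exists (mk_Sp1 one1); rewrite /= mulmx1.
rewrite AB => -[u uE].
have u0 := Sp1_neq0 u.
have E i j : val A i j = val B i j * val u.
  rewrite uE mul_mx2 !mxE; case: j => [[|[|//]]] jlt.
    rewrite [Ordinal jlt](_ : _ = 0); last exact/val_inj.
    by rewrite /= mulr1n mulr0n mulr0 addr0.
  rewrite [Ordinal jlt](_ : _ = 1); last exact/val_inj.
  by rewrite /= mulr1n mulr0n mulr0 add0r.
have EE i : val A i 1 = val B i 1 * val u := E i 1.
split; apply: val_inj; rewrite /= /mx_zero /mx_phase !E qinvM.
  by rewrite mulrA mulrK// qunit.
by rewrite mulrA mulrK// qunit.
Qed.

Definition coset_zero (X : Sp11_quot R) : qball R := mat_zero (coset_rep X).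
Definition coset_phase (X : Sp11_quot R) : Sp1 R := mat_phase (coset_rep X).

Lemma coset_zero_proj A : coset_zero (Sp11_proj R A) = mat_zero A.
Proof. by have [] := Sp11_proj_inv (coset_repK (Sp11_proj R A)). Qed.

Lemma coset_phase_proj A : coset_phase (Sp11_proj R A) = mat_phase A.
Proof. by have [] := Sp11_proj_inv (coset_repK (Sp11_proj R A)). Qed.

Lemma mobius_of_cosetE X q : val (val (mobius_of_coset R X) q) =
  mob_model (val (coset_zero X)) (val q) * val (coset_phase X).
Proof. exact: mobius_inv_val. Qed.

Lemma Mob_ext (F G : Mob R) : (forall q, val (val F q) = val (val G q)) -> F = G.
Proof. by move=> FG; apply: val_inj; apply/funext => q; apply: val_inj; exact: FG. Qed.

End MobStructure.

(** The transformation with zero al and phase x, known only through [mobE]: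
    its definition by a coset serves for smoothness alone. *)
HB.lock Definition mob (R : realType) (al : qball R) (x : Sp1 R) : Mob R :=
  mobius_of_coset R (Sp11_proj R (mat_boost al x)).

(** * Coordinates on the set of Moebius transformations *)

Section MobCoordinates.
Context (R : realType).
Local Notation H := (quat R).

Lemma mobE (al : qball R) (x : Sp1 R) q :
  val (val (mob al x) q) = mob_model (val al) (val q) * val x.
Proof.
by rewrite mob.unlock mobius_of_cosetE coset_zero_proj coset_phase_proj mat_zero_boost mat_phase_boost.
Qed.

Lemma mob_of_coset X : mobius_of_coset R X = mob (coset_zero X) (coset_phase X).
Proof. by apply: Mob_ext => q; exact: etrans (mobius_of_cosetE X q) (esym (mobE _ _ q)). Qed.

(** The inverse orbit map chooses a preimage of 0, and al is the only one. *)
Lemma inverse_orbit_mob (al : qball R) (x : Sp1 R) : inverse_orbit R (mob al x) = al.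
Proof.
have zero q : val (val (mob al x) q) = 0 <-> q = al.
  rewrite mobE; have x0 := Sp1_neq0 x.
  transitivity (mob_model (val al) (val q) = 0).
    split=> [/eqP|->]; last by rewrite mul0r.
    by rewrite qmulf_eq0 (negbTE x0) orbF => /eqP.
  rewrite mob_model_eq0; [|exact: qball_in|exact: qball_in].
  by split=> [/val_inj|->].
rewrite /inverse_orbit; apply/zero.
rewrite pinvK//; apply/mem_set; exists al => //.
by apply: val_inj; rewrite /=; apply/zero.
Qed.

Lemma mob_fix0 (al : qball R) (x : Sp1 R) : val (mob al x) (origin R) = origin R <-> al = origin R.
Proof.
split=> [F0|->]; last by apply: val_inj; rewrite mobE mob_model0 mul0r.
have x0 := Sp1_neq0 x.
have := congr1 val F0; rewrite mobE /= => /eqP.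
rewrite qmulf_eq0 (negbTE x0) orbF => /eqP.
have n0 : qnormsq (0 : H) < 1 by exact: (qball_in (origin R)).
by rewrite mob_model_eq0 ?qball_in// => e; apply: val_inj; rewrite /= -e.
Qed.

Lemma Sp1_one_subproof : qnormsq (1 : H) = 1. Proof. exact: qnormsq1. Qed.
Definition Sp1_one : Sp1 R := mk_Sp1 Sp1_one_subproof.

Lemma Sp1_conj_subproof (u : Sp1 R) : qnormsq (qconj (val u)) = 1.
Proof. by rewrite qnormsq_conj Sp1_in. Qed.
Definition Sp1_conj (u : Sp1 R) : Sp1 R := mk_Sp1 (Sp1_conj_subproof u).

Lemma Sp1_conjE (u : Sp1 R) : val (Sp1_conj u) = (val u)^-1.
Proof. by rewrite qinvE Sp1_in invr1 scale1r. Qed.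

Lemma Sp1_mulA : associative (Sp1_mul R).
Proof. by move=> u v w; apply: val_inj; rewrite /= mulrA. Qed.

Lemma Sp1_mul1 u : Sp1_mul R Sp1_one u = u.
Proof. by apply: val_inj; rewrite /= mul1r. Qed.

Lemma Sp1_mulr1 u : Sp1_mul R u Sp1_one = u.
Proof. by apply: val_inj; rewrite /= mulr1. Qed.

Lemma Sp1_mulV u : Sp1_mul R u (Sp1_conj u) = Sp1_one.
Proof. by apply: val_inj; rewrite /= mulqqJ Sp1_in scale1r. Qed.

Lemma Sp1_mulVl u : Sp1_mul R (Sp1_conj u) u = Sp1_one.
Proof. by apply: val_inj; rewrite /= mulqJq Sp1_in scale1r. Qed.

Lemma Sp1_conjK : involutive Sp1_conj.
Proof. by move=> u; apply: val_inj; rewrite /= qconjK. Qed.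

Lemma Sp1_conjM u v : Sp1_conj (Sp1_mul R u v) = Sp1_mul R (Sp1_conj v) (Sp1_conj u).
Proof. by apply: val_inj; rewrite /= qconjM. Qed.

End MobCoordinates.

(** * Smooth quaternionic expressions *)

Section Germs.
Context (R : realType) (n : nat).
Implicit Types (y : 'rV[R]_n).

(** Quaternionic expressions are built from sums, products, inverses and
    square roots of coordinates; stating smoothness near a point spares
    computing the domains on which the last two make sense. *)
Definition smooth_germ (W : normedModType R) y (F : 'rV[R]_n -> W) : Prop :=
  exists N : set 'rV[R]_n, [/\ open N, N y & Cinfty N F].

Lemma germ_cst y (W : normedModType R) (a : W) : smooth_germ y (fun=> a).
Proof. by exists setT; split=> //; [exact: openT|move=> k; exact: Ck_cst]. Qed.

Lemma germ_op2 y (W1 W2 W3 : normedModType R) (F : 'rV[R]_n -> W1) (G : 'rV[R]_n -> W2)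
   (E : 'rV[R]_n -> W3) :
  (forall k (N : set 'rV[R]_n), open N -> Ck k N F -> Ck k N G -> Ck k N E) ->
  smooth_germ y F -> smooth_germ y G -> smooth_germ y E.
Proof.
move=> FGE [N [oN Ny FC]] [M [oM My GC]]; exists (N `&` M); split=> //; first exact: openI.
move=> k; apply: FGE; first exact: openI.
  by apply: Ck_sub (FC k) => z [].
by apply: Ck_sub (GC k) => z [].
Qed.

Lemma germ_add y (F G : 'rV[R]_n -> R) : smooth_germ y F -> smooth_germ y G ->
  smooth_germ y (fun z => F z + G z).
Proof. by apply: germ_op2 => k N oN; exact: CkD. Qed.

Lemma germ_mul y (F G : 'rV[R]_n -> R) : smooth_germ y F -> smooth_germ y G ->
  smooth_germ y (fun z => F z * G z).
Proof. by apply: germ_op2 => k N oN; exact: CkM. Qed.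

Lemma germ_opp y (F : 'rV[R]_n -> R) : smooth_germ y F -> smooth_germ y (fun z => - F z).
Proof.
move=> h; rewrite (_ : (fun z => - F z) = (fun z => -1 * F z)).
  by apply: germ_mul => //; exact: germ_cst.
by apply/funext => z; rewrite mulN1r.
Qed.

Lemma germ_inv y (F : 'rV[R]_n -> R) : F y != 0 -> smooth_germ y F ->
  smooth_germ y (fun z => (F z)^-1).
Proof.
move=> Fy [N [oN Ny FC]]; exists [set z | N z /\ F z != 0].
have oM : open [set z | N z /\ F z != 0] by exact: open_neq0 (FC 0).
split=> // k; apply: (CkV oM) => [z []//|].
by apply: Ck_sub (FC k) => z [].
Qed.

Lemma germ_sqrt y (F : 'rV[R]_n -> R) : 0 < F y -> smooth_germ y F ->
  smooth_germ y (fun z => Num.sqrt (F z)).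
Proof.
move=> Fy [N [oN Ny FC]].
have oM : open (N `&` F @^-1` [set r : R | 0 < r]).
  by apply: open_preimage_within (@open_gt R 0) => //; exact: (Ck_continuous (FC 0)).
exists (N `&` F @^-1` [set r : R | 0 < r]).
split=> // k; apply: (Ck_sqrt oM) => [z []//|].
by apply: Ck_sub (FC k) => z [].
Qed.

Lemma germ_rV m y (F : 'rV[R]_n -> 'rV[R]_m) :
  (forall i, smooth_germ y (fun z => F z 0 i : R)) -> smooth_germ y F.
Proof.
move=> /choice[N HN].
pose M := [set z | forall i, N i z].
have oM : open M.
  rewrite openE => z Mz.
  apply: (@filter_forall _ 'I_m N (nbhs z)) => i.
  by have [oN _ _] := HN i; apply: open_nbhs_nbhs; split=> //; exact: Mz.
exists M; split=> //.
  by move=> i; have [] := HN i.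
move=> k; apply: Ck_rV => // i; have [_ _ FC] := HN i.
by apply: Ck_sub (FC k) => z; exact.
Qed.

Lemma germ_coord m y (F : 'rV[R]_n -> 'rV[R]_m) i :
  smooth_germ y F -> smooth_germ y (fun z => F z 0 i : R).
Proof.
by move=> [N [oN Ny FC]]; exists N; split=> // k; exact: Ck_coord (FC k).
Qed.

End Germs.

Lemma smooth_at_single (R : realType) (T T' : choiceType) (S : atlas R T) n
    (phi : T' -> 'rV[R]_n) (psi : 'rV[R]_n -> T') (f : T -> T') x c :
  is_atlas S -> is_atlas (single_chart setT phi psi) -> acharts S c -> cdom c x ->
  smooth_at S (single_chart setT phi psi) f x <->
  smooth_germ (cmap c x) (phi \o f \o cinv c).
Proof.
move=> aS aS' Sc cx; split=> [fS|[N [oN Nx NC]]].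
  have [N [oN Nx _ NC]] := @smooth_at_chart R _ _ S (single_chart setT phi psi) f x c
    (Chart setT phi psi) aS aS' fS Sc erefl cx I.
  by exists N.
exists c, (Chart setT phi psi : chart R T' (adim (single_chart setT phi psi))); split=> //.
have [aS1 _ _] := aS; have [_ oc] := aS1 c Sc.
exists (N `&` cmap c @` cdom c); split.
- exact: openI.
- by split=> //; exists x.
- by move=> _ [_ [z cz <-]]; exists z.
- by apply: Cinfty_sub NC => z [].
Qed.

Section QuaternionSmoothness.
Context (R : realType).
Local Notation H := (quat R).
Local Notation Q := (quat_atlas R).

Lemma quat_is_atlas : is_atlas Q.
Proof.
apply: single_chart_atlas => //.
by rewrite (_ : range _ = setT); [exact: openT|apply/seteqP; split=> // q _; exists q].
Qed.

Lemma qmx_coordsE (A : 'M[H]_2) i j k :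
  qmx_coords A 0 (mxvec_index (mxvec_index i j) k) = (A i j : 'rV[R]_4) 0 k.
Proof. by rewrite /qmx_coords mxvecE mxE mxvecE. Qed.

Lemma qmx_coordsK : cancel (@qmx_coords R) (@qmx_of_coords R).
Proof.
move=> A; apply/matrixP => i j; rewrite /qmx_of_coords mxE mxE.
by apply/rowP => k; rewrite mxE mxE qmx_coordsE.
Qed.

Lemma qmx_of_coordsK : cancel (@qmx_of_coords R) (@qmx_coords R).
Proof.
move=> v; apply/rowP => l; case/mxvec_indexP: l => i k; case/mxvec_indexP: i => i j.
by rewrite qmx_coordsE /qmx_of_coords !mxE.
Qed.

Lemma qmx_is_atlas : is_atlas (qmx_atlas R).
Proof.
apply: single_chart_atlas; first exact: qmx_coordsK.
rewrite (_ : range _ = setT); first exact: openT.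
by apply/seteqP; split=> // v _; exists (qmx_of_coords v) => //; rewrite qmx_of_coordsK.
Qed.

Lemma qball_cancel : cancel (fun q : qball R => val q : 'rV[R]_4)
  (fun v => insubd (origin R) (v : H)).
Proof. by move=> q; apply: val_inj; rewrite insubdK//; exact: valP. Qed.

Lemma qball_range : range (fun q : qball R => val q : 'rV[R]_4) = qball R.
Proof.
apply/seteqP; split=> [_ [q _ <-]|q Bq]; first exact: set_mem (valP q).
by exists (exist (fun q => q \in qball R) q (mem_set Bq)).
Qed.

Lemma open_qball : open (qball R : set 'rV[R]_4).
Proof.
rewrite (_ : qball R = setT `&` (fun v : 'rV[R]_4 => qnormsq (v : H)) @^-1` [set r : R | r < 1]); last first.
  by rewrite setTI; apply/seteqP; split=> q /qballP.
apply: open_preimage_within (@open_lt R 1); first exact: openT.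
move=> v _; suff: Ck 0 setT (fun v : 'rV[R]_4 => qnormsq (v : H)) by apply.
have C k : Ck 0 setT (fun v : 'rV[R]_4 => v 0 (inord k)).
  by apply: (@Ck_coord R 0 _ _ setT id _ openT); exact: Ck_id.
have C2 k : Ck 0 setT (fun v : 'rV[R]_4 => v 0 (inord k) * v 0 (inord k)).
  exact: (CkM openT (C k) (C k)).
exact: (CkD openT (CkD openT (CkD openT (C2 0) (C2 1%N)) (C2 2)) (C2 3)).
Qed.

Lemma qball_manifold : is_manifold (qball_atlas R).
Proof.
by apply: single_chart_manifold; [exact: qball_cancel|rewrite qball_range; exact: open_qball].
Qed.

Section Ops.
Context (T : choiceType) (S : atlas R T) (aS : is_atlas S) (x : T).
Implicit Types f g : T -> H.

Lemma smooth_at_qcoord c f : acharts S c -> cdom c x ->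
  smooth_at S Q f x <->
  forall k, smooth_germ (cmap c x) (fun y => qcoord (f (cinv c y)) k).
Proof.
move=> Sc cx; rewrite (smooth_at_single f aS quat_is_atlas Sc cx).
split=> [h k|h]; first exact: germ_coord h.
by apply: germ_rV => i; have := h i; rewrite /qcoord inord_val.
Qed.

(** An operation on quaternions is smooth when its real coordinates are. The
    values of f and g enter only through their coordinates. *)
Lemma smooth_at_qop2 (op : H -> H -> H) f g :
  (forall c k, acharts S c -> cdom c x ->
    (forall k, smooth_germ (cmap c x) (fun y => qcoord (f (cinv c y)) k)) ->
    (forall k, smooth_germ (cmap c x) (fun y => qcoord (g (cinv c y)) k)) -> (k < 4)%N ->
    smooth_germ (cmap c x) (fun y => qcoord (op (f (cinv c y)) (g (cinv c y))) k)) ->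
  smooth_at S Q f x -> smooth_at S Q g x -> smooth_at S Q (fun t => op (f t) (g t)) x.
Proof.
move=> H fS gS; have [_ _ /(_ x) [c Sc cx]] := aS.
rewrite (smooth_at_single _ aS quat_is_atlas Sc cx); apply: germ_rV => i.
have := H c i Sc cx ((smooth_at_qcoord f Sc cx).1 fS) ((smooth_at_qcoord g Sc cx).1 gS) (ltn_ord i).
by rewrite /qcoord inord_val.
Qed.

Lemma smooth_at_qmul f g : smooth_at S Q f x -> smooth_at S Q g x ->
  smooth_at S Q (fun t => f t * g t) x.
Proof.
apply: smooth_at_qop2 => c k Sc cx fC gC.
case: k => [|[|[|[|//]]]] _.
- under [X in smooth_germ _ X]funext do rewrite qmulE /qmul qcoord_mk.
  by do ![apply: germ_add|apply: germ_opp|apply: germ_mul].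
- under [X in smooth_germ _ X]funext do rewrite qmulE /qmul qcoord_mk.
  by do ![apply: germ_add|apply: germ_opp|apply: germ_mul].
- under [X in smooth_germ _ X]funext do rewrite qmulE /qmul qcoord_mk.
  by do ![apply: germ_add|apply: germ_opp|apply: germ_mul].
- under [X in smooth_germ _ X]funext do rewrite qmulE /qmul qcoord_mk.
  by do ![apply: germ_add|apply: germ_opp|apply: germ_mul].
Qed.

Lemma smooth_at_qconj f : smooth_at S Q f x -> smooth_at S Q (fun t => qconj (f t)) x.
Proof.
move=> fS; apply: (@smooth_at_qop2 (fun p _ => qconj p) f f) => // c k Sc cx fC _.
case: k => [|[|[|[|//]]]] _.
- under [X in smooth_germ _ X]funext do rewrite /qconj qcoord_mk.
  exact: fC.
- under [X in smooth_germ _ X]funext do rewrite /qconj qcoord_mk.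
  exact: germ_opp.
- under [X in smooth_germ _ X]funext do rewrite /qconj qcoord_mk.
  exact: germ_opp.
- under [X in smooth_germ _ X]funext do rewrite /qconj qcoord_mk.
  exact: germ_opp.
Qed.

Lemma germ_qnormsq (c : chart R T (adim S)) f : (forall k, smooth_germ (cmap c x) (fun y => qcoord (f (cinv c y)) k)) ->
  smooth_germ (cmap c x) (fun y => qnormsq (f (cinv c y))).
Proof.
move=> fC; rewrite /qnormsq.
under [X in smooth_germ _ X]funext do rewrite !expr2.
by do ![apply: germ_add|apply: germ_mul].
Qed.

Lemma smooth_at_qinv f : f x != 0 -> smooth_at S Q f x -> smooth_at S Q (fun t => (f t)^-1) x.
Proof.
move=> f0 fS; apply: (@smooth_at_qop2 (fun p q => (qnormsq p)^-1 *: q) f (fun t => qconj (f t))) => //; last exact: smooth_at_qconj.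
move=> c k Sc cx fC gC _.
under [X in smooth_germ _ X]funext do rewrite qcoordZ.
apply: germ_mul; last exact: gC.
apply: (@germ_inv _ _ (cmap c x) (fun y => qnormsq (f (cinv c y)))); last exact: germ_qnormsq.
by rewrite (chartK aS Sc cx) qnormsq_eq0.
Qed.

Lemma smooth_at_gamma f : qnormsq (f x) < 1 -> smooth_at S Q f x ->
  smooth_at S Q (fun t => gamma (f t)) x.
Proof.
move=> f1 fS; apply: (@smooth_at_qop2 (fun p _ => gamma p) f f) => //.
move=> c k Sc cx fC _ _; rewrite /gamma.
under [X in smooth_germ _ X]funext do rewrite qcoordZ.
apply: germ_mul; last exact: germ_cst.
have F1 : 0 < 1 - qnormsq (f (cinv c (cmap c x))) by rewrite (chartK aS Sc cx) subr_gt0.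
apply: germ_inv; first by rewrite gt_eqF// sqrtr_gt0.
apply: germ_sqrt => //; apply: germ_add; first exact: germ_cst.
by apply: germ_opp; exact: germ_qnormsq.
Qed.

Lemma smooth_at_qmx (F : T -> 'M[H]_2) :
  smooth_at S (qmx_atlas R) F x <-> forall i j, smooth_at S Q (fun t => F t i j) x.
Proof.
have [_ _ /(_ x) [c Sc cx]] := aS.
rewrite (smooth_at_single F aS qmx_is_atlas Sc cx); split=> [h i j|h].
  rewrite (smooth_at_single _ aS quat_is_atlas Sc cx); apply: germ_rV => k.
  have := germ_coord (mxvec_index (mxvec_index i j) k) h.
  by under [X in smooth_germ _ X -> _]funext do rewrite /= qmx_coordsE.
apply: germ_rV => l; case/mxvec_indexP: l => i k; case/mxvec_indexP: i => i j.
under [X in smooth_germ _ X]funext do rewrite /= qmx_coordsE.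
have := h i j; rewrite (smooth_at_single _ aS quat_is_atlas Sc cx) => h'.
exact: germ_coord h'.
Qed.

Lemma smooth_at_qball (F : T -> qball R) :
  smooth_at S (qball_atlas R) F x <-> smooth_at S Q (fun t => val (F t)) x.
Proof.
have [_ _ /(_ x) [c Sc cx]] := aS.
rewrite (smooth_at_single _ aS quat_is_atlas Sc cx).
by rewrite (smooth_at_single _ aS (manifold_atlas qball_manifold) Sc cx).
Qed.

End Ops.
End QuaternionSmoothness.

(** * The group of rotations and its action *)

Section MobGroup.
Context (R : realType).
Local Notation H := (quat R).

Lemma Sp11_invK : involutive (@Sp11_inv R).
Proof.
move=> A; apply: val_inj; rewrite !Sp11_inv_val /qmx_inv !qmxE !qconjN !qconjK !opprK.
by apply: mx2P; rewrite qmxE.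
Qed.

Lemma mob_surj (F : Mob R) : exists al x, F = mob al x.
Proof.
have [A _ AF] := set_mem (valP F); pose B := Sp11_inv A.
exists (mat_zero B), (mat_phase B); apply: Mob_ext => q.
rewrite mobE -[LHS]/(val (val F q)) -AF -[A]Sp11_invK -/B.
exact: mobius_inv_val.
Qed.

(** The zero is read off by the inverse orbit map; the phase is then
    determined by the value at any point other than the zero. *)
Lemma mob_inj (al al' : qball R) (x x' : Sp1 R) : mob al x = mob al' x' -> al = al' /\ x = x'.
Proof.
move=> E; have Ea : al = al'.
  by rewrite -(inverse_orbit_mob al x) E (inverse_orbit_mob al' x').
subst al'; split=> //.
have [q qa] : exists q : qball R, q <> al.
  (* Either 0 or 1/2 is different from al. *)
  have [->|/eqP a0] := eqVneq al (origin R); last by exists (origin R) => /esym.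
  have h : qnormsq ((2^-1)%:A : H) < 1.
    rewrite qnormsqZ qnormsq1 mulr1 exprn_ilt1// ?invr_ge0// invf_lt1// ltr1n//.
  exists (mk_qball h) => /(congr1 val) /= /eqP.
  by rewrite -qnormsq_eq0 qnormsqZ qnormsq1 mulr1 sqrf_eq0 invr_eq0 pnatr_eq0.
have M0 : mob_model (val al) (val q) != 0.
  by apply/eqP => /(mob_model_eq0 (qball_in al) (qball_in q))/val_inj.
apply: val_inj; apply: (qmulfI M0).
have := congr1 (fun F : Mob R => val (val F q)) E.
by rewrite /= !mobE.
Qed.

(** By [mob_inj] and [mob_surj] there is exactly one such phase; the default
    value is never used. *)
Definition mob_phase (F : Mob R) : Sp1 R :=
  xget (Sp1_one R) [set x | exists al, F = mob al x].

Lemma mob_phase_mob (al : qball R) (x : Sp1 R) : mob_phase (mob al x) = x.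
Proof.
rewrite /mob_phase; case: xgetP => [y _ [al' /mob_inj[_]]//|/(_ x) []].
by exists al.
Qed.

Lemma mob_eta F : mob (inverse_orbit R F) (mob_phase F) = F.
Proof. by have [al [x ->]] := mob_surj F; rewrite inverse_orbit_mob mob_phase_mob. Qed.

(** Phases multiply on the right because rotations are right multiplications;
    hence the order of the factors in [rot_mul] and [rot_act]. *)
Lemma mob_comp (al : qball R) (x y : Sp1 R) :
  val (mob (origin R) y) \o val (mob al x) = val (mob al (Sp1_mul R x y)).
Proof.
apply/funext => q; apply: val_inj.
by rewrite [LHS]mobE [RHS]mobE [in LHS]mobE mob_model0 /= mulrA.
Qed.

Lemma rot_subproof (u : Sp1 R) : mob (origin R) u \in Mob0 R.
Proof. by apply/mem_set/mob_fix0. Qed.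

Definition rot (u : Sp1 R) : Mob0 R :=
  exist (fun F => F \in Mob0 R) (mob (origin R) u) (rot_subproof u).

Definition rot_phase (F : Mob0 R) : Sp1 R := mob_phase (val F).

Lemma rotK : cancel rot rot_phase.
Proof. by move=> u; rewrite /rot_phase mob_phase_mob. Qed.

Lemma rot_phaseK : cancel rot_phase rot.
Proof.
move=> F; apply: val_inj; rewrite /= /rot_phase -[RHS]mob_eta.
suff -> : inverse_orbit R (val F) = origin R by [].
by have := set_mem (valP F); rewrite /Mob0 /= -{1}[val F]mob_eta => /mob_fix0.
Qed.

Lemma rotE u q : val (val (val (rot u)) q) = val q * val u.
Proof. by rewrite mobE mob_model0. Qed.

Definition rot_mul (F G : Mob0 R) : Mob0 R :=
  rot (Sp1_mul R (rot_phase G) (rot_phase F)).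
Definition rot_inv (F : Mob0 R) : Mob0 R := rot (Sp1_conj (rot_phase F)).
Definition rot_act (F0 : Mob0 R) (F : Mob R) : Mob R :=
  mob (inverse_orbit R F) (Sp1_mul R (mob_phase F) (rot_phase F0)).

Lemma rot_mulE F G : val (val (rot_mul F G)) = val (val F) \o val (val G).
Proof.
by rewrite /rot_mul -{2}[F]rot_phaseK -{2}[G]rot_phaseK [RHS]mob_comp.
Qed.

Lemma rot_actE F0 F : val (rot_act F0 F) = val (val F0) \o val F.
Proof.
by rewrite /rot_act -{2}[F0]rot_phaseK -{3}[F]mob_eta [RHS]mob_comp.
Qed.

Lemma rot_is_group : is_group rot_mul (rot (Sp1_one R)) rot_inv.
Proof.
split.
- by move=> F G K; rewrite /rot_mul !rotK Sp1_mulA.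
- by move=> F; rewrite /rot_mul rotK Sp1_mulr1 rot_phaseK.
- by move=> F; rewrite /rot_mul rotK Sp1_mul1 rot_phaseK.
- by move=> F; rewrite /rot_mul /rot_inv rotK Sp1_mulV.
- by move=> F; rewrite /rot_mul /rot_inv rotK Sp1_mulVl.
Qed.

End MobGroup.

(** * Smoothness of the coordinates *)

Section Assembly.
Context (R : realType).
Variables (SG : atlas R (Sp11 R)) (SQ : atlas R (Sp11_quot R))
    (SM : atlas R (Mob R)) (S0 : atlas R (Mob0 R)) (S1 : atlas R (Sp1 R)).
Hypotheses (aSG : is_atlas SG) (aSQ : is_atlas SQ) (aSM : is_atlas SM)
  (aS0 : is_atlas S0) (aS1 : is_atlas S1).
Hypothesis (hSG_sub : embedding SG (qmx_atlas R) (fun A : Sp11 R => val A)).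
Hypothesis (hSQ_quot : submersion SG SQ (Sp11_proj R)).
Hypothesis (hSM_diffeo : diffeomorphism SQ SM (mobius_of_coset R)).
Hypothesis (hS0_sub : embedding S0 SM (fun F : Mob0 R => val F)).
Hypothesis (hS1_sub : embedding S1 (quat_atlas R) (fun u : Sp1 R => val u)).
Local Notation SB := (qball_atlas R).
Local Notation Q := (quat_atlas R).

Let aSB : is_atlas SB := manifold_atlas (qball_manifold R).
Let aQ : is_atlas Q := quat_is_atlas R.

Definition smooth_everywhere (T T' : choiceType) (S : atlas R T) (S' : atlas R T') (f : T -> T') :=
  forall x, smooth_at S S' f x.

Lemma smooth_everywhere_comp (T T' T'' : choiceType) (S : atlas R T) (S' : atlas R T')
    (S'' : atlas R T'') f g : is_atlas S -> is_atlas S' -> is_atlas S'' ->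
  smooth_everywhere S S' f -> smooth_everywhere S' S'' g -> smooth_everywhere S S'' (g \o f).
Proof. by move=> aS aS' aS'' fS gS x; exact: smooth_at_comp (fS x) (gS (f x)). Qed.

Lemma smooth_val_Sp11 i j : smooth_everywhere SG Q (fun A : Sp11 R => val A i j).
Proof.
move=> A; have [h _ _ _] := hSG_sub.
exact: (smooth_at_qmx aSG A (fun A : Sp11 R => val A)).1 ((smoothP _ aSG (qmx_is_atlas R)).1 h A) i j.
Qed.

Lemma smooth_val_Sp1 : smooth_everywhere S1 Q (fun u : Sp1 R => val u).
Proof. by have [h _ _ _] := hS1_sub; apply/(smoothP _ aS1 aQ). Qed.

Lemma smooth_val_Mob0 : smooth_everywhere S0 SM (fun F : Mob0 R => val F).
Proof. by have [h _ _ _] := hS0_sub; apply/(smoothP _ aS0 aSM). Qed.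

Lemma smooth_to_Sp1 (T : choiceType) (S : atlas R T) (f : T -> Sp1 R) : is_atlas S ->
  smooth_everywhere S Q (fun t => val (f t)) -> smooth_everywhere S S1 f.
Proof. by move=> aS fS; exact: (embedding_lift aS1 aQ aS hS1_sub fS). Qed.

Lemma smooth_mat_zero : smooth_everywhere SG SB (@mat_zero R).
Proof.
move=> A; apply/(smooth_at_qball aSG); rewrite /= /mx_zero.
apply: (smooth_at_qmul aSG); first exact: smooth_val_Sp11.
by apply: (smooth_at_qinv aSG); [exact: Sp11_d_neq0|exact: smooth_val_Sp11].
Qed.

Lemma smooth_mat_phase : smooth_everywhere SG S1 (@mat_phase R).
Proof.
apply: (smooth_to_Sp1 aSG) => A; rewrite /= /mx_phase.
apply: (smooth_at_qconj aSG); apply: (smooth_at_qmul aSG); first exact: smooth_val_Sp11.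
by apply: (smooth_at_qinv aSG); [exact: Sp11_d_neq0|exact: smooth_val_Sp11].
Qed.

(** On matrices both coordinates are quotients of entries. They are constant
    on cosets, so they descend through the submersion onto the quotient, and
    are then transported by the diffeomorphism. *)
Lemma smooth_mob_data : smooth_everywhere SM SB (inverse_orbit R) /\
  smooth_everywhere SM S1 (@mob_phase R).
Proof.
have [mS [g [gK Kg gS]]] := hSM_diffeo.
have {}gS := (smoothP _ aSM aSQ).1 gS.
have E F : F = mob (coset_zero (g F)) (coset_phase (g F)).
  by rewrite -mob_of_coset Kg.
split.
  have -> : inverse_orbit R = (@coset_zero R) \o g.
    by apply/funext => F; rewrite [in LHS](E F) inverse_orbit_mob.
  apply: (smooth_everywhere_comp aSM aSQ aSB gS).
  apply: (submersion_descent aSG aSQ aSB hSQ_quot).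
  have -> : (@coset_zero R) \o Sp11_proj R = @mat_zero R.
    by apply/funext => A; rewrite /= coset_zero_proj.
  exact: smooth_mat_zero.
have -> : @mob_phase R = (@coset_phase R) \o g.
  by apply/funext => F; rewrite [in LHS](E F) mob_phase_mob.
apply: (smooth_everywhere_comp aSM aSQ aS1 gS).
apply: (submersion_descent aSG aSQ aS1 hSQ_quot).
have -> : (@coset_phase R) \o Sp11_proj R = @mat_phase R.
  by apply/funext => A; rewrite /= coset_phase_proj.
exact: smooth_mat_phase.
Qed.

(** The transformation is the class of the matrix [boost], which is smooth
    into the space of all matrices and therefore into the embedded submanifold
    Sp(1,1). *)
Lemma smooth_mob (T : choiceType) (S : atlas R T) (f : T -> qball R) (g : T -> Sp1 R) : is_atlas S ->
  smooth_everywhere S SB f -> smooth_everywhere S S1 g ->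
  smooth_everywhere S SM (fun t => mob (f t) (g t)).
Proof.
move=> aS fS gS.
have [mS _] := hSM_diffeo; have {}mS := (smoothP _ aSQ aSM).1 mS.
have [pS _ _] := hSQ_quot; have {}pS := (smoothP _ aSG aSQ).1 pS.
rewrite mob.unlock.
apply: (@smooth_everywhere_comp _ _ _ S SQ SM (fun t => Sp11_proj R (mat_boost (f t) (g t)))
  (mobius_of_coset R) aS aSQ aSM) mS.
apply: (@smooth_everywhere_comp _ _ _ S SG SQ (fun t => mat_boost (f t) (g t))
  (Sp11_proj R) aS aSG aSQ) pS.
apply: (embedding_lift aSG (qmx_is_atlas R) aS hSG_sub) => t.
have fQ : smooth_at S Q (fun t => val (f t)) t by apply/(smooth_at_qball aS).
have gQ : smooth_at S Q (fun t => val (g t)) t.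
  by apply: (smooth_everywhere_comp aS aS1 aQ gS smooth_val_Sp1).
have gaQ : smooth_at S Q (fun t => gamma (val (f t))) t.
  by apply: (smooth_at_gamma aS) => //; exact: qball_in.
apply/(smooth_at_qmx aS) => i j; rewrite /= /boost.
under [X in smooth_at _ _ X]funext do rewrite mxE.
case: (i == 0); case: (j == 0) => //.
- by apply: (smooth_at_qmul aS) => //; exact: smooth_at_qconj.
- apply: (smooth_at_qmul aS) => //; apply: (smooth_at_qmul aS); exact: smooth_at_qconj.
- exact: smooth_at_qmul.
Qed.

Lemma smooth_Sp1_mul (T : choiceType) (S : atlas R T) (f g : T -> Sp1 R) : is_atlas S ->
  smooth_everywhere S S1 f -> smooth_everywhere S S1 g ->
  smooth_everywhere S S1 (fun t => Sp1_mul R (f t) (g t)).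
Proof.
move=> aS fS gS; apply: (smooth_to_Sp1 aS) => t.
apply: (smooth_at_qmul aS).
  exact: (smooth_everywhere_comp aS aS1 aQ fS smooth_val_Sp1).
exact: (smooth_everywhere_comp aS aS1 aQ gS smooth_val_Sp1).
Qed.

Lemma smooth_Sp1_conj (T : choiceType) (S : atlas R T) (f : T -> Sp1 R) : is_atlas S ->
  smooth_everywhere S S1 f -> smooth_everywhere S S1 (fun t => Sp1_conj (f t)).
Proof.
move=> aS fS; apply: (smooth_to_Sp1 aS) => t; apply: (smooth_at_qconj aS).
exact: (smooth_everywhere_comp aS aS1 aQ fS smooth_val_Sp1).
Qed.

(** The group of rotations is embedded, so it suffices to be smooth as a
    transformation. *)
Lemma smooth_rot (T : choiceType) (S : atlas R T) (f : T -> Sp1 R) : is_atlas S ->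
  smooth_everywhere S S1 f -> smooth_everywhere S S0 (fun t => rot (f t)).
Proof.
move=> aS fS; apply: (embedding_lift aS0 aSM aS hS0_sub).
by apply: (smooth_mob aS _ fS) => t; exact: smooth_at_cst.
Qed.

Lemma smooth_rot_phase (T : choiceType) (S : atlas R T) (f : T -> Mob0 R) : is_atlas S ->
  smooth_everywhere S S0 f -> smooth_everywhere S S1 (fun t => rot_phase (f t)).
Proof.
move=> aS fS.
apply: (@smooth_everywhere_comp _ _ _ S S0 S1 f (@rot_phase R) aS aS0 aS1 fS).
exact: (smooth_everywhere_comp aS0 aSM aS1 smooth_val_Mob0 smooth_mob_data.2).
Qed.

Lemma smooth_mob_phase (T : choiceType) (S : atlas R T) (f : T -> Mob R) : is_atlas S ->
  smooth_everywhere S SM f -> smooth_everywhere S S1 (fun t => mob_phase (f t)).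
Proof. by move=> aS fS; exact: (smooth_everywhere_comp aS aSM aS1 fS smooth_mob_data.2). Qed.

Lemma smooth_inverse_orbit (T : choiceType) (S : atlas R T) (f : T -> Mob R) : is_atlas S ->
  smooth_everywhere S SM f -> smooth_everywhere S SB (fun t => inverse_orbit R (f t)).
Proof. by move=> aS fS; exact: (smooth_everywhere_comp aS aSM aSB fS smooth_mob_data.1). Qed.

End Assembly.

(** * The principal bundle *)

(** Used for pairs of transformations with the same zero, on which the action
    is inverted. *)
Lemma equalizer_closed (X Y : topologicalType) (f g : X -> Y) :
  hausdorff_space Y -> continuous f -> continuous g ->
  closed [set x | f x = g x].
Proof.
move=> hY fc gc x clx; apply: hY => A B Afx Bgx.
have [y [fgy [Ay By]]] := clx _ (@filterI _ (nbhs x) _ _ _ (fc x A Afx) (gc x B Bgx)).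
by exists (f y); split=> //; rewrite fgy.
Qed.

Theorem corollary4p3p3 (R : realType)
    (SG : atlas R (Sp11 R)) (SQ : atlas R (Sp11_quot R))
    (SM : atlas R (Mob R)) (S0 : atlas R (Mob0 R)) (S1 : atlas R (Sp1 R))
    (hSG : is_manifold SG)
    (hSG_sub : embedding SG (qmx_atlas R) (fun A : Sp11 R => val A))
    (hSQ : is_manifold SQ)
    (hSQ_quot : submersion SG SQ (Sp11_proj R))
    (hSM : is_manifold SM)
    (hSM_diffeo : diffeomorphism SQ SM (mobius_of_coset R))
    (hS0 : is_manifold S0)
    (hS0_sub : embedding S0 SM (fun F : Mob0 R => val F))
    (hS1 : is_manifold S1)
    (hS1_sub : embedding S1 (quat_atlas R) (fun u : Sp1 R => val u)) :
  exists (mul : Mob0 R -> Mob0 R -> Mob0 R) (one : Mob0 R)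
      (inv : Mob0 R -> Mob0 R) (act : Mob0 R -> Mob R -> Mob R),
    [/\ (forall F G : Mob0 R,
          val (val (mul F G)) = val (val F) \o val (val G)),
        (forall (F0 : Mob0 R) (F : Mob R),
          val (act F0 F) = val (val F0) \o val F),
        (exists rho : Sp1 R -> Mob0 R,
          (forall (u : Sp1 R) (q : qball R),
            val (val (val (rho u)) q) = val q * (val u)^-1) /\
          is_lie_isomorphism S1 (Sp1_mul R) S0 mul rho),
        is_principal_bundle SM (qball_atlas R) S0 mul one inv act
          (inverse_orbit R) &
        is_globally_trivial SM (qball_atlas R) S0 mul act (inverse_orbit R)].
Proof.
have aSG := manifold_atlas hSG; have aSQ := manifold_atlas hSQ.
have aSM := manifold_atlas hSM; have aS0 := manifold_atlas hS0.
have aS1 := manifold_atlas hS1; have hSB := qball_manifold R.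
have aSB := manifold_atlas hSB.
have smob := smooth_mob aSG aSQ aSM aS1 hSG_sub hSQ_quot hSM_diffeo hS1_sub.
have sphase := smooth_mob_phase aSG aSQ aSM aS1 hSG_sub hSQ_quot hSM_diffeo hS1_sub.
have szero := smooth_inverse_orbit aSG aSQ aSM aS1 hSG_sub hSQ_quot hSM_diffeo hS1_sub.
have srot := smooth_rot aSG aSQ aSM aS0 aS1 hSG_sub hSQ_quot hSM_diffeo hS0_sub hS1_sub.
have srphase := smooth_rot_phase aSG aSQ aSM aS0 aS1 hSG_sub hSQ_quot hSM_diffeo hS0_sub hS1_sub.
have smul := smooth_Sp1_mul aS1 hS1_sub.
have sconj := smooth_Sp1_conj aS1 hS1_sub.
have sid (T : choiceType) (S : atlas R T) : is_atlas S -> smooth_everywhere S S id.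
  by move=> aS x; exact: smooth_at_id.
have sfst (T T' : choiceType) (S : atlas R T) (S' : atlas R T') : is_atlas S -> is_atlas S' ->
    smooth_everywhere (prod_atlas S S') S fst.
  by move=> aS aS' x; exact: smooth_at_fst.
have ssnd (T T' : choiceType) (S : atlas R T) (S' : atlas R T') : is_atlas S -> is_atlas S' ->
    smooth_everywhere (prod_atlas S S') S' snd.
  by move=> aS aS' x; exact: smooth_at_snd.
have a00 := prod_is_atlas aS0 aS0; have a0M := prod_is_atlas aS0 aSM.
have aMM := prod_is_atlas aSM aSM; have aB0 := prod_is_atlas aSB aS0.
have piS : smooth SM (qball_atlas R) (inverse_orbit R).
  by apply/(smoothP _ aSM aSB); exact: szero aSM (sid _ _ aSM).
(* The inverse of this trivialization is F |-> (zero of F, phase of F). *)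
have triv : is_trivialization SM (qball_atlas R) S0 (@rot_mul R) (@rot_act R)
    (inverse_orbit R) setT (fun p => mob p.1 (rot_phase p.2)).
  split.
  - by move=> al F _; rewrite /= inverse_orbit_mob.
  - move=> al F G _; rewrite /rot_act /rot_mul /=.
    by rewrite inverse_orbit_mob mob_phase_mob rotK.
  - rewrite setXTT; apply/(smoothP _ aB0 aSM).
    exact: smob aB0 (sfst _ _ _ _ aSB aS0) (srphase _ _ _ aB0 (ssnd _ _ _ _ aSB aS0)).
  - exists (fun F => (inverse_orbit R F, rot (mob_phase F))); split.
    + by move=> al F _ /=; rewrite inverse_orbit_mob mob_phase_mob rot_phaseK.
    + by move=> F _; rewrite /= rotK mob_eta.
    + rewrite preimage_setT; apply/(smoothP _ aSM aB0) => F.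
      apply: smooth_at_pair => //; first exact: szero aSM (sid _ _ aSM) F.
      exact: srot aSM (sphase _ _ _ aSM (sid _ _ aSM)) F.
exists (@rot_mul R), (rot (Sp1_one R)), (@rot_inv R), (@rot_act R); split.
- exact: rot_mulE.
- exact: rot_actE.
(* Composing right multiplications reverses products, whence the inverse. *)
- exists (fun u => rot (Sp1_conj u)); split.
    by move=> u q; rewrite rotE Sp1_conjE.
  split; first by move=> u v; rewrite /rot_mul !rotK Sp1_conjM.
  split; first by apply/(smoothP _ aS1 aS0); exact: srot aS1 (sconj _ _ _ aS1 (sid _ _ aS1)).
  exists (fun F => Sp1_conj (rot_phase F)); split.
  + by move=> u; rewrite rotK Sp1_conjK.
  + by move=> F; rewrite Sp1_conjK rot_phaseK.
  + by apply/(smoothP _ aS0 aS1); exact: sconj aS0 (srphase _ _ _ aS0 (sid _ _ aS0)).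
- split => //.
  + split => //; first exact: rot_is_group.
      apply/(smoothP _ a00 aS0); apply: srot => //; apply: smul => //.
        exact: srphase a00 (ssnd _ _ _ _ aS0 aS0).
      exact: srphase a00 (sfst _ _ _ _ aS0 aS0).
    apply/(smoothP _ aS0 aS0); apply: srot => //; apply: sconj => //.
    exact: srphase aS0 (sid _ _ aS0).
  + apply: submersion_of_sections => //.
      by move=> al _; exists (mob al (Sp1_one R)) => //; rewrite inverse_orbit_mob.
    (* The section through F keeps the phase of F constant. *)
    move=> F; exists (fun al => mob al (mob_phase F)).
      apply/(smoothP _ aSB aSM); apply: smob => //; first exact: sid.
      by move=> al; exact: smooth_at_cst.
    split; first by rewrite mob_eta.
    by move=> al; rewrite inverse_orbit_mob.
  + have actS : smooth (prod_atlas S0 SM) SM (fun gp => rot_act gp.1 gp.2).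
      apply/(smoothP _ a0M aSM); apply: smob => //.
        exact: szero a0M (ssnd _ _ _ _ aS0 aSM).
      apply: smul => //; first exact: sphase a0M (ssnd _ _ _ _ aS0 aSM).
      exact: srphase a0M (sfst _ _ _ _ aS0 aSM).
    split => //.
    * by move=> F; rewrite /rot_act rotK Sp1_mulr1 mob_eta.
    * move=> F G K; rewrite /rot_act /rot_mul rotK inverse_orbit_mob mob_phase_mob.
      by rewrite Sp1_mulA.
    * move=> F0 F /(congr1 (@mob_phase R)); rewrite /rot_act mob_phase_mob => E.
      rewrite -[F0]rot_phaseK; congr rot.
      by rewrite -[LHS]Sp1_mul1 -(Sp1_mulVl (mob_phase F)) -Sp1_mulA E Sp1_mulVl.
    * move=> K Kc.
      pose E := [set z : Mob R * Mob R | inverse_orbit R z.1 = inverse_orbit R z.2].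
      (* D recovers (F_0, F) from (F', F) when F' = F_0 o F, that is, on E. *)
      pose D (z : Mob R * Mob R) : Mob0 R * Mob R :=
        (rot (Sp1_mul R (Sp1_conj (mob_phase z.2)) (mob_phase z.1)), z.2).
      have Dc : continuous (D : mspace (prod_atlas SM SM) -> mspace (prod_atlas S0 SM)).
        apply: smooth_continuous => //; apply/(smoothP _ aMM a0M) => z.
        apply: smooth_at_pair => //; last exact: ssnd.
        apply: (srot _ _ _ aMM) => //; apply: smul => //.
          exact: sconj aMM (sphase _ _ _ aMM (ssnd _ _ _ _ aSM aSM)).
        exact: sphase aMM (sfst _ _ _ _ aSM aSM).
      have Ecl : closed (E : set (mspace (prod_atlas SM SM))).
        have [_ _ _ hB _] := hSB.
        apply: (@equalizer_closed (mspace (prod_atlas SM SM)) (mspace (qball_atlas R))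
          (fun z => inverse_orbit R z.1) (fun z => inverse_orbit R z.2) hB).
          apply: smooth_continuous => //; apply/(smoothP _ aMM aSB).
          exact: szero aMM (sfst _ _ _ _ aSM aSM).
        apply: smooth_continuous => //; apply/(smoothP _ aMM aSB).
        exact: szero aMM (ssnd _ _ _ _ aSM aSM).
      have -> : [set gp | K (rot_act gp.1 gp.2, gp.2)] = D @` (K `&` E).
        apply/seteqP; split=> [[g p] /= Kgp|_ [[p' p] [Kp Epp] <-]].
          exists (rot_act g p, p).
            by split=> //; rewrite /E /= /rot_act inverse_orbit_mob.
          rewrite /D /= /rot_act mob_phase_mob Sp1_mulA Sp1_mulVl Sp1_mul1.
          by rewrite rot_phaseK.
        rewrite /D /= /rot_act rotK Sp1_mulA Sp1_mulV Sp1_mul1.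
        by move: Epp; rewrite /E /= => <-; rewrite mob_eta.
      apply: (@continuous_compact (mspace (prod_atlas SM SM))
        (mspace (prod_atlas S0 SM)) D (K `&` E)).
        exact: continuous_subspaceT.
      exact: (@compact_closedI (mspace (prod_atlas SM SM)) K E Kc Ecl).
  + move=> F G; split=> [E|[g ->]]; last by rewrite /rot_act inverse_orbit_mob.
    exists (rot (Sp1_mul R (Sp1_conj (mob_phase F)) (mob_phase G))).
    by rewrite /rot_act rotK Sp1_mulA Sp1_mulV Sp1_mul1 E mob_eta.
  + move=> al; exists setT; split=> //; first exact: openT.
    by exists (fun p => mob p.1 (rot_phase p.2)).
- by exists (fun p => mob p.1 (rot_phase p.2)).
Qed.
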